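(* Let $X$ be a non-orientable Klein surface with non-empty boundary, let $DX$ be its double of doubles and let $\langle s,t\rangle\cong C_2\times C_2$ be the group of conformal and anticonformal automorphisms of $DX$ with $DX/\langle s,t\rangle=X$. Then the action of $\langle s,t\rangle$ on $DX$ is not given by restricting a finite group of isometries of Euclidean space to a classical Riemann surface. That is, there do not exist a classical Riemann surface $T\subset\mathbb{R}^3$, a finite group $G$ of isometries of $\mathbb{R}^3$ leaving $T$ invariant, and a conformal or anticonformal homeomorphism $f:DX\to T$ such that $f\langle s,t\rangle f^{-1}=\{\gamma|_T:\gamma\in G\}$.
   Context: A (compact) Klein surface is a compact connected surface, possibly non-orientable and possibly with boundary, with a dianalytic structure (charts into open subsets of the closed upper half-plane, transition functions analytic or anti-analytic). A classical Riemann surface is a (compact, connected, without boundary) smooth surface embedded in Euclidean space $\mathbb{R}^3$, with the Riemann surface structure induced by restricting the Euclidean metric to it. A non-orientable Klein surface $X$ of genus $g\ge1$ with $k\ge1$ boundary components is a quotient $\mathcal{S}/\Gamma$, where $\mathcal{S}$ is the upper half-plane if $g+k-1>1$ and $\mathcal{S}=\mathbb{C}$ if $g+k-1=1$, and $\Gamma$ is a (non-Euclidean, respectively Euclidean) crystallographic group without elliptic elements, with canonical presentation $$\langle d_1,\dots,d_g,e_1,\dots,e_k,c_1,\dots,c_k \mid d_1^2\cdots d_g^2e_1\cdots e_k=1,\ c_i^2=1,\ e_ic_ie_i^{-1}=c_i\ (1\le i\le k)\rangle,$$ where the $d_i$ are glide reflections, the $e_i$ are orientation preserving and the $c_i$ are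 reflections. Let $\omega:\Gamma\to C_2\times C_2=\langle s,t\rangle$ be defined by $d_i\mapsto t$, $e_i\mapsto 1$, $c_i\mapsto s$. The double of doubles of $X$ is the Riemann surface $DX=\mathcal{S}/\ker\omega$, on which $\langle s,t\rangle\cong\Gamma/\ker\omega$ acts by conformal and anticonformal automorphisms ($s$ and $t$ anticonformal, $st$ conformal) with $DX/\langle s,t\rangle=X$. *)

(* Defs.v *)
From HB Require Import structures.
From mathcomp Require Import all_boot all_order all_algebra all_fingroup.
From mathcomp Require Import all_classical all_reals all_analysis.
From mathcomp Require Import complex.

Set Implicit Arguments.
Unset Strict Implicit.
Unset Printing Implicit Defensive.

Import Order.TTheory GRing.Theory Num.Theory.
Import numFieldNormedType.Exports.

Local Open Scope classical_set_scope.
Local Open Scope complex_scope.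
Local Open Scope ring_scope.

(** ** Holomorphic maps *)

(* The field of complex numbers, with its topology; ^o makes it a normed module
   over itself, so that [derivable] below is complex differentiability. *)
Notation CC R := (R[i]^o).

Definition holomorphic_on (R : realType) (W : set (CC R)) (f : CC R -> CC R) :
    Prop :=
  forall z, W z -> derivable f z 1.

Definition antiholomorphic_on (R : realType) (W : set (CC R))
    (f : CC R -> CC R) : Prop :=
  holomorphic_on W (fun z => (f z)^*).

(** ** Klein surfaces *)

Definition closed_half_plane (R : realType) : set (CC R) :=
  [set z | 0 <= complex.Im z].
Arguments closed_half_plane : clear implicits.

(* [coord] is only meaningful on [dom]. *)
Record chart (R : realType) (X : Type) := Chart {
  dom : set X;
  coord : X -> CC R }.

(* A homeomorphism from an open subset of X onto a relatively open subset of
   the closed upper half-plane.  The last clause, which says that [coord] is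
   an open map, covers both the openness of the image and the continuity of
   the inverse. *)
Definition is_chart (R : realType) (X : topologicalType) (phi : chart R X) :
    Prop :=
  [/\ open (dom phi),
      {in dom phi &, injective (coord phi)},
      forall x, dom phi x -> {for x, continuous (coord phi)} &
      forall V : set X, open V -> V `<=` dom phi ->
        exists2 O : set (CC R), open O &
          coord phi @` V = O `&` closed_half_plane R].

(* [tau] represents the transition function [coord psi \o (coord phi)^-1] on
   a neighbourhood W of the point [coord phi x] of C: at boundary points,
   analyticity means analyticity of an extension across the real axis. *)
Definition represents_transition (R : realType) (X : Type)
    (phi psi : chart R X) (x : X) (W : set (CC R)) (tau : CC R -> CC R) : Prop :=
  [/\ open W, W (coord phi x) &
      forall y, dom phi y -> dom psi y -> W (coord phi y) ->
        coord psi y = tau (coord phi y)].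

Definition analytic_transition (R : realType) (X : Type)
    (phi psi : chart R X) : Prop :=
  forall x, dom phi x -> dom psi x ->
  exists W tau, represents_transition phi psi x W tau /\ holomorphic_on W tau.

(* Analytic or antianalytic near each point, i.e. on each connected component
   of the domain of the transition function. *)
Definition dianalytic_transition (R : realType) (X : Type)
    (phi psi : chart R X) : Prop :=
  forall x, dom phi x -> dom psi x ->
  exists W tau, represents_transition phi psi x W tau /\
    (holomorphic_on W tau \/ antiholomorphic_on W tau).

Definition atlas_covers (R : realType) (X : Type) (A : set (chart R X)) :
    Prop :=
  forall x, exists2 phi, A phi & dom phi x.

Definition klein_surface (R : realType) (X : topologicalType)
    (A : set (chart R X)) : Prop :=
  [/\ compact [set: X], connected [set: X] & hausdorff_space X] /\
  [/\ forall phi, A phi -> is_chart phi,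
      atlas_covers A &
      forall phi psi, A phi -> A psi -> dianalytic_transition phi psi].

(* The dianalytic structure defined by A contains an analytic atlas. *)
Definition orientable (R : realType) (X : topologicalType)
    (A : set (chart R X)) : Prop :=
  exists B : set (chart R X),
    [/\ forall phi, B phi -> is_chart phi,
        forall phi psi, B phi -> A psi ->
          dianalytic_transition phi psi /\ dianalytic_transition psi phi,
        atlas_covers B &
        forall phi psi, B phi -> B psi -> analytic_transition phi psi].

Definition klein_boundary (R : realType) (X : topologicalType)
    (A : set (chart R X)) : set X :=
  [set x | exists2 phi, A phi & dom phi x /\ complex.Im (coord phi x) = 0].

(** ** The universal covering geometries and their isometries *)

(* The upper half-plane with the hyperbolic metric if [hyp] holds, and the
   complex plane with the Euclidean metric otherwise. *)
Definition plane (R : realType) (hyp : bool) : set (CC R) :=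
  if hyp then [set z | 0 < complex.Im z] else setT.
Arguments plane : clear implicits.

(* Orientation-preserving isometries of [plane hyp]. *)
Definition direct_isometry (R : realType) (hyp : bool) (m : CC R -> CC R) :
    Prop :=
  if hyp then
    exists a b c d : R, 0 < a * d - b * c /\
      forall z, plane R hyp z -> m z = (a%:C * z + b%:C) / (c%:C * z + d%:C)
  else
    exists a b : CC R, `|a| = 1 /\ forall z, m z = a * z + b.

(* Orientation-reversing isometries of [plane hyp]: z |-> - z^* is one of
   them, so the others are its composites with direct isometries. *)
Definition opposite_isometry (R : realType) (hyp : bool) (m : CC R -> CC R) :
    Prop :=
  direct_isometry hyp (fun z => m (- z^*)).

Definition has_fixpoint (R : realType) (hyp : bool) (m : CC R -> CC R) :
    Prop :=
  exists2 z, plane R hyp z & m z = z.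

(* An orientation-reversing isometry of either geometry is a reflection if it
   has a fixed point in the plane, and a glide reflection otherwise. *)
Definition reflection (R : realType) (hyp : bool) (m : CC R -> CC R) : Prop :=
  opposite_isometry hyp m /\ has_fixpoint hyp m.

Definition glide_reflection (R : realType) (hyp : bool) (m : CC R -> CC R) :
    Prop :=
  opposite_isometry hyp m /\ ~ has_fixpoint hyp m.

(* A nontrivial orientation-preserving isometry with a fixed point. *)
Definition elliptic (R : realType) (hyp : bool) (m : CC R -> CC R) : Prop :=
  [/\ direct_isometry hyp m, has_fixpoint hyp m &
      exists2 z, plane R hyp z & m z <> z].

(** ** Crystallographic groups *)

(* [rho] identifies Gamma with a discrete cocompact group of isometries of
   [plane hyp]; discreteness is expressed as proper discontinuity. *)
Definition crystallographic (R : realType) (hyp : bool) (Gamma : groupType)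
    (rho : Gamma -> CC R -> CC R) : Prop :=
  [/\ forall z, plane R hyp z -> rho 1%g z = z,
      forall x y z, plane R hyp z -> rho (x * y)%g z = rho x (rho y z),
      forall x, (forall z, plane R hyp z -> rho x z = z) -> x = 1%g &
      forall x, direct_isometry hyp (rho x) \/ opposite_isometry hyp (rho x)] /\
  [/\ forall K : set (CC R), compact K -> K `<=` plane R hyp ->
        finite_set [set x | exists2 z, K z & K (rho x z)] &
      exists K : set (CC R), [/\ compact K, K `<=` plane R hyp &
        forall z, plane R hyp z -> exists x, K (rho x z)]].

(* The relations d_1^2 ... d_g^2 e_1 ... e_k = 1, c_i^2 = 1 and
   e_i c_i e_i^-1 = c_i *)
Definition canonical_relations (g k : nat) (H : groupType)
    (d : 'I_g -> H) (e c : 'I_k -> H) : Prop :=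
  [/\ ((\big[*%g/1]_(i < g) d i ^+ 2) * \big[*%g/1]_(i < k) e i = 1)%g,
      forall i, (c i ^+ 2 = 1)%g &
      forall i, (e i * c i * (e i)^-1 = c i)%g].

(* Gamma is generated by the d_i, e_i, c_i (it is its only subgroup containing
   them), and the canonical relations are defining: families satisfying them
   in any group are the images of d, e, c under a homomorphism. *)
Definition canonical_presentation (g k : nat) (Gamma : groupType)
    (d : 'I_g -> Gamma) (e c : 'I_k -> Gamma) : Prop :=
  [/\ canonical_relations d e c,
      forall P : set Gamma,
        P 1%g -> (forall x y, P x -> P y -> P (x * y)%g) ->
        (forall x, P x -> P x^-1%g) ->
        (forall i, P (d i)) -> (forall i, P (e i)) -> (forall i, P (c i)) ->
        P = setT &
      forall (H : groupType) (d' : 'I_g -> H) (e' c' : 'I_k -> H),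
        canonical_relations d' e' c' ->
        exists h : {multiplicative Gamma -> H},
          [/\ forall i, h (d i) = d' i, forall i, h (e i) = e' i &
              forall i, h (c i) = c' i]].

(* The hyperbolic case of a surface with g cross-caps and k boundary
   components; for g, k >= 1 the only other case is g = k = 1. *)
Definition hyperbolic_type (g k : nat) : bool := (1 < g + k - 1)%N.

(* Gamma, acting through [rho], is a crystallographic group without elliptic
   elements, with canonical generators d, e, c. *)
Definition klein_surface_group (R : realType) (g k : nat) (Gamma : groupType)
    (rho : Gamma -> CC R -> CC R)
    (d : 'I_g -> Gamma) (e c : 'I_k -> Gamma) : Prop :=
  let hyp := hyperbolic_type g k in
  [/\ crystallographic hyp rho,
      forall x, ~ elliptic hyp (rho x) &
      canonical_presentation d e c] /\
  [/\ forall i, glide_reflection hyp (rho (d i)),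
      forall i, direct_isometry hyp (rho (e i)) &
      forall i, reflection hyp (rho (c i))].

(** ** Quotients of the plane *)

(* Y, with projection p, is the topological space of the orbits in S of the
   set Lambda of elements of Gamma (S is open in C). *)
Definition orbit_space (R : realType) (S : set (CC R)) (Gamma : Type)
    (rho : Gamma -> CC R -> CC R) (Lambda : set Gamma)
    (Y : topologicalType) (p : CC R -> Y) : Prop :=
  [/\ forall y, exists2 z, S z & p z = y,
      forall z w, S z -> S w ->
        p z = p w <-> exists2 x, Lambda x & w = rho x z &
      forall U : set Y, open U <-> open (S `&` p @^-1` U)].

(* The folding map x + iy |-> x + i|y| of C onto the closed half-plane *)
Definition folding (R : realType) (z : CC R) : CC R :=
  complex.Re z +i* `|complex.Im z|.

(* Read in the charts of A, the projection p is near each point of S a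
   biholomorphism (F, with inverse F') followed by folding: A defines the
   quotient dianalytic structure.  As no elliptic element is present, p is not
   branched. *)
Definition quotient_dianalytic (R : realType) (S : set (CC R)) (X : Type)
    (A : set (chart R X)) (p : CC R -> X) : Prop :=
  forall z0 phi, S z0 -> A phi -> dom phi (p z0) ->
  exists (V W : set (CC R)) (F F' : CC R -> CC R),
    [/\ open V, V z0, V `<=` S & open W] /\
    [/\ holomorphic_on V F,
        holomorphic_on W F',
        forall z, V z -> W (F z) /\ F' (F z) = z,
        forall w, W w -> V (F' w) /\ F (F' w) = w &
        forall z, V z -> dom phi (p z) /\ coord phi (p z) = folding (F z)].

(* The Klein surface (X, A) is the quotient S/Gamma, with projection p. *)
Definition klein_quotient (R : realType) (S : set (CC R)) (Gamma : Type)
    (rho : Gamma -> CC R -> CC R) (X : topologicalType)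
    (A : set (chart R X)) (p : CC R -> X) : Prop :=
  orbit_space S rho setT p /\ quotient_dianalytic S A p.

(** ** The double of doubles *)

(* C_2 x C_2, written multiplicatively: the group law of 'Z_2 as a
   [groupType] is addition modulo 2, with unit 1%g = Zp0. *)
Notation C2xC2 := ('Z_2 * 'Z_2)%type.
Definition gen_s : C2xC2 := (Zp1, 1%g).
Definition gen_t : C2xC2 := (1%g, Zp1).

(* The homomorphism omega *)
Definition doubling_hom (g k : nat) (Gamma : groupType)
    (d : 'I_g -> Gamma) (e c : 'I_k -> Gamma)
    (omega : {multiplicative Gamma -> C2xC2}) : Prop :=
  [/\ forall i, omega (d i) = gen_t, forall i, omega (e i) = 1%g &
      forall i, omega (c i) = gen_s].

(* The action of <s,t> = Gamma / ker omega on D = S / ker omega, where q is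
   the projection of S onto D *)
Definition induced_action (R : realType) (S : set (CC R)) (Gamma : groupType)
    (rho : Gamma -> CC R -> CC R) (omega : Gamma -> C2xC2)
    (D : Type) (q : CC R -> D) (act : C2xC2 -> D -> D) : Prop :=
  forall x z, S z -> act (omega x) (q z) = q (rho x z).

(** ** Classical Riemann surfaces *)

Notation E3 R := 'rV[R]_3.

Definition dot3 (R : realType) (u v : E3 R) : R := (u *m v^T) 0 0.

Definition cross3 (R : realType) (u v : E3 R) : E3 R :=
  let i0 : 'I_3 := inord 0 in
  let i1 : 'I_3 := inord 1 in
  let i2 : 'I_3 := inord 2 in
  \row_(j < 3)
    if j == i0 then u 0 i1 * v 0 i2 - u 0 i2 * v 0 i1
    else if j == i1 then u 0 i2 * v 0 i0 - u 0 i0 * v 0 i2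
    else u 0 i0 * v 0 i1 - u 0 i1 * v 0 i0.

Definition iter_derive (R : realType) (vs : seq (E3 R)) (f : E3 R -> E3 R) :
    E3 R -> E3 R :=
  foldr (fun v h x => 'D_v h x) f vs.

(* C^infinity on the open set U *)
Definition smooth_on (R : realType) (U : set (E3 R)) (f : E3 R -> E3 R) :
    Prop :=
  forall vs x, U x -> differentiable (iter_derive vs f) x.

(* Smooth embedded surface: near each of its points, T is carried to the plane
   x_3 = 0 by a diffeomorphism Phi between open subsets of R^3. *)
Definition embedded_surface (R : realType) (T : set (E3 R)) : Prop :=
  forall y, T y ->
  exists (U V : set (E3 R)) (Phi Psi : E3 R -> E3 R),
    [/\ open U, U y, open V & Phi @` U = V] /\
    [/\ smooth_on U Phi, smooth_on V Psi,
        forall x, U x -> Psi (Phi x) = x &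
        forall x, U x -> T x <-> Phi x 0 ord_max = 0].

Definition tangent_vector (R : realType) (T : set (E3 R)) (y v : E3 R) :
    Prop :=
  exists u : R -> E3 R,
    [/\ u 0 = y, \forall t \near (0 : R), T (u t) & is_derive (0 : R) 1 u v].

(* A continuous unit normal field, i.e. an orientation of T *)
Definition unit_normal (R : realType) (T : set (E3 R)) (N : E3 R -> E3 R) :
    Prop :=
  [/\ {within T, continuous N},
      forall y, T y -> dot3 (N y) (N y) = 1 &
      forall y v, T y -> tangent_vector T y v -> dot3 (N y) v = 0].

(* The metric and the orientation N determine the complex structure of T:
   multiplication by i in the tangent plane at y is the rotation by a right
   angle v |-> N y x v. *)
Definition classical_riemann_surface (R : realType) (T : set (E3 R))
    (N : E3 R -> E3 R) : Prop :=
  [/\ T !=set0, compact T, connected T, embedded_surface T & unit_normal T N].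

(* F, as a map of two real variables, is differentiable at z, and its
   differential is nonzero and complex linear from C to the tangent plane of T
   at F z. *)
Definition conformal_at (R : realType) (N : E3 R -> E3 R)
    (F : CC R -> E3 R) (z : CC R) : Prop :=
  let F2 := fun u : R * R => F (u.1 +i* u.2) in
  let z2 : R * R := (complex.Re z, complex.Im z) in
  [/\ differentiable F2 z2,
      'd F2 z2 (1, 0) != 0 &
      'd F2 z2 (0, 1) = cross3 (N (F z)) ('d F2 z2 (1, 0))].

(* The complex structure of D being the one for which q : S -> D is a local
   biholomorphism, f : D -> T is conformal if and only if f \o q is; it is
   anticonformal if it is conformal for the other orientation of T. *)
Definition conformal_or_anticonformal (R : realType) (S : set (CC R))
    (D : Type) (q : CC R -> D) (N : E3 R -> E3 R) (f : D -> E3 R) : Prop :=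
  (forall z, S z -> conformal_at N (f \o q) z) \/
  (forall z, S z -> conformal_at (fun y => - N y) (f \o q) z).

Definition homeomorphism_onto (R : realType) (D : topologicalType)
    (T : set (E3 R)) (f : D -> E3 R) : Prop :=
  [/\ continuous f, range f = T &
      exists2 f' : E3 R -> D, cancel f f' & {within T, continuous f'}].

(** ** Finite groups of isometries of Euclidean space *)

(* The norm of 'rV[R]_3 in the library is the sup norm, hence [dot3]. *)
Definition isometry3 (R : realType) (m : E3 R -> E3 R) : Prop :=
  forall x y, dot3 (m x - m y) (m x - m y) = dot3 (x - y) (x - y).

Definition finite_isometry_group (R : realType) (G : set (E3 R -> E3 R)) :
    Prop :=
  [/\ finite_set G, forall m, G m -> isometry3 m & G idfun] /\
  [/\ forall m n, G m -> G n -> G (m \o n) &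
      forall m, G m -> exists2 n, G n & cancel m n /\ cancel n m].

(* Main.v *)
Require Import Defs.
From HB Require Import structures.
From mathcomp Require Import all_boot all_order all_algebra all_fingroup.
From mathcomp Require Import all_classical all_reals all_analysis.
From mathcomp Require Import complex.
From mathcomp Require Import ring lra.

(** Suppose that T, G and f exist, and lift f to a conformal parametrization
    F = f o q of T by the plane.  The elements of G inducing s and t are
    isometries fixing a common point O, with commuting linear parts A and B
    that are orthogonal involutions, because T spans space.

    T separates space modulo 2: gluing local sides of T gives a locally
    constant function off T that jumps across T.  An isometry of T that is
    anticonformal on T and whose linear part is a rotation would exchange the
    sides, so all its fixed points lie on T.  As s has fixed points on T and
    the fixed points of a rotation are unbounded, A is a reflection, in a plane
    with unit normal n say.  Since A and B commute, B n = n or B n = - n.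

    No element of Gamma over t has a fixed point (its square would be 1, and a
    homomorphism to Z/4 shows that involutions have trivial t-component), so t
    acts freely on T.  If B n = n, then B is the identity, the rotation about n
    or a reflection, and t has a fixed point on T: impossible.  If B n = - n,
    the function zeta = <n, F - O> on the plane satisfies
    zeta (gamma z) = +- zeta z, according to the orientation character of
    Gamma, and its zeros are the axes of the reflections: the region zeta > 0
    orients X, which is non-orientable: impossible. *)

Set Implicit Arguments.
Unset Strict Implicit.
Unset Printing Implicit Defensive.

Import Order.TTheory GRing.Theory Num.Theory.
Import numFieldNormedType.Exports.
Import Defs.

Local Open Scope classical_set_scope.
Local Open Scope complex_scope.
Local Open Scope ring_scope.

(** * Complex and conjugate-complex differentials *)

(** The isometries realizing s and t are known only through their restrictions to T, so the
    relations of C_2 x C_2 hold a priori on T alone. They reach the linear parts because a linear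
    form constant on T is zero: its vector w would be normal to T everywhere, and at a point of T
    where the form of a nonzero v orthogonal to w is maximal, v would be normal too. The common
    fixed point O is the centroid of the orbit of a point of T.

    Orientation is tracked by the parity of a real differential, [d * v] or [d * v^*] with [d]
    nonzero. The chain rule and the uniqueness of this parity carry the whole argument, for plane
    isometries, for charts and for the normal of T.

    Separation modulo 2 is obtained without homology: the local sides of T form the cocycle of a
    double cover of a cube, trivialized one coordinate at a time by subdividing intervals.

    Orienting X is delicate because its charts fold the plane along the boundary. The sign of zeta
    must therefore be compared with the sign of the imaginary part of the unfolded coordinate, and a
    chart is flipped when the two disagree. *)

Definition cmod (R : realType) (z : CC R) : R := Normc.normc z.

(** The norm of [R[i]] takes its values in [R[i]]; [cmod] is the same modulus as an element of [R],
    so that all estimates below compare real numbers. *)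
Lemma cmodE (R : realType) (z : CC R) : `|z| = (cmod z)%:C.
Proof. by []. Qed.

Lemma cmod_ge0 (R : realType) (z : CC R) : 0 <= cmod z.
Proof. by rewrite /cmod; case: z => a b /=; rewrite sqrtr_ge0. Qed.

Lemma cmodM (R : realType) (z w : CC R) : cmod (z * w) = cmod z * cmod w.
Proof. exact: Normc.normcM. Qed.

Lemma cmodD (R : realType) (z w : CC R) : cmod (z + w) <= cmod z + cmod w.
Proof. exact: le_normcD. Qed.

Lemma cmodN (R : realType) (z : CC R) : cmod (- z) = cmod z.
Proof. exact: normcN. Qed.

Lemma cmodB (R : realType) (z w : CC R) : cmod (z - w) = cmod (w - z).
Proof. by rewrite -cmodN opprB. Qed.

Lemma cmod0 (R : realType) : cmod (0 : CC R) = 0.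
Proof. exact: Normc.normc0. Qed.

Lemma cmod_eq0 (R : realType) (z : CC R) : cmod z = 0 -> z = 0.
Proof. exact: Normc.eq0_normc. Qed.

Lemma cmod_gt0 (R : realType) (z : CC R) : z != 0 -> 0 < cmod z.
Proof.
move=> z0; rewrite lt_neqAle cmod_ge0 andbT eq_sym.
by apply: contra z0 => /eqP/cmod_eq0 ->.
Qed.

Lemma cmod_conj (R : realType) (z : CC R) : cmod (z^*) = cmod z.
Proof. by rewrite /cmod; case: z => a b /=; rewrite sqrrN. Qed.

Lemma cmod_real (R : realType) (x : R) : cmod (x%:C) = `|x|.
Proof. by rewrite /cmod /= expr0n /= addr0 sqrtr_sqr. Qed.

Lemma cmod_i (R : realType) : cmod ('i : CC R) = 1.
Proof. by rewrite /cmod /= expr0n /= add0r expr1n sqrtr1. Qed.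

Lemma Re_le_cmod (R : realType) (z : CC R) : `|complex.Re z| <= cmod z.
Proof.
rewrite /cmod; case: z => a b /=.
by rewrite -sqrtr_sqr ler_wsqrtr // lerDl sqr_ge0.
Qed.

Lemma Im_le_cmod (R : realType) (z : CC R) : `|complex.Im z| <= cmod z.
Proof.
rewrite /cmod; case: z => a b /=.
by rewrite -sqrtr_sqr ler_wsqrtr // lerDr sqr_ge0.
Qed.

Lemma cmod_le_ReIm (R : realType) (z : CC R) :
  cmod z <= `|complex.Re z| + `|complex.Im z|.
Proof.
have -> : z = (complex.Re z)%:C + 'i * (complex.Im z)%:C := complexE z.
by rewrite (le_trans (cmodD _ _)) // cmodM cmod_i mul1r !cmod_real /=
  !(mul0r, mulr0, mul1r, addr0, add0r, subr0, oppr0).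
Qed.

Lemma nbhs_cmodP (R : realType) (z : CC R) (A : set (CC R)) :
  nbhs z A <-> exists2 e : R, 0 < e & forall w, cmod (w - z) < e -> A w.
Proof.
split.
- move/(@nbhs_normP _ (CC R)) => [e /= e0 H].
  (* A positive element of [R[i]] is real; its real part is the radius. *)
  move: e0; rewrite ltcE => /andP[/= /eqP ie re].
  exists (complex.Re e) => // w Hw; apply: H => /=.
  by rewrite distrC cmodE ltcE /= ie eqxx.
- move=> [e e0 H]; apply/(@nbhs_normP _ (CC R)); exists (e%:C); first by rewrite /= ltcR.
  by move=> w /=; rewrite distrC cmodE ltcR; apply: H.
Qed.

Lemma open_cmodP (R : realType) (A : set (CC R)) :
  open A <-> forall z, A z -> exists2 e : R, 0 < e &
    forall w, cmod (w - z) < e -> A w.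
Proof.
rewrite openE; split => H z /H; rewrite /interior; first by move/nbhs_cmodP.
by move=> h; apply/nbhs_cmodP.
Qed.

(* [bconj true] is conjugation: the boolean marks antiholomorphy below. *)
Definition bconj (R : realType) (b : bool) (z : CC R) : CC R :=
  if b then z^* else z.

Lemma bconjD (R : realType) b (z w : CC R) :
  bconj b (z + w) = bconj b z + bconj b w.
Proof. by case: b => //=; rewrite raddfD. Qed.

Lemma bconjM (R : realType) b (z w : CC R) :
  bconj b (z * w) = bconj b z * bconj b w.
Proof. by case: b => //=; rewrite rmorphM. Qed.

Lemma bconjB (R : realType) b (z w : CC R) :
  bconj b (z - w) = bconj b z - bconj b w.
Proof. by case: b => //=; rewrite raddfB. Qed.

Lemma bconj0 (R : realType) b : bconj b (0 : CC R) = 0.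
Proof. by case: b => //; exact: conjc0. Qed.

Lemma bconj_real (R : realType) b (t : R) : bconj b (t%:C : CC R) = t%:C.
Proof. by case: b => //; exact: conjc_real. Qed.

Lemma cmod_bconj (R : realType) b (z : CC R) : cmod (bconj b z) = cmod z.
Proof. by case: b => //=; rewrite cmod_conj. Qed.

Lemma bconjK (R : realType) b b' (z : CC R) :
  bconj b (bconj b' z) = bconj (b (+) b') z.
Proof. case: b; case: b' => //=. exact: conjcK. Qed.

Lemma bconj_eq0 (R : realType) b (z : CC R) : (bconj b z == 0) = (z == 0).
Proof. by case: b => //=; rewrite conjc_eq0. Qed.

(* [h] has at [z] the real differential [v |-> d * v], or [v |-> d * v^*]
   if [b] holds. *)
Definition cdiff (R : realType) (b : bool) (h : CC R -> CC R) (z d : CC R) :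
    Prop :=
  forall e : R, 0 < e -> exists2 r : R, 0 < r & forall w, cmod (w - z) < r ->
    cmod (h w - h z - d * bconj b (w - z)) <= e * cmod (w - z).

Lemma cdiff_near (R : realType) b (h k : CC R -> CC R) (z d : CC R) (r : R) :
  0 < r -> (forall w, cmod (w - z) < r -> h w = k w) ->
  cdiff b h z d -> cdiff b k z d.
Proof.
move=> r0 hk H e e0; have [r' r'0 H'] := H e e0.
exists (Num.min r r'); first by rewrite lt_min r0.
move=> w; rewrite lt_min => /andP[w1 w2].
by rewrite -(hk w) // -(hk z) ?subrr ?cmod0 //; apply: H'.
Qed.

Lemma cdiff_cts (R : realType) b (h : CC R -> CC R) (z d : CC R) :
  cdiff b h z d -> forall e : R, 0 < e -> exists2 r : R, 0 < r &
    forall w, cmod (w - z) < r -> cmod (h w - h z) < e.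
Proof.
move=> H e e0; have [r r0 H'] := H 1 ltr01.
have K0 : 0 < 1 + cmod d by rewrite ltr_pwDl // cmod_ge0.
exists (Num.min r (e / (1 + cmod d))); first by rewrite lt_min r0 divr_gt0.
move=> w; rewrite lt_min => /andP[w1]; rewrite ltr_pdivlMr // => w2.
have := H' w w1; rewrite mul1r => w3.
have -> : h w - h z = (h w - h z - d * bconj b (w - z)) + d * bconj b (w - z).
  by rewrite subrK.
apply: le_lt_trans (cmodD _ _) _; rewrite cmodM cmod_bconj.
apply: le_lt_trans w2; rewrite mulrDr mulr1.
by rewrite [cmod d * _]mulrC lerD2r.
Qed.

Lemma cdiff_comp (R : realType) b c (h k : CC R -> CC R) (z d d' : CC R) :
  cdiff b h z d -> cdiff c k (h z) d' ->
  cdiff (b (+) c) (k \o h) z (d' * bconj c d).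
Proof.
move=> Hh Hk e e0.
set K := 1 + cmod d + cmod d'.
have K1 : 1 <= K by rewrite /K -addrA lerDl addr_ge0 ?cmod_ge0.
have K0 : 0 < K by apply: lt_le_trans K1.
have dK : 1 + cmod d <= K by rewrite /K lerDl cmod_ge0.
have d'K : cmod d' <= K by rewrite /K lerDr addr_ge0 ?cmod_ge0.
(* The bound [e1 <= 1] makes the increment of [h] at most [K * cmod v], and [e1 * K <= e / 2] leaves
   half of [e] to each of the two error terms. *)
pose e1 := Num.min 1 (e / (2 * K)).
have e10 : 0 < e1 by rewrite lt_min ltr01 divr_gt0 // mulr_gt0.
have e11 : e1 <= 1 by rewrite ge_min lexx.
have e1e : e1 * K <= e / 2.
  have h1 : e1 <= e / (2 * K) by rewrite ge_min lexx orbT.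
  apply: le_trans (ler_wpM2r (ltW K0) h1) _.
  by rewrite invfM mulrA mulfVK // gt_eqF.
have [r1 r10 H1] := Hk e1 e10.
have [r2 r20 H2] := cdiff_cts Hh r10.
have [r3 r30 H3] := Hh e1 e10.
exists (Num.min r2 r3); first by rewrite lt_min r20.
move=> w; rewrite lt_min => /andP[w2 w3] /=.
have A1 := H1 _ (H2 _ w2); have A2 := H3 _ w3.
set u := h w - h z in A1 A2 *; set v := w - z in A2 *.
have -> : k (h w) - k (h z) - d' * bconj c d * bconj (b (+) c) v =
  (k (h w) - k (h z) - d' * bconj c u) + d' * bconj c (u - d * bconj b v).
  rewrite (bconjB c u) (bconjM c d) bconjK [c (+) b]addbC; ring.
apply: le_trans (cmodD _ _) _; rewrite cmodM cmod_bconj.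
have u1 : cmod u <= K * cmod v.
  have -> : u = (u - d * bconj b v) + d * bconj b v by rewrite subrK.
  apply: le_trans (cmodD _ _) _; rewrite cmodM cmod_bconj.
  apply: le_trans (lerD A2 (lexx _)) _; rewrite -mulrDl ler_wpM2r ?cmod_ge0 //.
  by apply: le_trans dK; rewrite lerD2r.
have B1 : e1 * cmod u <= e / 2 * cmod v.
  apply: le_trans (_ : e1 * (K * cmod v) <= _).
    by rewrite ler_wpM2l // ltW.
  by rewrite mulrA ler_wpM2r ?cmod_ge0.
have B2 : cmod d' * cmod (u - d * bconj b v) <= e / 2 * cmod v.
  apply: le_trans (_ : K * (e1 * cmod v) <= _).
    by rewrite ler_pM ?cmod_ge0.
  by rewrite mulrA [K * _]mulrC ler_wpM2r ?cmod_ge0.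
apply: le_trans (lerD (le_trans A1 B1) B2) _.
by rewrite -mulrDl -splitr.
Qed.

Lemma le_small_eq0 (R : realType) (x : R) (K : R) :
  0 <= x -> (forall e : R, 0 < e -> x <= e * K) -> x = 0.
Proof.
move=> x0 H; apply/eqP; rewrite eq_le x0 andbT; apply/ler_addgt0Pr => e e0.
rewrite add0r.
have K0 : 0 < 1 + `|K| by rewrite ltr_pwDl.
apply: le_trans (H (e / (1 + `|K|)) _) _; first by rewrite divr_gt0.
rewrite -mulrA ler_piMr // ?(ltW e0) // ler_pdivrMl // mulr1.
by apply: le_trans (ler_norm _) _; rewrite lerDr.
Qed.

(** Both differentials are homogeneous under real scaling, so they can be compared on the short
    vector [t%:C * v], where both approximate the same increment of [h]. *)
Lemma cdiff_uniq (R : realType) b c (h : CC R -> CC R) (z d d' v : CC R) :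
  cdiff b h z d -> cdiff c h z d' -> d * bconj b v = d' * bconj c v.
Proof.
move=> Hb Hc; apply/eqP; rewrite -subr_eq0; apply/eqP/cmod_eq0.
apply: (@le_small_eq0 _ _ (2 * cmod v)); first exact: cmod_ge0.
move=> e e0; have [->|v0] := eqVneq v 0.
  by rewrite !bconj0 !mulr0 subrr cmod0 !mulr0.
have [r1 r10 H1] := Hb e e0; have [r2 r20 H2] := Hc e e0.
have v0' := cmod_gt0 v0.
pose t : R := Num.min r1 r2 / (2 * cmod v).
have m0 : 0 < Num.min r1 r2 by rewrite lt_min r10.
have t0 : 0 < t by rewrite divr_gt0 // mulr_gt0.
have tv : cmod (z + t%:C * v - z) = t * cmod v.
  by rewrite addrC addKr cmodM cmod_real gtr0_norm.
have tm : t * cmod v < Num.min r1 r2.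
  rewrite /t invfM mulrA mulfVK ?gt_eqF // ltr_pdivrMr //.
  by rewrite ltr_pMr // ltr1n.
move: (tm); rewrite lt_min -!tv => /andP[t1 t2].
have A1 := H1 _ t1; have A2 := H2 _ t2.
rewrite !tv ![z + _]addrC !addrK in A1 A2.
rewrite -(ler_pM2l t0).
have -> : t * cmod (d * bconj b v - d' * bconj c v) =
   cmod ((d * bconj b (t%:C * v)) - (d' * bconj c (t%:C * v))).
  rewrite -{1}(gtr0_norm t0) -cmod_real -cmodM !bconjM !bconj_real.
  by congr cmod; ring.
set u := h _ - h z in A1 A2.
have -> : forall x y : CC R, x - y = (u - y) - (u - x) by move=> x y; ring.
apply: le_trans (cmodD _ _) _; rewrite cmodN.
apply: le_trans (lerD A2 A1) _.
by rewrite le_eqVlt; apply/orP; left; apply/eqP; ring.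
Qed.

(** Evaluation on [1] gives [d = d']; evaluation on ['i] then distinguishes [d * v] from [d * v^*].
    This is how orientation is detected throughout. *)
Lemma cdiff_parity (R : realType) b c (h : CC R -> CC R) (z d d' : CC R) :
  cdiff b h z d -> cdiff c h z d' -> d != 0 -> b = c.
Proof.
move=> Hb Hc d0.
have b1 a : bconj a (1 : CC R) = 1 by exact: bconj_real.
have dd' : d = d' by have := cdiff_uniq 1 Hb Hc; rewrite !b1 !mulr1.
have := cdiff_uniq 'i Hb Hc; rewrite -dd' => /(mulfI d0).
case: b c {Hb Hc} => [] [] //= [] /eqP; last first.
  by rewrite -subr_eq0 opprK -[1 + 1]/(2%:R) pnatr_eq0.
by rewrite -subr_eq0 -opprD oppr_eq0 -[1 + 1]/(2%:R) pnatr_eq0.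
Qed.

Lemma cdiff_id (R : realType) (z : CC R) : cdiff false id z 1.
Proof.
move=> e e0; exists 1 => // w _ /=.
by rewrite mul1r subrr cmod0 mulr_ge0 ?cmod_ge0 ?ltW.
Qed.

Lemma cdiff_affine (R : realType) b (a c z : CC R) :
  cdiff b (fun w => a * bconj b w + c) z a.
Proof.
move=> e e0; exists 1 => // w _ /=.
have -> : a * bconj b w + c - (a * bconj b z + c) - a * bconj b (w - z) = 0.
  by rewrite bconjB; ring.
by rewrite cmod0 mulr_ge0 ?cmod_ge0 ?ltW.
Qed.

Lemma cdiff_derivable (R : realType) (h : CC R -> CC R) (z d : CC R) :
  cdiff false h z d -> derivable h z 1.
Proof.
move=> H; apply/cvg_ex; exists d; apply/cvgrPdist_le => /= e.
rewrite ltcE => /andP[/= /eqP ie re].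
have [r r0 Hr] := H _ re.
near=> t.
have t0 : t != 0 by near: t; apply: (@nbhs_dnbhs_neq (CC R)).
have tr : cmod t < r.
  near: t; apply/nbhs_dnbhs/nbhs_cmodP; exists r => // w.
  by rewrite subr0.
suff : `|d - t^-1 * (h (t * 1 + z) - h z)| <= e by [].
have := Hr (t + z); rewrite addrK mulr1 => /(_ tr) /= H1.
have -> : d - t^-1 * (h (t + z) - h z) = t^-1 * - (h (t + z) - h z - d * t).
  by field.
rewrite cmodE lecE /= ie eqxx /= cmodM cmodN.
rewrite [X in X * _](_ : _ = (cmod t)^-1); last exact: Normc.normcV.
by rewrite ler_pdivrMl ?cmod_gt0 // [cmod t * _]mulrC.
Unshelve. all: by end_near.
Qed.

Lemma derivable_cdiff (R : realType) (h : CC R -> CC R) (z : CC R) :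
  derivable h z 1 -> exists d, cdiff false h z d.
Proof.
move=> /cvg_ex[d]; move=> /cvgrPdist_le /= H; exists d => e e0.
have e0' : 0 < (e%:C : R[i]) by rewrite ltcR.
have Hn : \forall t \near (0 : CC R)^',
  `|d - t^-1 *: (h (t *: 1 + z) - h z)| <= e%:C by exact: H _ e0'.
have /nbhs_cmodP[r r0 Hr] : nbhs (0 : CC R) (fun t => t != 0 ->
  `|d - t^-1 *: (h (t *: 1 + z) - h z)| <= e%:C) by exact: Hn.
exists r => // w wz; have [->|w0] := eqVneq w z.
  by rewrite /= !subrr mulr0 subr0 cmod0 mulr0.
have t0 : w - z != 0 by rewrite subr_eq0.
have := Hr (w - z); rewrite subr0 => /(_ wz t0).
rewrite cmodE lecR.
have -> : (w - z) *: (1 : CC R) + z = w by rewrite /GRing.scale /= mulr1 subrK.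
rewrite -[(_)^-1 *: _]/((w - z)^-1 * (h w - h z)) => H1 /=.
have -> : h w - h z - d * (w - z) = - (w - z) * (d - (w - z)^-1 * (h w - h z)).
  by field.
by rewrite cmodM cmodN mulrC ler_wpM2r ?cmod_ge0.
Qed.

(** * Isometries of the plane as conformal and anticonformal maps *)

Lemma plane_open (R : realType) hyp (z : CC R) : plane R hyp z ->
  exists2 e : R, 0 < e & forall w, cmod (w - z) < e -> plane R hyp w.
Proof.
case: hyp => /=; last by exists 1.
rewrite /plane /= => z0; exists (complex.Im z) => // w H.
have := le_lt_trans (Im_le_cmod _) H; rewrite ltr_norml => /andP[+ _].
by rewrite raddfB /= => ?; lra.
Qed.

Lemma plane_oppconj (R : realType) hyp (z : CC R) :
  plane R hyp z -> plane R hyp (- z^*).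
Proof. by case: hyp => //; rewrite /plane /=; case: z => x y /=; rewrite opprK. Qed.

Lemma cdiff_inv (R : realType) (z : CC R) :
  z != 0 -> cdiff false (fun w => w^-1) z (- z ^- 2).
Proof.
move=> z0 e e0; have nz := cmod_gt0 z0.
have k0 : 0 < e * (cmod z ^+ 3 / 2) by rewrite mulr_gt0 // divr_gt0 // exprn_gt0.
exists (Num.min (cmod z / 2) (e * (cmod z ^+ 3 / 2))).
  by rewrite lt_min divr_gt0.
move=> w; rewrite lt_min => /andP[w1 w2] /=.
have nw : cmod z / 2 < cmod w.
  have := cmodD (z - w) w; rewrite subrK cmodB => h; lra.
have w0 : w != 0.
  by apply: contraTneq nw => ->; rewrite cmod0 -leNgt divr_ge0 ?ltW.
have -> : w^-1 - z^-1 - - z ^- 2 * (w - z) = (w - z) * (w - z) / (z ^+ 2 * w).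
  by field; rewrite z0 w0.
rewrite cmodM [cmod (_^-1)](_ : _ = (cmod (z ^+ 2 * w))^-1); last exact: Normc.normcV.
rewrite !cmodM ler_pdivrMr; last by rewrite !mulr_gt0 // (lt_trans _ nw) // divr_gt0.
rewrite mulrAC ler_wpM2r ?cmod_ge0 // (le_trans (ltW w2)) //.
rewrite -mulrA ler_wpM2l ?ltW //.
by rewrite !exprS expr0 mulr1 -!mulrA !ltr_pM2l.
Qed.

Lemma moebius_cdiff (R : realType) (a b c d z : CC R) :
  a * d - b * c != 0 -> c * z + d != 0 ->
  exists2 k, k != 0 & cdiff false (fun w => (a * w + b) / (c * w + d)) z k.
Proof.
move=> D0 cz0; have [c0|c0] := eqVneq c 0.
  have d0 : d != 0 by move: cz0; rewrite c0 mul0r add0r.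
  have a0 : a != 0.
    by apply: contraNneq D0 => ->; rewrite c0 mul0r mulr0 subrr.
  exists (a / d); first by rewrite mulf_neq0 ?invr_neq0.
  have := @cdiff_affine R false (a / d) (b / d) z.
  apply: (@cdiff_near _ _ _ _ _ _ 1) => // w _ /=.
  by rewrite c0 mul0r add0r; field.
(* For [c != 0] the map is [a / c + D / (c * w + d)]: an inversion between two affine maps. *)
pose D := - (a * d - b * c) / c.
exists (D * ((- (c * z + d) ^- 2) * c)).
  by rewrite !(mulf_neq0, oppr_eq0) // ?invr_neq0 // expf_neq0.
have H1 := @cdiff_affine R false c d z.
have H2 := cdiff_comp H1 (cdiff_inv cz0).
have H3 := cdiff_comp H2 (@cdiff_affine R false D (a / c) _).
have [r r0 Hr] := cdiff_cts H1 (cmod_gt0 cz0).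
move: H3; apply: (cdiff_near r0) => w /Hr Hw /=.
have cw0 : c * w + d != 0.
  by apply: contraTneq Hw => /= ->; rewrite sub0r cmodN ltxx.
by rewrite /D; field; rewrite c0 cw0.
Qed.

(** The boolean is [true] for anticonformal maps. Requiring a nonzero differential makes it
    unique. *)
Definition conformal_plane_map (R : realType) (hyp b : bool) (m : CC R -> CC R) :
    Prop :=
  forall z, plane R hyp z -> plane R hyp (m z) /\
    exists2 d, d != 0 & cdiff b m z d.

Lemma direct_isometry_conformal (R : realType) hyp (m : CC R -> CC R) :
  direct_isometry hyp m -> conformal_plane_map hyp false m.
Proof.
case: hyp => [[a [b [c [d [D0 Hm]]]]] z zP | [a [b [a1 Hm]]] z _]; last first.
  split=> //; exists a.
    by rewrite -normr_gt0 a1.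
  have := @cdiff_affine R false a b z.
  by apply: (@cdiff_near _ _ _ _ _ _ 1) => // w _ /=; rewrite Hm.
have Iz : 0 < complex.Im z by exact: zP.
have cz0 : c%:C * z + d%:C != 0.
  rewrite eq_complex; case: z Iz {zP} => x y /= y0.
  rewrite !(mul0r, subr0, addr0, add0r); apply/negP => /andP[/eqP h1 /eqP h2].
  have c0 : c = 0.
    by apply/eqP; move/eqP: h2; rewrite mulf_eq0 (gt_eqF y0) orbF.
  have d0 : d = 0 by move: h1; rewrite c0 mul0r add0r.
  by move: D0; rewrite c0 d0 !mulr0 subrr ltxx.
split.
  rewrite /plane /= Hm //.
  have -> : complex.Im ((a%:C * z + b%:C) / (c%:C * z + d%:C)) =
     (a * d - b * c) * complex.Im z / (cmod (c%:C * z + d%:C)) ^+ 2.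
    move: cz0; rewrite eq_complex /cmod; case: z {zP} Iz => x y /= y0.
    rewrite !(mul0r, subr0, addr0, add0r) => cz0.
    rewrite sqr_sqrtr ?addr_ge0 ?sqr_ge0 //.
    have nz : (c * x + d) ^+ 2 + (c * y) ^+ 2 != 0.
      by rewrite paddr_eq0 ?sqr_ge0 // !sqrf_eq0.
    by field; rewrite nz.
  by apply: divr_gt0; [exact: mulr_gt0 | apply: exprn_gt0; exact: cmod_gt0].
have D0' : a%:C * d%:C - b%:C * c%:C != 0 :> CC R.
  by rewrite -!rmorphM -rmorphB /= eq_complex /= eqxx andbT gt_eqF.
have [k k0 Hk] := moebius_cdiff D0' cz0; exists k => //.
have [r r0 Hr] := plane_open zP.
by move: Hk; apply: (cdiff_near r0) => w /Hr wP; rewrite Hm.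
Qed.

Lemma opposite_isometry_conformal (R : realType) hyp (m : CC R -> CC R) :
  opposite_isometry hyp m -> conformal_plane_map hyp true m.
Proof.
move=> /direct_isometry_conformal H z zP.
have [H1 [d d0 Hd]] := H _ (plane_oppconj zP).
have E (w : CC R) : - (- w^*)^* = w by rewrite raddfN /= opprK; exact: conjcK.
rewrite E in H1; split => //; exists (d * bconj false (-1)).
  by rewrite mulf_neq0 ?oppr_eq0 ?oner_neq0.
have Hc := @cdiff_affine R true (-1) 0 z.
have Ec (w : CC R) : -1 * bconj true w + 0 = - w^* by rewrite mulN1r addr0.
rewrite -[X in cdiff _ _ X _]Ec in Hd.
have := cdiff_comp Hc Hd.
by apply: (@cdiff_near _ _ _ _ _ _ 1) => // w _ /=; rewrite Ec E.
Qed.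

Lemma conformal_parity (R : realType) hyp b c (m : CC R -> CC R) z :
  plane R hyp z -> conformal_plane_map hyp b m ->
  conformal_plane_map hyp c m -> b = c.
Proof.
move=> zP /(_ _ zP) [_ [d d0 Hd]] /(_ _ zP) [_ [d' _ Hd']].
exact: cdiff_parity Hd Hd' d0.
Qed.

Lemma plane_i (R : realType) hyp : plane R hyp 'i.
Proof. by case: hyp => //; rewrite /plane /=. Qed.

Lemma conformal_comp (R : realType) hyp b c (m n k : CC R -> CC R) :
  conformal_plane_map hyp b m -> conformal_plane_map hyp c n ->
  (forall z, plane R hyp z -> k z = n (m z)) ->
  conformal_plane_map hyp (b (+) c) k.
Proof.
move=> Hm Hn Hk z zP; have [mP [d d0 Hd]] := Hm _ zP.
have [nP [d' d'0 Hd']] := Hn _ mP.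
rewrite Hk //; split => //; exists (d' * bconj c d).
  by rewrite mulf_neq0 ?bconj_eq0.
have [r r0 Hr] := plane_open zP.
by have := cdiff_comp Hd Hd'; apply: (cdiff_near r0) => w /Hr wP; rewrite Hk.
Qed.

(** * The group and its action on the plane *)

Lemma Complex_continuous (R : realType) :
  continuous (fun u : R * R => (u.1 +i* u.2 : CC R)).
Proof.
move=> u A /nbhs_cmodP[e e0 H].
apply/nbhs_ballP; exists (e / 2) => /=; first by rewrite divr_gt0.
move=> v [v1 v2]; apply: H; apply: le_lt_trans (cmod_le_ReIm _) _.
move: v1 v2; rewrite -!ball_normE /= distrC => v1; rewrite distrC => v2.
by rewrite (splitr e) ltrD.
Qed.

(** Squares rather than discs, because a square is the continuous image of a product of two
    segments. *)
Lemma compact_square (R : realType) (z : CC R) (r : R) :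
  compact [set w : CC R | `|complex.Re (w - z)| <= r /\
                          `|complex.Im (w - z)| <= r].
Proof.
pose f := fun u : R * R => (u.1 +i* u.2 : CC R).
pose a := complex.Re z; pose b := complex.Im z.
have -> : [set w : CC R | `|complex.Re (w - z)| <= r /\ `|complex.Im (w - z)| <= r]
  = f @` (`[a - r, a + r] `*` `[b - r, b + r]).
  apply/seteqP; split => w /=.
    rewrite !raddfB /= !ler_distl => -[w1 w2].
    exists (complex.Re w, complex.Im w); last by case: (w).
    by split => /=; rewrite in_itv.
  move=> [[x y] [/=]]; rewrite !in_itv /= => x1 y1 <-.
  by rewrite !raddfB /= !ler_distl.
apply: continuous_compact; first by apply: continuous_subspaceT; exact: Complex_continuous.
by apply: compact_setX; exact: segment_compact.
Qed.

(** Only finitely many elements carry some point of a small square around [z0] back into it. Each of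
    them that moves [z0] is excluded, by continuity, after shrinking the radius. *)
Lemma crystallographic_discrete (R : realType) hyp (Gamma : groupType)
    (rho : Gamma -> CC R -> CC R) (z0 : CC R) :
  crystallographic hyp rho -> plane R hyp z0 ->
  exists2 r : R, 0 < r & forall x z, cmod (z - z0) < r ->
    cmod (rho x z - z0) < r -> rho x z0 = z0.
Proof.
move=> [[_ _ _ Hiso] [Hfin _]] z0P.
have [e e0 He] := plane_open z0P.
pose K := [set w : CC R | `|complex.Re (w - z0)| <= e / 3 /\
                          `|complex.Im (w - z0)| <= e / 3].
have KP : K `<=` plane R hyp.
  move=> w [w1 w2]; apply: He; apply: le_lt_trans (cmod_le_ReIm _) _; lra.
have /finite_seqP[s Hs] := Hfin K (@compact_square _ _ _) KP.
have [r1 r10 H1] : exists2 r : R, 0 < r & forall x z, x \in s ->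
    cmod (z - z0) < r -> cmod (rho x z - z0) < r -> rho x z0 = z0.
  elim: s {Hs} => [|x s [r r0 IH]]; first by exists 1.
  suff [r' r'0 H'] : exists2 r : R, 0 < r & forall z,
    cmod (z - z0) < r -> cmod (rho x z - z0) < r -> rho x z0 = z0.
    exists (Num.min r r'); first by rewrite lt_min r0.
    move=> y z; rewrite !lt_min inE => /orP[/eqP ->|ys] /andP[z1 z2] /andP[z3 z4].
      exact: H' z2 z4.
    exact: IH ys z1 z3.
  have [->|xz] := eqVneq (rho x z0) z0; first by exists 1.
  have n0 : 0 < cmod (rho x z0 - z0) by apply: cmod_gt0; rewrite subr_eq0.
  have [b Hb] : exists b, conformal_plane_map hyp b (rho x).
    by case: (Hiso x) => [/direct_isometry_conformal|/opposite_isometry_conformal];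
      [exists false | exists true].
  have [_ [d _ Hd]] := Hb _ z0P.
  have h2 : 0 < cmod (rho x z0 - z0) / 2 by rewrite divr_gt0.
  have [r' r'0 Hr'] := cdiff_cts Hd h2.
  exists (Num.min r' (cmod (rho x z0 - z0) / 2)); first by rewrite lt_min r'0.
  move=> z; rewrite !lt_min => /andP[z1 _] /andP[_ z2].
  have := Hr' _ z1; have := cmodD (rho x z0 - rho x z) (rho x z - z0).
  rewrite addrA subrK cmodB => h3 h4; move: z2 h3 h4 n0; rewrite [cmod (rho x z - rho x z0)]cmodB.
  set A := cmod _; set B := cmod _; set C := cmod _ => *.
  by exfalso; lra.
exists (Num.min r1 (e / 3)); first by rewrite lt_min r10 divr_gt0.
move=> x z; rewrite !lt_min => /andP[z1 z2] /andP[z3 z4].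
apply: H1 z1 z3; suff : [set` s] x by [].
rewrite -Hs /=; exists z; split.
- exact: le_trans (Re_le_cmod _) (ltW z2).
- exact: le_trans (Im_le_cmod _) (ltW z2).
- exact: le_trans (Re_le_cmod _) (ltW z4).
- exact: le_trans (Im_le_cmod _) (ltW z4).
Qed.

(** The orientation character of C_2 x C_2: s and t are anticonformal, so st is conformal. *)
Definition reversing (a : C2xC2) : bool := (a.1 == Zp1) (+) (a.2 == Zp1).

Lemma Z2_cases (a : 'Z_2) : a = 1%g \/ a = Zp1.
Proof.
by case: a => [[|[|//]] i]; [left|right]; apply/val_inj.
Qed.

Lemma Z2_mul11 : (Zp1 * Zp1 = 1 :> 'Z_2)%g.
Proof. exact/val_inj. Qed.

Lemma Z2_eq1 (a b : 'Z_2) : ((a * b)%g == Zp1) = (a == Zp1) (+) (b == Zp1).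
Proof.
by case: (Z2_cases a) => ->; case: (Z2_cases b) => ->;
  rewrite ?mulg1 ?mul1g ?Z2_mul11.
Qed.

Lemma Z2_eqN1 (a : 'Z_2) : (a == 1%g) = ~~ (a == Zp1).
Proof. by case: (Z2_cases a) => ->. Qed.

Lemma reversingM (a b : C2xC2) :
  reversing (a * b)%g = reversing a (+) reversing b.
Proof.
rewrite /reversing /= !Z2_eq1.
by case: (a.1 == _) (a.2 == _) (b.1 == _) (b.2 == _) => [] [] [] [].
Qed.

Lemma multiplicative1 (G H : groupType) (f : {multiplicative G -> H}) :
  f 1%g = 1%g.
Proof. by apply: (mulgI (f 1%g)); rewrite -gmulfM !mulg1. Qed.

Lemma multiplicativeV (G H : groupType) (f : {multiplicative G -> H}) x :
  f x^-1%g = (f x)^-1%g.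
Proof. by apply: (mulgI (f x)); rewrite -gmulfM !mulgV multiplicative1. Qed.

Lemma crystallographic_conformal (R : realType) hyp (Gamma : groupType)
    (rho : Gamma -> CC R -> CC R) (x : Gamma) :
  crystallographic hyp rho -> exists b, conformal_plane_map hyp b (rho x).
Proof.
move=> [[_ _ _ /(_ x) Hiso] _].
by case: Hiso => [/direct_isometry_conformal|/opposite_isometry_conformal];
  [exists false | exists true].
Qed.

(** The property holds for the canonical generators and is stable under products and inverses, so it
    spreads to the group they generate. *)
Lemma klein_group_parity (R : realType) (g k : nat) (Gamma : groupType)
    (rho : Gamma -> CC R -> CC R) (d : 'I_g -> Gamma) (e c : 'I_k -> Gamma)
    (omega : {multiplicative Gamma -> C2xC2}) :
  klein_surface_group rho d e c -> doubling_hom d e c omega ->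
  forall x, conformal_plane_map (hyperbolic_type g k)
              (reversing (omega x)) (rho x).
Proof.
set hyp := hyperbolic_type g k.
move=> [[Hcr _ [_ Hgen _]] [Hd He Hc]] [od oe oc].
have [[H1 HM _ _] _] := Hcr.
pose P : set Gamma :=
  [set x | conformal_plane_map hyp (reversing (omega x)) (rho x)].
have P1 : P 1%g.
  rewrite /P /= multiplicative1 => z zP; rewrite H1 //; split => //.
  exists 1; first exact: oner_neq0.
  have [r r0 Hr] := plane_open zP.
  have := cdiff_id z; apply: (cdiff_near r0) => w /Hr wP.
  by rewrite H1.
suff PT : P = setT by move=> x; have : P x by rewrite PT.
apply: Hgen => //.
- move=> x y Px Py; rewrite /P /= gmulfM reversingM addbC.
  by apply: conformal_comp Py Px _ => z zP; exact: HM.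
(* The parity [b] of the inverse is unknown at first; composing with [rho x] gives the identity,
   whose parity determines [b]. *)
- move=> x Px; have [b Hb] := crystallographic_conformal x^-1%g Hcr.
  rewrite /P /=; suff -> : reversing (omega x^-1%g) = b by [].
  have H : conformal_plane_map hyp (b (+) reversing (omega x)) (rho 1%g).
    by apply: conformal_comp Hb Px _ => z zP; rewrite -HM // mulgV.
  have E := conformal_parity (plane_i R hyp) P1 H.
  have E1 : reversing (omega x^-1%g) (+) reversing (omega x) = b (+) reversing (omega x).
    by rewrite -reversingM -gmulfM mulVg.
  by rewrite -[LHS](addbK (reversing (omega x))) E1 addbK.
- move=> i; rewrite /P /= od; have [] := Hd i.
  by move/opposite_isometry_conformal.
- move=> i; rewrite /P /= oe; have := He i.
  by move/direct_isometry_conformal.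
- move=> i; rewrite /P /= oc; have [] := Hc i.
  by move/opposite_isometry_conformal.
Qed.

(** If [x] moved some point it would be elliptic: having a conformal action, it cannot be an
    opposite isometry. *)
Lemma klein_group_free (R : realType) (g k : nat) (Gamma : groupType)
    (rho : Gamma -> CC R -> CC R) (d : 'I_g -> Gamma) (e c : 'I_k -> Gamma)
    (x : Gamma) z :
  klein_surface_group rho d e c ->
  conformal_plane_map (hyperbolic_type g k) false (rho x) ->
  plane R (hyperbolic_type g k) z -> rho x z = z -> x = 1%g.
Proof.
move=> [[Hcr Hel _] _] Hx zP xz.
have [[_ _ Hfaith /(_ x) Hiso] _] := Hcr.
apply: Hfaith => w wP; apply: contrapT => xw; apply: (Hel x); split.
- case: Hiso => // /opposite_isometry_conformal H.
  by have := conformal_parity zP Hx H.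
- by exists z.
- by exists w.
Qed.

Definition odd4 (a : 'Z_4) : bool := odd a.

Lemma odd4M (a b : 'Z_4) : odd4 (a * b)%g = odd4 a (+) odd4 b.
Proof.
by case: a => [[|[|[|[|//]]]] ?]; case: b => [[|[|[|[|//]]]] ?].
Qed.

Lemma odd4V (a : 'Z_4) : odd4 (a^-1)%g = odd4 a.
Proof. by case: a => [[|[|[|[|//]]]] ?]. Qed.

Lemma odd4_sqr (a : 'Z_4) : (a * a = 1)%g -> odd4 a = false.
Proof. by case: a => [[|[|[|[|//]]]] ?] // /(congr1 val). Qed.

(* An involution has trivial t-component: sending [d_i |-> 1], [c_i |-> 0],
   [e_0 |-> - 2 g] and the other [e_i |-> 0] defines a homomorphism to Z/4
   lifting the t-component of omega, and involutions of Z/4 are even. *)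
Lemma involution_t_component (g k : nat) (Gamma : groupType)
    (d : 'I_g -> Gamma) (e c : 'I_k -> Gamma)
    (omega : {multiplicative Gamma -> C2xC2}) (x : Gamma) :
  (0 < k)%N -> canonical_presentation d e c -> doubling_hom d e c omega ->
  (x * x = 1)%g -> (omega x).2 = 1%g.
Proof.
case: k e c => // k e c _ [_ Hgen Huniv] [od oe oc] xx.
pose d' := fun _ : 'I_g => (Zp1 : 'Z_4).
pose w := (\big[*%g/1%g]_(i < g) (d' i ^+ 2))%g.
pose e' := fun i : 'I_k.+1 => if i == ord0 then w^-1%g else 1%g.
pose c' := fun _ : 'I_k.+1 => 1%g : 'Z_4.
have rel : canonical_relations d' e' c'.
  split.
  - rewrite big_ord_recl [X in (_ * (_ * X))%g]big1 /=; last by move=> i _.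
    by rewrite mulg1 /e' eqxx mulgV.
  - by move=> i; rewrite /c' expg1n.
  - by move=> i; rewrite /c' mulg1 mulgV.
have [h [hd he hc]] := Huniv _ d' e' c' rel.
have w_even : odd4 w = false.
  rewrite /w; apply: (big_ind (fun a => odd4 a = false)) => //.
  by move=> a b Ha Hb; rewrite odd4M Ha Hb.
(* The parity of [h] and the t-component of [omega] are both characters with values in Z/2, so it
   suffices to compare them on generators; [e_0] goes to the inverse of [w], which is even. *)
pose P : set Gamma := [set x | odd4 (h x) = ((omega x).2 == Zp1)].
have PT : P = setT.
  apply: Hgen.
  - by rewrite /P /= !multiplicative1.
  - by move=> a b; rewrite /P /= !gmulfM odd4M Z2_eq1 => -> ->.
  - move=> a; rewrite /P /= => Pa; rewrite multiplicativeV odd4V Pa.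
    have : (omega (a^-1)%g * omega a).2%g = 1%g.
      by rewrite -gmulfM mulVg multiplicative1.
    move/(congr1 (eq_op^~ Zp1)); rewrite Z2_eq1.
    by case: (_ == _) (_ == _) => [] [].
  - by move=> i; rewrite /P /= hd od.
  - by move=> i; rewrite /P /= he oe /e'; case: eqP => // _; rewrite odd4V w_even.
  - by move=> i; rewrite /P /= hc oc.
have : P x by rewrite PT.
rewrite /P /= odd4_sqr -?gmulfM ?xx ?multiplicative1 // => /esym/negbT.
by rewrite -Z2_eqN1 => /eqP.
Qed.

(** * Orientability of the quotient *)

Lemma cdiff_conj (R : realType) (z : CC R) :
  cdiff true (fun w : CC R => w^*) z 1.
Proof.
have := @cdiff_affine R true 1 0 z.
by apply: (@cdiff_near _ _ _ _ _ _ 1) => // w _; rewrite mul1r addr0.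
Qed.

Definition semiholomorphic (R : realType) (b : bool) (W : set (CC R))
    (f : CC R -> CC R) : Prop :=
  forall z, W z -> exists d, cdiff b f z d.

Lemma holomorphicP (R : realType) (W : set (CC R)) (f : CC R -> CC R) :
  holomorphic_on W f <-> semiholomorphic false W f.
Proof.
split=> H z /H; first exact: derivable_cdiff.
by move=> [d]; apply: cdiff_derivable.
Qed.

Lemma antiholomorphicP (R : realType) (W : set (CC R)) (f : CC R -> CC R) :
  antiholomorphic_on W f <-> semiholomorphic true W f.
Proof.
rewrite /antiholomorphic_on holomorphicP; split=> H z /H [d Hd].
  exists (1 * bconj true d).
  have := cdiff_comp Hd (cdiff_conj _).
  by apply: (@cdiff_near _ _ _ _ _ _ 1) => // w _ /=; exact: conjcK.
exists (1 * bconj true d).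
exact: (cdiff_comp Hd (cdiff_conj _)).
Qed.

Lemma dianalyticP (R : realType) (X : Type) (phi psi : chart R X) :
  dianalytic_transition phi psi <->
  (forall x, dom phi x -> dom psi x -> exists W tau b,
    represents_transition phi psi x W tau /\ semiholomorphic b W tau).
Proof.
split=> H x px qx.
  have [W [tau [Hr [Hh|Hh]]]] := H x px qx.
    by exists W, tau, false; split=> //; apply/holomorphicP.
  by exists W, tau, true; split=> //; apply/antiholomorphicP.
have [W [tau [b [Hr Hh]]]] := H x px qx.
exists W, tau; split=> //; case: b Hh => Hh.
  by right; apply/antiholomorphicP.
by left; apply/holomorphicP.
Qed.

(** The reflection [- z^*] reverses orientation and, unlike [z^*], preserves the closed upper
    half-plane, so a flipped chart is again a chart. *)
Definition flip (R : realType) (b : bool) (z : CC R) : CC R :=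
  if b then - z^* else z.

Lemma flipK (R : realType) b : involutive (@flip R b).
Proof. by case: b => z //=; rewrite raddfN /= opprK; exact: conjcK. Qed.

Lemma flip_cdiff (R : realType) b (z : CC R) :
  exists2 d, d != 0 & cdiff b (flip b) z d.
Proof.
case: b; last by exists 1; [exact: oner_neq0 | exact: cdiff_id].
exists (-1); first by rewrite oppr_eq0 oner_neq0.
have := @cdiff_affine R true (-1) 0 z.
by apply: (@cdiff_near _ _ _ _ _ _ 1) => // w _; rewrite mulN1r addr0.
Qed.

Lemma cmod_flipB (R : realType) b (z w : CC R) :
  cmod (flip b z - flip b w) = cmod (z - w).
Proof.
case: b => //=; rewrite -opprD cmodN.
by rewrite -(cmod_conj (z - w)) raddfB.
Qed.

Lemma Im_flip (R : realType) b (z : CC R) :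
  complex.Im (flip b z) = complex.Im z.
Proof. by case: b => //; case: z => x y /=; rewrite opprK. Qed.

Lemma flip_open (R : realType) b (W : set (CC R)) :
  open W -> open [set z | W (flip b z)].
Proof.
move=> /open_cmodP H; apply/open_cmodP => z /= /H[e e0 He].
by exists e => // w; rewrite -(cmod_flipB b); apply: He.
Qed.

Definition flip_chart (R : realType) (X : Type) (b : bool) (U : set X)
    (phi : chart R X) : chart R X :=
  Chart U (flip b \o coord phi).

Lemma flip_chartE (R : realType) (X : Type) (phi : chart R X) :
  flip_chart false (dom phi) phi = phi.
Proof. by case: phi. Qed.

Lemma flip_chart_is_chart (R : realType) (X : topologicalType) b (U : set X)
    (phi : chart R X) :
  open U -> U `<=` dom phi -> is_chart phi -> is_chart (flip_chart b U phi).
Proof.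
move=> oU Up [od inj cts Hopen]; split => //=.
- move=> x y /set_mem Ux /set_mem Uy /= /(can_inj (@flipK R b)).
  by apply: inj; apply/mem_set/Up.
- move=> x Ux V /= /nbhs_cmodP[e e0 He].
  apply: (cts x (Up _ Ux) (fun z => V (flip b z))).
  apply/nbhs_cmodP; exists e => // w; rewrite -(cmod_flipB b); exact: He.
- move=> V oV VU; have [Q oQ EQ] := Hopen V oV (subset_trans VU Up).
  exists [set z | Q (flip b z)]; first exact: flip_open.
  apply/seteqP; split=> z /=.
    move=> [x Vx <-]; have : (coord phi @` V) (coord phi x) by exists x.
    by rewrite EQ => -[Qx Hx]; rewrite flipK /closed_half_plane /= Im_flip.
  move=> [Qz Hz]; have : (Q `&` closed_half_plane R) (flip b z).
    by split=> //; rewrite /closed_half_plane /= Im_flip.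
  by rewrite -EQ => -[x Vx Ex]; exists x => //=; rewrite Ex flipK.
Qed.

Lemma flip_chart_dianalytic (R : realType) (X : Type) b c (U V : set X)
    (phi psi : chart R X) :
  U `<=` dom phi -> V `<=` dom psi -> dianalytic_transition phi psi ->
  dianalytic_transition (flip_chart b U phi) (flip_chart c V psi).
Proof.
move=> Up Vp /dianalyticP H; apply/dianalyticP => x /= Ux Vx.
have [W [tau [a [[oW Wx Ht] Hh]]]] := H x (Up _ Ux) (Vp _ Vx).
exists [set z | W (flip b z)], (flip c \o tau \o flip b), (b (+) a (+) c).
split.
  split; [exact: flip_open | by rewrite /= flipK |].
  move=> y /= Uy Vy; rewrite flipK => Wy.
  by rewrite (Ht y) //; [exact: Up | exact: Vp].
move=> z /= /Hh[d Hd].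
have [d1 _ H1] := flip_cdiff b z.
have H2 := cdiff_comp H1 Hd.
have [d3 _ H3] := flip_cdiff c (tau (flip b z)).
by eexists; exact: (cdiff_comp H2 H3).
Qed.

(** * Orienting the quotient by the sign of a function on the plane *)

Lemma path_nonvanishing (R : realType) (h : R -> R) :
  (forall t, 0 <= t <= 1 -> {for t, continuous h}) ->
  (forall t, 0 <= t <= 1 -> h t != 0) -> 0 < h 0 -> 0 < h 1.
Proof.
move=> hc hn h0; rewrite ltNge; apply/negP => h1.
have uc : {within `[0, 1], continuous h}.
  apply: continuous_in_subspaceT => t /set_mem /=; rewrite in_itv /=; exact: hc.
have [|t] := @IVT _ h 0 1 0 ler01 uc.
  by rewrite ge_min h1 orbT le_max (ltW h0).
by rewrite in_itv /= => /hn /eqP.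
Qed.

Lemma convex_nonvanishing (R : realType) (D : set (CC R)) (h : CC R -> R) :
  (forall a b (t : R), D a -> D b -> 0 <= t <= 1 ->
     D (a + t%:C * (b - a))) ->
  (forall z, D z -> forall e : R, 0 < e -> exists2 r : R, 0 < r &
     forall w, cmod (w - z) < r -> `|h w - h z| < e) ->
  (forall z, D z -> h z != 0) ->
  forall a b, D a -> D b -> 0 < h a -> 0 < h b.
Proof.
move=> Dconv hc hn a b Da Db ha.
pose u (t : R) : CC R := a + t%:C * (b - a).
have u0 : u 0 = a by rewrite /u rmorph0 mul0r addr0.
have u1 : u 1 = b by rewrite /u rmorph1 mul1r addrC subrK.
have := @path_nonvanishing _ (h \o u); rewrite /= u0 u1; apply => // t t01.
- apply/cvgrPdist_lt => e e0.
  have [r r0 Hr] := hc _ (Dconv _ _ _ Da Db t01) e e0.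
  have k0 : 0 < 1 + cmod (b - a) by rewrite ltr_pwDl // cmod_ge0.
  near=> s; rewrite distrC; apply: Hr.
  rewrite [X in cmod X](_ : _ = (s - t)%:C * (b - a)); last first.
    by rewrite /u rmorphB /=; ring.
  rewrite cmodM cmod_real.
  apply: le_lt_trans (_ : `|s - t| * (1 + cmod (b - a)) < r).
    by rewrite ler_wpM2l // lerDr.
  rewrite -ltr_pdivlMr // distrC; near: s.
  apply/nbhs_ballP; exists (r / (1 + cmod (b - a))); first exact: divr_gt0.
  by [].
- by apply: hn; apply: Dconv.
Unshelve. all: by end_near.
Qed.

(* [zeta] transforms by the orientation character of the group and vanishes
   only on the axes of its reflections. *)
Definition orientation_sign (R : realType) (hyp : bool) (Gamma : groupType)
    (rho : Gamma -> CC R -> CC R) (zeta : CC R -> R) : Prop :=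
  [/\ forall z, plane R hyp z -> forall e : R, 0 < e ->
        exists2 r : R, 0 < r &
          forall w, cmod (w - z) < r -> `|zeta w - zeta z| < e,
      forall b x z, plane R hyp z -> conformal_plane_map hyp b (rho x) ->
        zeta (rho x z) = (-1) ^+ b * zeta z &
      forall z, plane R hyp z -> zeta z = 0 ->
        exists2 x, conformal_plane_map hyp true (rho x) & rho x z = z].

Definition folded_by (R : realType) (S : set (CC R)) (X : Type)
    (p : CC R -> X) (phi : chart R X) (V W : set (CC R))
    (F F' : CC R -> CC R) : Prop :=
  [/\ open V, V `<=` S & open W] /\
  [/\ forall z, V z -> exists2 d, d != 0 & cdiff false F z d,
      forall w, W w -> exists d, cdiff false F' w d,
      forall z, V z -> W (F z) /\ F' (F z) = z,
      forall w, W w -> V (F' w) /\ F (F' w) = w &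
      forall z, V z -> dom phi (p z) /\ coord phi (p z) = folding (F z)].

(** The derivative of [F] cannot vanish: [F'] inverts [F], so by the chain rule the two derivatives
    have product 1. *)
Lemma quotient_folded (R : realType) (S : set (CC R)) (X : Type)
    (A : set (chart R X)) (p : CC R -> X) z0 phi :
  quotient_dianalytic S A p -> S z0 -> A phi -> dom phi (p z0) ->
  exists V W F F', V z0 /\ folded_by S p phi V W F F'.
Proof.
move=> H Sz Aphi Dz; have [V [W [F [F' [[oV Vz VS oW]]]]]] := H _ _ Sz Aphi Dz.
move=> [/holomorphicP HF /holomorphicP HF' FK F'K Hc].
exists V, W, F, F'; split=> //; split=> //; split=> //.
move=> z zV; have [d Hd] := HF _ zV; exists d => //.
have [Wz Ez] := FK _ zV; have [d' Hd'] := HF' _ Wz.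
have [r r0 Hr] := (open_cmodP _).1 oV _ zV.
have Hc' : cdiff false id z (d' * d).
  by have := cdiff_comp Hd Hd'; apply: (cdiff_near r0) => w /Hr /FK[].
have := cdiff_uniq 1 Hc' (cdiff_id z); rewrite /= !mulr1 => E.
by apply: contra_eq_neq E => ->; rewrite mulr0 eq_sym oner_neq0.
Qed.

Lemma foldingE (R : realType) (z : CC R) :
  folding z = bconj (complex.Im z < 0) z.
Proof.
rewrite /folding /bconj; case: z => x y /=; case: ltP => y0 /=.
  by rewrite ltr0_norm.
by rewrite ger0_norm.
Qed.

Lemma folding_conj (R : realType) (z : CC R) : folding z^* = folding z.
Proof. by case: z => x y; rewrite /folding /= normrN. Qed.

Lemma folding_cdiff (R : realType) (z : CC R) :
  complex.Im z != 0 -> cdiff (complex.Im z < 0) (@folding R) z 1.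
Proof.
move=> z0; set b := complex.Im z < 0.
have := @cdiff_affine R b 1 0 z.
apply: (@cdiff_near _ _ _ _ _ _ `|complex.Im z|); first by rewrite normr_gt0.
move=> w Hw; rewrite mul1r addr0 foldingE; congr bconj; rewrite /b.
have := le_lt_trans (Im_le_cmod _) Hw; rewrite raddfB /=.
case: (ltgtP (complex.Im z) 0) z0 => // Iz _; rewrite ltr_norml => /andP[h1 h2].
  by rewrite ltr0_norm // in h2; apply/esym; lra.
by rewrite gtr0_norm // in h1; apply/esym/negbTE; rewrite -leNgt; lra.
Qed.

Lemma orbit_space_invariant (R : realType) hyp (Gamma : groupType)
    (rho : Gamma -> CC R -> CC R) (X : topologicalType) (p : CC R -> X) b x z :
  orbit_space (plane R hyp) rho setT p -> plane R hyp z ->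
  conformal_plane_map hyp b (rho x) -> p (rho x z) = p z.
Proof.
move=> [_ Hp _] zP Hx; have [xzP _] := Hx _ zP.
by apply/esym; apply/(Hp _ _ zP xzP); exists x.
Qed.

(* The coordinate read through the projection near [rho x z] is the one near
   [z], up to the orientation of [rho x]. *)
Lemma folded_cdiff (R : realType) hyp (Gamma : groupType)
    (rho : Gamma -> CC R -> CC R) (X : topologicalType) (p : CC R -> X)
    (phi : chart R X) V W F F' b x z :
  orbit_space (plane R hyp) rho setT p ->
  folded_by (plane R hyp) p phi V W F F' ->
  plane R hyp z -> conformal_plane_map hyp b (rho x) -> V (rho x z) ->
  complex.Im (F (rho x z)) != 0 ->
  exists2 d, d != 0 &
    cdiff (b (+) (complex.Im (F (rho x z)) < 0)) (coord phi \o p) z d.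
Proof.
move=> Ho [[oV VS oW] [HF HF' FK F'K Hc]] zP Hx Vz Iz.
have [xzP [d1 d10 H1]] := Hx _ zP.
have [d2 d20 H2] := HF _ Vz.
have H3 := folding_cdiff Iz.
have H := cdiff_comp H1 (cdiff_comp H2 H3).
eexists; last first.
  have [e e0 He] := (open_cmodP _).1 oV _ Vz.
  have [r r0 Hr] := cdiff_cts H1 e0.
  have [r' r'0 Hr'] := plane_open zP.
  have m0 : 0 < Num.min r r' by rewrite lt_min r0.
  apply: (cdiff_near m0 _ H) => w; rewrite lt_min => /andP[/Hr /He Vw /Hr' wP] /=.
  have [_ <-] := Hc _ Vw.
  by rewrite (orbit_space_invariant Ho wP Hx).
by rewrite !mulf_neq0 ?bconj_eq0 ?oner_neq0.
Qed.

(** A zero of [zeta] is fixed by an orientation-reversing [x]. Off the real axis, the chart read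
    through [p] at [z] would have opposite parities when computed through [x] and through the
    identity. *)
Lemma sign_zero_Im (R : realType) hyp (Gamma : groupType)
    (rho : Gamma -> CC R -> CC R) (X : topologicalType) (p : CC R -> X)
    (phi : chart R X) V W F F' zeta z :
  (forall w, plane R hyp w -> rho 1%g w = w) ->
  orbit_space (plane R hyp) rho setT p ->
  folded_by (plane R hyp) p phi V W F F' ->
  orientation_sign hyp rho zeta ->
  V z -> zeta z = 0 -> complex.Im (F z) = 0.
Proof.
move=> H1 Ho Hf [_ _ Z3] Vz z0; have [[_ VS _] _] := Hf.
have zP := VS _ Vz; have [x Hx xz] := Z3 _ zP z0.
apply: contrapT => /eqP Iz.
have Hid : conformal_plane_map hyp false (rho 1%g).
  move=> w wP; rewrite H1 //; split=> //; exists 1; first exact: oner_neq0.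
  have [r r0 Hr] := plane_open wP.
  by have := cdiff_id w; apply: (cdiff_near r0) => u /Hr uP; rewrite H1.
have [d d0 Hd] := folded_cdiff Ho Hf zP Hx (eq_ind_r V Vz xz) (eq_ind_r (fun u => complex.Im (F u) != 0) Iz xz).
have [d' _ Hd'] := folded_cdiff Ho Hf zP Hid (eq_ind_r V Vz (H1 _ zP)) (eq_ind_r (fun u => complex.Im (F u) != 0) Iz (H1 _ zP)).
have := cdiff_parity Hd Hd' d0; rewrite xz H1 //.
by case: (_ < 0).
Qed.

Lemma lt_irrefl_false (R : realType) : (0 : R) < 0 -> False.
Proof. by rewrite ltxx. Qed.

Lemma Im0_conj (R : realType) (z : CC R) : complex.Im z = 0 -> z^* = z.
Proof. by case: z => x y /= ->; apply/eqP; rewrite eq_complex /= oppr0 !eqxx. Qed.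

Lemma cmod_conjB (R : realType) (a b : CC R) : cmod (a^* - b) = cmod (a - b^*).
Proof.
rewrite -(cmod_conj (a - b^*)); case: a b => x y [x' y'].
by rewrite /cmod /= opprK opprD.
Qed.

Lemma half_disc_convex (R : realType) (u : CC R) (r s : R) (a b : CC R) (t : R) :
  let D := [set w : CC R | cmod (w - u) < r /\ 0 < s * complex.Im w] in
  D a -> D b -> 0 <= t <= 1 -> D (a + t%:C * (b - a)).
Proof.
move=> D [a1 a2] [b1 b2] /andP[t0 t1]; split.
  have -> : a + t%:C * (b - a) - u = (1 - t)%:C * (a - u) + t%:C * (b - u).
    by rewrite rmorphB rmorph1; ring.
  apply: le_lt_trans (cmodD _ _) _; rewrite !cmodM !cmod_real.
  have t1' : 0 <= 1 - t by rewrite subr_ge0.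
  rewrite !ger0_norm //; have [t00|t00] := eqVneq t 0.
    by rewrite t00 mul0r addr0 subr0 mul1r.
  have -> : r = (1 - t) * r + t * r by ring.
  apply: ler_ltD; first by rewrite ler_wpM2l // ltW.
  by rewrite ltr_pM2l // lt_neqAle eq_sym t00.
have -> : complex.Im (a + t%:C * (b - a)) =
    (1 - t) * complex.Im a + t * complex.Im b.
  by case: (a) (b) => [x y] [x' y'] /=; rewrite mul0r addr0; ring.
have [t00|t00] := eqVneq t 0.
  by rewrite t00 mul0r addr0 subr0 mul1r.
rewrite mulrDr !(mulrCA s); apply: ltr_wpDl.
  by rewrite mulr_ge0 ?subr_ge0 // ltW.
by rewrite mulr_gt0 // lt_neqAle eq_sym t00.
Qed.

(** On a small disc, [zeta \o F'] vanishes at most on the real axis, has constant sign on each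
    half-disc because half-discs are convex, and changes sign under conjugation because conjugate
    points have the same image under folding. Hence its product with the imaginary part has a
    constant sign, recorded by [k]. *)
Lemma sign_chart_orientation (R : realType) hyp (Gamma : groupType)
    (rho : Gamma -> CC R -> CC R) (X : topologicalType) (p : CC R -> X)
    (phi : chart R X) V W F F' zeta z0 :
  crystallographic hyp rho ->
  (forall x z, conformal_plane_map hyp false (rho x) -> plane R hyp z ->
     rho x z = z -> x = 1%g) ->
  orbit_space (plane R hyp) rho setT p ->
  {in dom phi &, injective (coord phi)} ->
  folded_by (plane R hyp) p phi V W F F' ->
  orientation_sign hyp rho zeta -> V z0 ->
  exists r : R, exists k : bool, 0 < r /\
    forall w, cmod (w - F z0) < r -> W w /\
      (zeta (F' w) != 0 -> 0 < (-1) ^+ k * zeta (F' w) * complex.Im w).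
Proof.
move=> Hcr Hfree Ho phi_inj Hf Hz Vz0.
have [[Hid _ _ Hiso] _] := Hcr.
have [[oV VS oW] [HF HF' FK F'K Hc]] := Hf.
have [Z1 Z2 _] := Hz.
set w0 := F z0; have [Ww0 F'w0] := FK _ Vz0.
have z0P := VS _ Vz0.
have [rd rd0 Hrd] := crystallographic_discrete Hcr z0P.
have [rW rW0 HrW] := (open_cmodP _).1 oW _ Ww0.
have [dF' HdF'] := HF' _ Ww0.
have [rF rF0 HrF] := cdiff_cts HdF' rd0; rewrite F'w0 in HrF.
(* Around a centre off the real axis the disc has to miss the axis; on the axis there is no
   constraint, and 1 is an arbitrary positive value. *)
pose rI := if complex.Im w0 == 0 then 1 else `|complex.Im w0|.
have rI0 : 0 < rI by rewrite /rI; case: eqVneq => // h; rewrite normr_gt0.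
pose r := Num.min (Num.min rW rF) rI.
have r0 : 0 < r by rewrite !lt_min rW0 rF0 rI0.
pose h w := zeta (F' w).
have rP w : cmod (w - w0) < r ->
    [/\ W w, cmod (F' w - z0) < rd & cmod (w - w0) < rI].
  by rewrite !lt_min => /andP[/andP[/HrW ? /HrF ?] ?].
have hct w : W w -> forall e : R, 0 < e -> exists2 s : R, 0 < s &
     forall v, cmod (v - w) < s -> `|h v - h w| < e.
  move=> Ww e e0; have [Vw _] := F'K _ Ww.
  have [s s0 Hs] := Z1 _ (VS _ Vw) e e0.
  have [d Hd] := HF' _ Ww; have [s' s'0 Hs'] := cdiff_cts Hd s0.
  by exists s' => // v /Hs' /Hs.
have hnz w : W w -> complex.Im w != 0 -> h w != 0.
  move=> Ww; have [Vw Ew] := F'K _ Ww.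
  apply: contra_neq => hw; have := sign_zero_Im Hid Ho Hf Hz Vw hw.
  by rewrite Ew.
have hconst (s : R) a b : 0 < s * complex.Im a -> 0 < s * complex.Im b ->
    cmod (a - w0) < r -> cmod (b - w0) < r -> 0 < h a -> 0 < h b.
  move=> ia ib ra rb.
  pose D := [set w : CC R | cmod (w - w0) < r /\ 0 < s * complex.Im w].
  apply: (@convex_nonvanishing _ D) => //.
  - by move=> ? ? ? ? ? ?; apply: half_disc_convex.
  - by move=> z [/rP[Wz _ _] _]; apply: hct.
  - move=> z [/rP[Wz _ _]]; have [->|i0 _] := eqVneq (complex.Im z) 0.
      by rewrite mulr0 ltxx.
    exact: hnz.
have hopp w : complex.Im w != 0 -> complex.Im w0 = 0 -> cmod (w - w0) < r ->
    h w^* = - h w.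
  move=> iw i0 rw; have rw' : cmod (w^* - w0) < r.
    rewrite cmod_conjB.
    by rewrite (Im0_conj i0).
  have [Ww Zw _] := rP _ rw; have [Ww' Zw' _] := rP _ rw'.
  have [Vw Ew] := F'K _ Ww; have [Vw' Ew'] := F'K _ Ww'.
  have [D1 C1] := Hc _ Vw; have [D2 C2] := Hc _ Vw'.
  have Ep : p (F' w) = p (F' w^*).
    apply: phi_inj; [exact/mem_set | exact/mem_set |].
    by rewrite C1 C2 Ew Ew' folding_conj.
  have [_ Hp _] := Ho.
  have [x _ Ex] := (Hp _ _ (VS _ Vw) (VS _ Vw')).1 Ep.
  (* Both [F' w] and its image under [x] are close to [z0], so discreteness forces [x] to fix [z0].
     If [x] were conformal it would be 1, although it moves [F' w]; hence it reverses orientation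
     and [zeta] changes sign. *)
  have xz0 : rho x z0 = z0 by apply: (Hrd x (F' w)) => //; rewrite -Ex.
  have [b Hb] := crystallographic_conformal x Hcr.
  case: b Hb => Hb; first by rewrite /h Ex (Z2 _ _ _ (VS _ Vw) Hb) expr1 mulN1r.
  have x1 := Hfree _ _ Hb z0P xz0.
  move: Ex; rewrite x1 Hid; last exact: VS.
  move/(congr1 F); rewrite Ew Ew' => E; exfalso.
  move: iw; move/(congr1 (@complex.Im R)): E; case: (w) => x' y' /= E.
  by move/eqP; apply; lra.
have hopp2 a b : 0 < complex.Im a -> complex.Im b < 0 ->
    cmod (a - w0) < r -> cmod (b - w0) < r -> h a * h b < 0.
  move=> ia ib ra rb.
  (* A disc meeting both half-planes is centred on the real axis, by the choice of [rI]. *)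
  have i0 : complex.Im w0 = 0.
    have [_ _] := rP _ ra; have [_ _] := rP _ rb; rewrite /rI.
    case: eqVneq => // i0 h1 h2; exfalso.
    have := le_lt_trans (Im_le_cmod _) h1; have := le_lt_trans (Im_le_cmod _) h2.
    rewrite !raddfB /=; case: (ltgtP (complex.Im w0) 0) i0 => // iw _.
      by rewrite (ltr0_norm iw) !ltr_norml => /andP[? ?] /andP[? ?]; apply: (@lt_irrefl_false R); lra.
    by rewrite (gtr0_norm iw) !ltr_norml => /andP[? ?] /andP[? ?]; apply: (@lt_irrefl_false R); lra.
  have ra' : cmod (a^* - w0) < r.
    rewrite cmod_conjB.
    by rewrite (Im0_conj i0).
  have ica : complex.Im (a^*) = - complex.Im a by case: (a).
  have ha : h a^* = - h a by apply: hopp => //; rewrite gt_eqF.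
  have [Wa _ _] := rP _ ra; have [Wb _ _] := rP _ rb.
  have na : h a != 0 by apply: hnz => //; rewrite gt_eqF.
  have nb : h b != 0 by apply: hnz => //; rewrite lt_eqF.
  have i1 : 0 < -1 * complex.Im (a^*) by rewrite ica mulN1r opprK.
  have i2 : 0 < -1 * complex.Im b by rewrite mulN1r oppr_gt0.
  have c1 := hconst _ _ _ i1 i2 ra' rb; have c2 := hconst _ _ _ i2 i1 rb ra'.
  rewrite ha in c1 c2.
  case: (ltgtP (h a) 0) na => // ha0 _; case: (ltgtP (h b) 0) nb => // hb0 _.
  - by have := c1; rewrite oppr_gt0 ha0 => /(_ isT); lra.
  - by rewrite nmulr_rlt0.
  - by rewrite pmulr_rlt0.
  - by have := c2 hb0; lra.
(* If [h] were nonzero at a real point, it would have the same sign slightly above and slightly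
   below it, against [hopp2]. *)
have hreal w : cmod (w - w0) < r -> complex.Im w = 0 -> h w = 0.
  move=> rw iw; have [Ww _ _] := rP _ rw; apply/eqP; apply: contrapT => /negP hw.
  have hw0 : 0 < `|h w| by rewrite normr_gt0.
  have [s s0 Hs] := hct _ Ww _ hw0.
  pose q := Num.min s (r - cmod (w - w0)) / 2.
  have m0 : 0 < Num.min s (r - cmod (w - w0)) by rewrite lt_min s0 subr_gt0.
  have q0 : 0 < q by rewrite divr_gt0.
  have qm : q < Num.min s (r - cmod (w - w0)).
    by rewrite /q ltr_pdivrMr // ltr_pMr // ltr1n.
  move: qm; rewrite lt_min => /andP[q1 q2].
  have ia : complex.Im (w + q *i) = q by case: (w) iw => x y /= ->; rewrite add0r.
  have ib : complex.Im (w - q *i) = - q by case: (w) iw => x y /= ->; rewrite add0r.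
  have cq : cmod (q *i : CC R) = q.
    by rewrite /cmod /= expr0n /= add0r sqrtr_sqr gtr0_norm.
  have ra : cmod (w + q *i - w0) < r.
    have -> : w + q *i - w0 = (w - w0) + q *i by ring.
    by apply: le_lt_trans (cmodD _ _) _; rewrite cq; lra.
  have rb : cmod (w - q *i - w0) < r.
    have -> : w - q *i - w0 = (w - w0) - q *i by ring.
    by apply: le_lt_trans (cmodD _ _) _; rewrite cmodN cq; lra.
  have ia' : 0 < complex.Im (w + q *i) by rewrite ia.
  have ib' : complex.Im (w - q *i) < 0 by rewrite ib oppr_lt0.
  have H := hopp2 _ _ ia' ib' ra rb.
  have Ha := Hs (w + q *i); have Hb := Hs (w - q *i).
  have Ea : w + q *i - w = q *i by ring.
  have Eb : w - q *i - w = - q *i by ring.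
  rewrite Ea cq in Ha; rewrite Eb cmodN cq in Hb.
  move: (Ha q1) (Hb q1) H; move: (h _) (h _) (h w) hw {hw0 Hs Ha Hb} => A B C C0.
  rewrite !ltr_norml => /andP[h1 h2] /andP[h3 h4].
  case: (ltgtP C 0) C0 h1 h2 h3 h4 => // C0 _.
    rewrite ltr0_norm // => *; have ? : 0 < A * B by (rewrite nmulr_rgt0; lra).
    by apply: (@lt_irrefl_false R); lra.
  rewrite gtr0_norm // => *; have ? : 0 < A * B by (apply: mulr_gt0; lra).
  by apply: (@lt_irrefl_false R); lra.
exists r; suff [k Hk] : exists k : bool, forall w, cmod (w - w0) < r ->
    complex.Im w != 0 -> 0 < (-1) ^+ k * h w * complex.Im w.
  exists k; split=> // w rw; have [Ww _ _] := rP _ rw; split=> // hw.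
  by apply: Hk => //; apply: contraNneq hw => /(hreal _ rw)/eqP.
(* One nonreal point where [h] and the imaginary part have opposite signs decides [k]; [hconst] and
   [hopp2] carry that sign to all the others. *)
have [[a [ra ha]]|Hno] := pselect (exists a, cmod (a - w0) < r /\ h a * complex.Im a < 0).
  exists true => b rb ib; have ia : complex.Im a != 0.
    by apply: contraTneq ha => ->; rewrite mulr0 ltxx.
  have [Wa _ _] := rP _ ra; have [Wb _ _] := rP _ rb.
  have na := hnz _ Wa ia; have nb := hnz _ Wb ib.
  rewrite expr1 mulN1r mulNr oppr_gt0.
  have p1 := hconst 1; have m1 := hconst (-1).
  case: (ltgtP (complex.Im a) 0) ia => // ia _; case: (ltgtP (complex.Im b) 0) ib => // ib _.
  - rewrite nmulr_llt0 // in ha; rewrite nmulr_llt0 //.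
    by apply: (m1 a) => //; rewrite mulN1r oppr_gt0.
  - have := hopp2 _ _ ib ia rb ra; rewrite nmulr_llt0 // in ha.
    by rewrite !pmulr_llt0.
  - have := hopp2 _ _ ia ib ra rb; rewrite pmulr_llt0 // in ha.
    by rewrite nmulr_rlt0 // nmulr_llt0.
  - rewrite pmulr_llt0 // in ha; rewrite pmulr_llt0 // ltNge le_eqVlt eq_sym (negPf nb) /=.
    apply/negP => hb; have ? : 0 < h a by apply: (p1 b a) => //; rewrite mul1r.
    by apply: (@lt_irrefl_false R); lra.
exists false => w rw iw; have [Ww _ _] := rP _ rw.
rewrite expr0 mul1r lt_neqAle eq_sym mulf_neq0 ?hnz //=.
by rewrite leNgt; apply/negP => hw; apply: Hno; exists w.
Qed.

(** Compatibility of a chart with the orientation that the region [zeta > 0] induces on the quotient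
    through [p]. *)
Definition positive_chart (R : realType) hyp (X : Type) (p : CC R -> X)
    (zeta : CC R -> R) (phi : chart R X) : Prop :=
  forall z, plane R hyp z -> dom phi (p z) -> 0 < zeta z ->
  exists2 d, d != 0 & cdiff false (coord phi \o p) z d.

(** The domain is the image of the disc given by [sign_chart_orientation], and the chart is flipped
    exactly when [zeta] and the unfolded imaginary part have opposite signs there. *)
Lemma exists_positive_chart (R : realType) hyp (Gamma : groupType)
    (rho : Gamma -> CC R -> CC R) (X : topologicalType) (A : set (chart R X))
    (p : CC R -> X) zeta (phi : chart R X) z0 :
  crystallographic hyp rho ->
  (forall x z, conformal_plane_map hyp false (rho x) -> plane R hyp z ->
     rho x z = z -> x = 1%g) ->
  klein_quotient (plane R hyp) rho A p ->
  orientation_sign hyp rho zeta ->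
  is_chart phi -> A phi -> plane R hyp z0 -> dom phi (p z0) ->
  exists b U, [/\ open U, U `<=` dom phi, U (p z0) &
    positive_chart hyp p zeta (flip_chart b U phi)].
Proof.
move=> Hcr Hfree [Ho Hq] Hz [oD Dinj _ _] Aphi z0P Dz0.
have [V [W [F [F' [Vz0 Hf]]]]] := quotient_folded Hq z0P Aphi Dz0.
have [r [k [r0 Hr]]] := sign_chart_orientation Hcr Hfree Ho Dinj Hf Hz Vz0.
have [[oV VS oW] [HF HF' FK F'K Hc]] := Hf.
have [_ Z2 _] := Hz; have [_ Hp Hop] := Ho.
pose D := [set w | cmod (w - F z0) < r].
exists k, ((p \o F') @` D); split.
(* A point over the domain is carried into [V] by some element [x] of the group; near that point,
   [F] composed with [rho x] stays in the disc. *)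
- apply/Hop/open_cmodP => z [zP [w Dw Ew]].
  have [Ww _] := Hr w Dw; have [Vw Fw] := F'K _ Ww.
  have [x _ Ex] := (Hp _ _ zP (VS _ Vw)).1 (esym Ew).
  have [b Hb] := crystallographic_conformal x Hcr.
  have [_ [d1 _ H1]] := Hb _ zP.
  have Vx : V (rho x z) by rewrite -Ex.
  have [d2 _ H2] := HF _ Vx.
  have H3 := cdiff_comp H1 H2.
  have e0 : 0 < r - cmod (w - F z0) by rewrite subr_gt0.
  have [r1 r10 Hr1] := cdiff_cts H3 e0.
  have [e1 e10 He1] := (open_cmodP _).1 oV _ Vx.
  have [r2 r20 Hr2] := cdiff_cts H1 e10.
  have [r3 r30 Hr3] := plane_open zP.
  exists (Num.min r1 (Num.min r2 r3)); first by rewrite !lt_min r10 r20.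
  move=> u; rewrite !lt_min => /and3P[/Hr1 u1 /Hr2 /He1 u2 /Hr3 u3]; split=> //.
  have [_ F'u] := FK _ u2.
  exists (F (rho x u)); last by rewrite /= F'u (orbit_space_invariant Ho u3 Hb).
  move: u1; rewrite /= -Ex Fw /D /= => u1.
  have -> : F (rho x u) - F z0 = (F (rho x u) - w) + (w - F z0) by rewrite addrA subrK.
  by apply: le_lt_trans (cmodD _ _) _; rewrite -ltrBrDr.
- move=> _ [w Dw <-] /=; have [Ww _] := Hr w Dw.
  by have [/Hc[]] := F'K _ Ww.
- exists (F z0); first by rewrite /D /= subrr cmod0.
  by rewrite /=; have [_ ->] := FK _ Vz0.
- move=> z zP /= [w Dw Ew] zz.
  have [Ww Hw] := Hr w Dw; have [Vw Fw] := F'K _ Ww.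
  have [x _ Ex] := (Hp _ _ zP (VS _ Vw)).1 (esym Ew).
  have [b Hb] := crystallographic_conformal x Hcr.
  have E2 := Z2 _ _ _ zP Hb; rewrite -Ex in E2.
  have nz : zeta (F' w) != 0 by rewrite E2 mulf_neq0 ?signr_eq0 // gt_eqF.
  have pos := Hw nz; rewrite E2 in pos.
  have Iw : complex.Im w != 0.
    by apply: contraTneq pos => ->; rewrite mulr0 ltxx.
  have Vx : V (rho x z) by rewrite -Ex.
  have Fx : F (rho x z) = w by rewrite -Ex.
  have Ix : complex.Im (F (rho x z)) != 0 by rewrite Fx.
  have [d d0 Hd] := folded_cdiff Ho Hf zP Hb Vx Ix.
  have [d' d'0 Hd'] := flip_cdiff k (coord phi (p z)).
  exists (d' * bconj k d); first by rewrite mulf_neq0 ?bconj_eq0.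
  have := cdiff_comp Hd Hd'.
  (* Three reversals may occur: that of [x], the folding of a point with negative imaginary part,
     and the flip. Positivity of [zeta z] and the choice of [k] make their number even. *)
  suff -> : (b (+) (complex.Im (F (rho x z)) < 0)) (+) k = false by [].
  rewrite Fx; move: pos; clear -Iw zz.
  case: b => /=; case: k => /=; case: (ltgtP (complex.Im w) 0) Iw => //= iw _;
    rewrite ?expr1 ?expr0 ?mulN1r ?mul1r ?opprK ?mulNr ?oppr_gt0 => pos;
    exfalso; move: pos; apply/negP; rewrite -leNgt.
  all: rewrite ?oppr_le0 ?oppr_ge0 ?pmulr_rge0 ?pmulr_rle0 // ltW //.
Qed.

(** The analytic atlas consists of the positive charts obtained from [A] by restriction and flip. An
    antiholomorphic transition between two of them would give the second chart both parities at a
    lift where [zeta > 0]. *)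
Lemma sign_orientable (R : realType) hyp (Gamma : groupType)
    (rho : Gamma -> CC R -> CC R) (X : topologicalType) (A : set (chart R X))
    (p : CC R -> X) zeta :
  klein_surface A ->
  crystallographic hyp rho ->
  (forall x z, conformal_plane_map hyp false (rho x) -> plane R hyp z ->
     rho x z = z -> x = 1%g) ->
  klein_quotient (plane R hyp) rho A p ->
  orientation_sign hyp rho zeta ->
  (exists x, conformal_plane_map hyp true (rho x)) ->
  orientable A.
Proof.
move=> [_ [Achart Acov Atrans]] Hcr Hfree Hk Hz [x0 Hx0].
have [Ho Hq] := Hk; have [Hsurj _ Hop] := Ho; have [_ Z2 _] := Hz.
have [[Hid _ _ _] _] := Hcr.
pose B := [set phi' | positive_chart hyp p zeta phi' /\ exists phi b U,
  [/\ A phi, open U, U `<=` dom phi & phi' = flip_chart b U phi]].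
exists B; split.
- move=> _ [_ [phi [b [U [Aphi oU Up ->]]]]].
  by apply: flip_chart_is_chart => //; exact: Achart.
- move=> _ psi [_ [phi [b [U [Aphi oU Up ->]]]]] Apsi.
  rewrite -(flip_chartE psi).
  by split; apply: flip_chart_dianalytic => //; exact: Atrans.
- move=> x; have [phi Aphi Dx] := Acov x; have [z0 z0P Ez0] := Hsurj x.
  rewrite -Ez0 in Dx *.
  have [b [U [oU Up Ux Hpos]]] :=
    exists_positive_chart Hcr Hfree Hk Hz (Achart _ Aphi) Aphi z0P Dx.
  by exists (flip_chart b U phi) => //; split=> //; exists phi, b, U.
- move=> phi1 psi1 [pos1 [phi [b [U [Aphi oU Up E1]]]]].
  move=> [pos2 [psi [c [V [Apsi oV Vp E2]]]]] x D1 D2.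
  have C1 : is_chart phi1.
    by rewrite E1; apply: flip_chart_is_chart => //; exact: Achart.
  have C2 : is_chart psi1.
    by rewrite E2; apply: flip_chart_is_chart => //; exact: Achart.
  have : dianalytic_transition phi1 psi1.
    by rewrite E1 E2; apply: flip_chart_dianalytic => //; exact: Atrans.
  move=> /dianalyticP /(_ x D1 D2)[W [tau [a [[oW Wx Ht] Hh]]]].
  exists W, tau; split; first by split.
  case: a Hh => Hh; last exact/holomorphicP.
  exfalso.
  pose N := [set y | [/\ dom phi1 y, dom psi1 y & W (coord phi1 y)]].
  have oN : open N.
    have [dom1 _ cts _] := C1; have [dom2 _ _ _] := C2.
    rewrite openE => y [N1 N2 N3]; rewrite /interior.
    have n3 := cts _ N1 _ (open_nbhs_nbhs (conj oW N3)).
    have n1 := open_nbhs_nbhs (conj dom1 N1); have n2 := open_nbhs_nbhs (conj dom2 N2).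
    by apply: filterS (filterI n1 (filterI n2 n3)) => v [? []].
  have /open_cmodP oN' := (Hop N).1 oN.
  have [z1 z1P Ez1] := Hsurj x.
  have Nz1 : N (p z1) by rewrite Ez1; split.
  have Dz1 : dom phi (p z1) by rewrite Ez1; apply: Up; move: D1; rewrite E1.
  have [V' [W' [F [F' [Vz1 Hf]]]]] := quotient_folded Hq z1P Aphi Dz1.
  have [[oV' VS oW'] [HF HF' FK F'K Hc]] := Hf.
  (* Over the overlap [N] there is a point where [zeta] does not vanish: if [F z1] is real, move it
     upwards by a small [q] and return by [F']. *)
  have [z zP [Nz zz]] : exists2 z, plane R hyp z & N (p z) /\ zeta z != 0.
    have nonzero z : V' z -> complex.Im (F z) != 0 -> zeta z != 0.
      by move=> V'z; apply: contra_neq => /(sign_zero_Im Hid Ho Hf Hz V'z).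
    have [iF|iF] := eqVneq (complex.Im (F z1)) 0; last first.
      by exists z1 => //; split=> //; apply: nonzero.
    have [r r0 Hr] := oN' _ (conj z1P Nz1).
    have [WF F'F] := FK _ Vz1; have [d Hd] := HF' _ WF.
    have [r1 r10 Hr1] := cdiff_cts Hd r0; rewrite F'F in Hr1.
    have [r2 r20 Hr2] := (open_cmodP _).1 oW' _ WF.
    pose q := Num.min r1 r2 / 2.
    have m0 : 0 < Num.min r1 r2 by rewrite lt_min r10.
    have q0 : 0 < q by rewrite divr_gt0.
    have : q < Num.min r1 r2 by rewrite /q ltr_pdivrMr // ltr_pMr // ltr1n.
    rewrite lt_min => /andP[q1 q2].
    have cq : cmod (F z1 + q *i - F z1) = q.
      by rewrite addrAC subrr add0r /cmod /= expr0n /= add0r sqrtr_sqr gtr0_norm.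
    have [V'q Fq] := F'K _ (Hr2 (F z1 + q *i) ltac:(by rewrite cq)).
    have [zP Nz] := Hr _ (Hr1 (F z1 + q *i) ltac:(by rewrite cq)).
    exists (F' (F z1 + q *i)) => //; split=> //; apply: nonzero => //.
    by rewrite Fq raddfD /= iF add0r gt_eqF.
  (* The orientation-reversing element [x0] changes the sign of [zeta] without changing the image in
     the quotient. *)
  have {z zP Nz zz} [z [zP [N1 N2 N3] zz]] :
      exists z, [/\ plane R hyp z, N (p z) & 0 < zeta z].
    have [zz0|zz0] := ltP 0 (zeta z); first by exists z.
    exists (rho x0 z); rewrite (orbit_space_invariant Ho zP Hx0).
    split=> //; first by have [] := Hx0 _ zP.
    by rewrite (Z2 _ _ _ zP Hx0) expr1 mulN1r oppr_gt0 lt_neqAle zz.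
  have [d1 d10 H1] := pos1 _ zP N1 zz; have [d2 d20 H2] := pos2 _ zP N2 zz.
  have [d3 H3] := Hh _ N3.
  have [r r0 Hr] := oN' z (conj zP (And3 N1 N2 N3)).
  have H4 : cdiff true (coord psi1 \o p) z (d3 * bconj true d1).
    have := cdiff_comp H1 H3; apply: (cdiff_near r0) => u /Hr[_ [u1 u2 u3]] /=.
    by rewrite (Ht _ u1 u2 u3).
  by have := cdiff_parity H2 H4 d20.
Qed.

(** * Euclidean geometry of space *)

Lemma rV3P (R : realType) (u v : E3 R) :
  u 0 (inord 0) = v 0 (inord 0) -> u 0 (inord 1) = v 0 (inord 1) ->
  u 0 (inord 2) = v 0 (inord 2) -> u = v.
Proof.
move=> h0 h1 h2; apply/rowP => -[[|[|[|//]]] i].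
- by rewrite (_ : Ordinal i = inord 0) //; apply/val_inj; rewrite /= inordK.
- by rewrite (_ : Ordinal i = inord 1) //; apply/val_inj; rewrite /= inordK.
- by rewrite (_ : Ordinal i = inord 2) //; apply/val_inj; rewrite /= inordK.
Qed.

Lemma dot3E (R : realType) (u v : E3 R) :
  dot3 u v = u 0 (inord 0) * v 0 (inord 0) + u 0 (inord 1) * v 0 (inord 1)
             + u 0 (inord 2) * v 0 (inord 2).
Proof.
rewrite /dot3 mxE !big_ord_recl big_ord0 addr0 !mxE addrA.
by congr (_ * _ + _ * _ + _ * _); congr (_ 0 _); apply/val_inj; rewrite /= inordK.
Qed.

Lemma cross3E (R : realType) (u v : E3 R) :
  [/\ cross3 u v 0 (inord 0) =
        u 0 (inord 1) * v 0 (inord 2) - u 0 (inord 2) * v 0 (inord 1),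
      cross3 u v 0 (inord 1) =
        u 0 (inord 2) * v 0 (inord 0) - u 0 (inord 0) * v 0 (inord 2) &
      cross3 u v 0 (inord 2) =
        u 0 (inord 0) * v 0 (inord 1) - u 0 (inord 1) * v 0 (inord 0)].
Proof. by split; rewrite mxE -!val_eqE /= !inordK. Qed.

Lemma cross3_0 (R : realType) (u v : E3 R) : cross3 u v 0 (inord 0) =
  u 0 (inord 1) * v 0 (inord 2) - u 0 (inord 2) * v 0 (inord 1).
Proof. by have [] := cross3E u v. Qed.

Lemma cross3_1 (R : realType) (u v : E3 R) : cross3 u v 0 (inord 1) =
  u 0 (inord 2) * v 0 (inord 0) - u 0 (inord 0) * v 0 (inord 2).
Proof. by have [] := cross3E u v. Qed.

Lemma cross3_2 (R : realType) (u v : E3 R) : cross3 u v 0 (inord 2) =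
  u 0 (inord 0) * v 0 (inord 1) - u 0 (inord 1) * v 0 (inord 0).
Proof. by have [] := cross3E u v. Qed.

Definition coordE (R : realType) := (@dot3E R, @cross3_0 R, @cross3_1 R, @cross3_2 R).

Lemma add3E (R : realType) (u v : E3 R) i : (u + v) 0 i = u 0 i + v 0 i.
Proof. by rewrite mxE. Qed.
Lemma opp3E (R : realType) (u : E3 R) i : (- u) 0 i = - u 0 i.
Proof. by rewrite mxE. Qed.
Lemma scale3E (R : realType) (a : R) (u : E3 R) i : (a *: u) 0 i = a * u 0 i.
Proof. by rewrite mxE. Qed.

Ltac coord3 := apply: rV3P; rewrite ?(coordE, add3E, opp3E, scale3E).

Lemma dot3C (R : realType) (u v : E3 R) : dot3 u v = dot3 v u.
Proof. by rewrite !coordE; ring. Qed.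

Lemma dot3D (R : realType) (u v w : E3 R) : dot3 (u + v) w = dot3 u w + dot3 v w.
Proof. by rewrite !(coordE, add3E); ring. Qed.

Lemma dot3N (R : realType) (u w : E3 R) : dot3 (- u) w = - dot3 u w.
Proof. by rewrite !(coordE, opp3E); ring. Qed.

Lemma dot3B (R : realType) (u v w : E3 R) : dot3 (u - v) w = dot3 u w - dot3 v w.
Proof. by rewrite dot3D dot3N. Qed.

Lemma dot3Z (R : realType) a (u w : E3 R) : dot3 (a *: u) w = a * dot3 u w.
Proof. by rewrite !(coordE, scale3E); ring. Qed.

Lemma dot3Dr (R : realType) (u v w : E3 R) : dot3 u (v + w) = dot3 u v + dot3 u w.
Proof. by rewrite !(dot3C u) dot3D. Qed.

Lemma dot3Nr (R : realType) (u w : E3 R) : dot3 u (- w) = - dot3 u w.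
Proof. by rewrite !(dot3C u) dot3N. Qed.

Lemma dot3Br (R : realType) (u v w : E3 R) : dot3 u (v - w) = dot3 u v - dot3 u w.
Proof. by rewrite !(dot3C u) dot3B. Qed.

Lemma dot3Zr (R : realType) a (u w : E3 R) : dot3 u (a *: w) = a * dot3 u w.
Proof. by rewrite !(dot3C u) dot3Z. Qed.

Lemma dot30 (R : realType) (u : E3 R) : dot3 0 u = 0.
Proof. by rewrite -(scale0r 0) dot3Z mul0r. Qed.

Definition dot3_lin (R : realType) :=
  (@dot3D R, @dot3N R, @dot3Z R, @dot3Dr R, @dot3Nr R, @dot3Zr R).

Lemma dot3_ge0 (R : realType) (u : E3 R) : 0 <= dot3 u u.
Proof. by rewrite coordE -!expr2 !addr_ge0 ?sqr_ge0. Qed.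

Lemma dot3_eq0 (R : realType) (u : E3 R) : dot3 u u = 0 -> u = 0.
Proof.
rewrite coordE -!expr2 => /eqP.
rewrite paddr_eq0 ?addr_ge0 ?sqr_ge0 // paddr_eq0 ?sqr_ge0 // !sqrf_eq0.
by move=> /andP[/andP[/eqP h0 /eqP h1] /eqP h2]; apply: rV3P; rewrite ?mxE.
Qed.

Lemma dot3_gt0 (R : realType) (u : E3 R) : u != 0 -> 0 < dot3 u u.
Proof.
move=> u0; rewrite lt_neqAle dot3_ge0 andbT eq_sym.
by apply: contra u0 => /eqP/dot3_eq0 ->.
Qed.

Lemma dot3_cross (R : realType) (u v : E3 R) : dot3 u (cross3 u v) = 0.
Proof. by rewrite !coordE; ring. Qed.

Lemma dot3_crossr (R : realType) (u v : E3 R) : dot3 v (cross3 u v) = 0.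
Proof. by rewrite !coordE; ring. Qed.

Lemma cross3_norm (R : realType) (u v : E3 R) :
  dot3 (cross3 u v) (cross3 u v) = dot3 u u * dot3 v v - dot3 u v ^+ 2.
Proof. by rewrite !coordE; ring. Qed.

Lemma cross3_cross (R : realType) (u v w : E3 R) :
  cross3 u (cross3 v w) = dot3 u w *: v - dot3 u v *: w.
Proof. by coord3; ring. Qed.

Lemma cross3_anti (R : realType) (u v : E3 R) : cross3 u v = - cross3 v u.
Proof. by coord3; ring. Qed.

Lemma cross3Dl (R : realType) (u v w : E3 R) :
  cross3 (u + v) w = cross3 u w + cross3 v w.
Proof. by coord3; ring. Qed.

Lemma cross3Zl (R : realType) a (u w : E3 R) :
  cross3 (a *: u) w = a *: cross3 u w.
Proof. by coord3; ring. Qed.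

Lemma cross3Dr (R : realType) (u v w : E3 R) :
  cross3 w (u + v) = cross3 w u + cross3 w v.
Proof. by coord3; ring. Qed.

Lemma cross3Zr (R : realType) a (u w : E3 R) :
  cross3 w (a *: u) = a *: cross3 w u.
Proof. by coord3; ring. Qed.

Lemma cross30r (R : realType) (u : E3 R) : cross3 u 0 = 0.
Proof. by rewrite -[X in cross3 u X](scale0r (0 : E3 R)) cross3Zr scale0r. Qed.

(** The double cross product formula turns orthogonality to [a] and to [cross3 N a], which span the
    plane orthogonal to [N], into [cross3 v N = 0]. *)
Lemma perp_normal (R : realType) (N a v : E3 R) :
  dot3 N N = 1 -> a != 0 -> dot3 N a = 0 -> dot3 v a = 0 ->
  dot3 v (cross3 N a) = 0 -> v = dot3 v N *: N.
Proof.
move=> N1 a0 Na va vc.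
have H : cross3 v (cross3 a (cross3 N a)) = 0.
  by rewrite cross3_cross vc va !scale0r subrr.
have Ha : cross3 a (cross3 N a) = dot3 a a *: N.
  by rewrite cross3_cross (dot3C a N) Na scale0r subr0.
have vN : cross3 v N = 0.
  have aa := dot3_gt0 a0.
  have /(congr1 (fun x => (dot3 a a)^-1 *: x)) : dot3 a a *: cross3 v N = 0.
    by rewrite -cross3Zr -Ha.
  by rewrite scalerA mulVf ?gt_eqF // scale1r scaler0.
have : cross3 N (cross3 v N) = 0 by rewrite vN cross30r.
rewrite cross3_cross N1 scale1r dot3C => /eqP; rewrite subr_eq0 => /eqP ->.
by rewrite dot3Z N1 mulr1.
Qed.

(** * Isometries and orthogonal involutions of space *)

Lemma dot3_mulmx (R : realType) (M : 'M[R]_3) (u v : E3 R) :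
  M *m M^T = 1%:M -> dot3 (u *m M) (v *m M) = dot3 u v.
Proof. by move=> H; rewrite /dot3 trmx_mul !mulmxA -(mulmxA u) H mulmx1. Qed.

(** By polarization [h] preserves [dot3]. The rows of [M] are the images of the basis vectors, hence
    [h x *m M^T = x], and orthogonality of [M] inverts this relation. *)
Lemma isometry3_affine (R : realType) (m : E3 R -> E3 R) :
  isometry3 m -> exists M : 'M[R]_3, M *m M^T = 1%:M /\
    forall x y, m x = m y + (x - y) *m M.
Proof.
move=> Hm; pose h x := m x - m 0.
have hd x y : dot3 (h x) (h y) = dot3 x y.
  have h1 := Hm x y.
  have h2 : dot3 (h x) (h x) = dot3 x x by rewrite /h Hm subr0.
  have h3 : dot3 (h y) (h y) = dot3 y y by rewrite /h Hm subr0.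
  have E : m x - m y = h x - h y by rewrite /h opprB addrA subrK.
  rewrite E in h1; move: (h x) (h y) h1 h2 h3 => a b {E}.
  by rewrite !dot3_lin (dot3C b a) (dot3C y x); lra.
pose M := \matrix_i h (delta_mx 0 i).
have rowM i : row i M = h (delta_mx 0 i) by rewrite rowK.
have MMT : M *m M^T = 1%:M.
  apply/matrixP => i j; rewrite !mxE.
  transitivity (dot3 (h (delta_mx 0 i)) (h (delta_mx 0 j))).
    by rewrite /dot3 mxE; apply: eq_bigr => k _; rewrite !mxE.
  rewrite hd /dot3 trmx_delta mul_delta_mx_cond.
  by case: (i == j); rewrite ?mulr1n ?mulr0n !mxE.
have hM x : h x = x *m M.
  have MTM : M^T *m M = 1%:M by exact: mulmx1C.
  suff E : h x *m M^T = x by rewrite -{2}E -mulmxA MTM mulmx1.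
  apply/rowP => i; rewrite mxE.
  transitivity (dot3 (h x) (h (delta_mx 0 i))).
    by rewrite /dot3 mxE; apply: eq_bigr => k _; rewrite !mxE.
  by rewrite hd /dot3 trmx_delta -colE mxE.
exists M; split=> // x y; rewrite mulmxBl -!hM /h.
rewrite (_ : m x - m 0 - (m y - m 0) = m x - m y); last by rewrite opprB addrA subrK.
by rewrite [RHS]addrC subrK.
Qed.

(* [x |-> x *m M] multiplies cross products by the sign [k] (its determinant) *)
Definition cross_sign (R : realType) (M : 'M[R]_3) (k : R) : Prop :=
  forall u v : E3 R, cross3 (u *m M) (v *m M) = k *: (cross3 u v *m M).

Lemma unit_scale3 (R : realType) (u : E3 R) : u != 0 ->
  exists2 a : R, a != 0 & dot3 (a *: u) (a *: u) = 1.
Proof.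
move=> u0; have uu := dot3_gt0 u0.
exists (Num.sqrt (dot3 u u))^-1; first by rewrite invr_neq0 // gt_eqF // sqrtr_gt0.
by rewrite !dot3_lin mulrA -expr2 exprVn sqr_sqrtr ?dot3_ge0 // mulVf // gt_eqF.
Qed.

(** Every [x + x *m M] is fixed; when one of them is nonzero, it is normalized. *)
Lemma orth_involution_axis (R : realType) (M : 'M[R]_3) :
  M *m M = 1%:M ->
  (forall u : E3 R, u *m M = - u) \/
  exists n : E3 R, dot3 n n = 1 /\ n *m M = n.
Proof.
move=> MM; have [H|/existsNP[x Hx]] := pselect (forall u : E3 R, u *m M = - u).
  by left.
right; have u0 : x + x *m M != 0.
  by apply: contra_not_neq Hx => /eqP; rewrite addrC addr_eq0 => /eqP.
have [a a0 ua] := unit_scale3 u0.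
exists (a *: (x + x *m M)); split=> //.
by rewrite -scalemxAl mulmxDl -mulmxA MM mulmx1 addrC.
Qed.

Lemma rotation_cross_sign (R : realType) (M : 'M[R]_3) (n : E3 R) :
  dot3 n n = 1 ->
  (forall x : E3 R, x *m M = (2 * dot3 n x) *: n - x) -> cross_sign M 1.
Proof.
move=> n1 HM u v; rewrite scale1r !HM.
(* A polynomial identity in all coordinates; its last term vanishes because [n] is a unit vector. *)
have -> : cross3 ((2 * dot3 n u) *: n - u) ((2 * dot3 n v) *: n - v) =
    (2 * dot3 n (cross3 u v)) *: n - cross3 u v
    + (2 * (1 - dot3 n n)) *: cross3 u v.
  by coord3; ring.
by rewrite n1 subrr mulr0 scale0r addr0.
Qed.

(** Either [M] is minus the identity on the plane orthogonal to [n], giving the half-turn about [n],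
    or that plane contains another fixed unit vector [u]. Then [cross3 n u] is an eigenvector with
    eigenvalue 1 or -1, giving the identity or a reflection. *)
Lemma orth_involution_fixing (R : realType) (M : 'M[R]_3) (n : E3 R) :
  M *m M^T = 1%:M -> M *m M = 1%:M -> dot3 n n = 1 -> n *m M = n ->
  [\/ forall x : E3 R, x *m M = x,
      forall x : E3 R, x *m M = (2 * dot3 n x) *: n - x |
      exists2 m : E3 R, dot3 m m = 1 & forall x : E3 R, x *m M = x - (2 * dot3 m x) *: m].
Proof.
move=> MMT MM n1 nM.
have n0 : n != 0.
  by apply: contra_eq_neq n1 => ->; rewrite dot30 eq_sym oner_neq0.
have [Hrot|] := pselect (forall x : E3 R, dot3 n x = 0 -> x *m M = - x).
  apply: Or32 => x; have nx : dot3 n (x - dot3 n x *: n) = 0.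
    by rewrite !dot3_lin n1 mulr1 subrr.
  have := Hrot _ nx; rewrite mulmxBl -scalemxAl nM => /eqP.
  rewrite subr_eq => /eqP ->; rewrite opprB -addrA addrC -addrA -scalerDl.
  by rewrite addrC mulrDl mul1r.
move=> /existsNP[x /not_implyP[nx Hx]].
have u0 : x + x *m M != 0.
  by apply: contra_not_neq Hx => /eqP; rewrite addrC addr_eq0 => /eqP.
have [a a0 ua] := unit_scale3 u0.
set u := a *: (x + x *m M) in ua.
have nu : dot3 n u = 0.
  have nxM : dot3 n (x *m M) = 0 by rewrite -{1}nM dot3_mulmx.
  by rewrite /u !dot3_lin nx nxM addr0 mulr0.
have uM : u *m M = u.
  by rewrite /u -scalemxAl mulmxDl -mulmxA MM mulmx1 addrC.
clearbody u; pose m := cross3 n u.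
have nm : dot3 n m = 0 by exact: dot3_cross.
have um : dot3 u m = 0 by exact: dot3_crossr.
have m1 : dot3 m m = 1 by rewrite /m cross3_norm n1 ua nu expr0n subr0 mulr1.
have mn : cross3 m n = u.
  by rewrite /m cross3_anti cross3_cross nu n1 scale0r sub0r opprK scale1r.
have alongm v : dot3 v n = 0 -> dot3 v u = 0 -> v = dot3 v m *: m.
  move=> vn vu; apply: (perp_normal m1 n0); rewrite ?mn //.
  by rewrite dot3C.
clearbody m; pose l := dot3 (m *m M) m.
have mM : m *m M = l *: m.
  apply: alongm; first by rewrite -{1}nM dot3_mulmx // dot3C.
  by rewrite -{1}uM dot3_mulmx // dot3C.
have expand v : v = dot3 v n *: n + dot3 v u *: u + dot3 v m *: m.
  have := alongm (v - dot3 v n *: n - dot3 v u *: u).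
  rewrite !(dot3D, dot3N, dot3Z) n1 ua nu (dot3C u n) nu.
  rewrite nm um !mulr0 !mulr1 !subr0 subrr => /(_ erefl (subrr _)) H.
  by apply/eqP; rewrite addrC -subr_eq opprD addrA; apply/eqP.
have l2 : l * l = 1.
  have := dot3_mulmx m m MMT; by rewrite mM !dot3_lin m1 mulr1.
have /eqP : (l - 1) * (l + 1) = 0.
  by rewrite mulrDr mulr1 mulrBl l2 mul1r addrA subrK subrr.
rewrite mulf_eq0 subr_eq0 addr_eq0 => /orP[/eqP l1|/eqP l1].
  apply: Or31 => v; rewrite {1}(expand v) {4}(expand v).
  by rewrite !mulmxDl -!scalemxAl nM uM mM l1 scale1r.
apply: Or33; exists m => // v.
rewrite {1}(expand v) {4}(expand v) !mulmxDl -!scalemxAl nM uM mM l1.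
rewrite (dot3C m v); move: (dot3 v n) (dot3 v u) (dot3 v m) => p q r.
by coord3; ring.
Qed.

(** * Differentials of maps from the plane to space *)

Lemma coord_le_norm (R : realType) (u : E3 R) i : `|u 0 i| <= `|u|.
Proof.
rewrite -[`|u|]/(mx_norm u) mx_normrE; apply/bigmax_geP; right => /=.
by exists (0, i).
Qed.

Lemma norm_le_coord (R : realType) (u : E3 R) (c : R) :
  0 <= c -> (forall i, `|u 0 i| <= c) -> `|u| <= c.
Proof.
move=> c0 H; rewrite -[`|u|]/(mx_norm u) mx_normrE; apply/bigmax_leP; split=> //.
by move=> [i j] _ /=; rewrite (ord1 i).
Qed.

Lemma mulmx_bound (R : realType) (M : 'M[R]_3) :
  exists2 K : R, 0 < K & forall x : E3 R, `|x *m M| <= K * `|x|.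
Proof.
exists (1 + \sum_(i < 3) \sum_(j < 3) `|M i j|).
  by rewrite ltr_pwDl // sumr_ge0 // => i _; rewrite sumr_ge0.
move=> x; apply: norm_le_coord.
  by rewrite mulr_ge0 // addr_ge0 // sumr_ge0 // => i _; rewrite sumr_ge0.
move=> j; rewrite mxE; apply: le_trans (ler_norm_sum _ _ _) _.
apply: le_trans (_ : \sum_(i < 3) `|M i j| * `|x| <= _).
  by apply: ler_sum => i _; rewrite normrM mulrC ler_wpM2l // coord_le_norm.
rewrite -mulr_suml ler_wpM2r //.
apply: le_trans (_ : \sum_(i < 3) \sum_(j < 3) `|M i j| <= _); last by rewrite lerDr.
apply: ler_sum => i _; rewrite (bigD1 j) //= lerDl sumr_ge0 //.
Qed.

(** The norm is the sup norm; the constant counts the three coordinates. *)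
Lemma dot3_bound (R : realType) (u v : E3 R) : `|dot3 u v| <= 3 * `|u| * `|v|.
Proof.
have h i : `|u 0 i * v 0 i| <= `|u| * `|v|.
  by rewrite normrM ler_pM // coord_le_norm.
rewrite coordE; apply: le_trans (ler_normD _ _) _.
apply: le_trans (lerD (ler_normD _ _) (lexx _)) _.
apply: le_trans (lerD (lerD (h _) (h _)) (h _)) _.
by rewrite le_eqVlt; apply/orP; left; apply/eqP; ring.
Qed.

Definition rlin (R : realType) (a b : E3 R) (v : CC R) : E3 R :=
  complex.Re v *: a + complex.Im v *: b.

(* [F] has at [z] the real differential sending [1] to [a] and [i] to [b] *)
Definition rdiff (R : realType) (F : CC R -> E3 R) (z : CC R) (a b : E3 R) :
    Prop :=
  forall e : R, 0 < e -> exists2 r : R, 0 < r & forall w, cmod (w - z) < r ->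
    `|F w - F z - rlin a b (w - z)| <= e * cmod (w - z).

Lemma rlinD (R : realType) (a b : E3 R) v w :
  rlin a b (v + w) = rlin a b v + rlin a b w.
Proof. by rewrite /rlin !raddfD /= !scalerDl addrACA. Qed.

Lemma rlinB (R : realType) (a b : E3 R) v w :
  rlin a b (v - w) = rlin a b v - rlin a b w.
Proof. by rewrite /rlin !raddfB /= !scalerBl opprD addrACA. Qed.

Lemma rlin_bound (R : realType) (a b : E3 R) v :
  `|rlin a b v| <= (`|a| + `|b|) * cmod v.
Proof.
apply: le_trans (ler_normD _ _) _; rewrite !normrZ mulrDl.
by rewrite lerD // mulrC ler_wpM2l // ?Re_le_cmod ?Im_le_cmod.
Qed.

Lemma rlin_real (R : realType) (a b : E3 R) (t : R) v :
  rlin a b (t%:C * v) = t *: rlin a b v.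
Proof.
rewrite /rlin scalerDr !scalerA; case: v => x y /=.
by rewrite !mul0r subr0 addr0.
Qed.

Lemma rlin1 (R : realType) (a b : E3 R) : rlin a b 1 = a.
Proof. by rewrite /rlin /= scale1r scale0r addr0. Qed.

Lemma rlini (R : realType) (a b : E3 R) : rlin a b 'i = b.
Proof. by rewrite /rlin /= scale1r scale0r add0r. Qed.

Lemma rdiff_near (R : realType) (F G : CC R -> E3 R) z a b (r : R) :
  0 < r -> (forall w, cmod (w - z) < r -> F w = G w) ->
  rdiff F z a b -> rdiff G z a b.
Proof.
move=> r0 FG H e e0; have [r' r'0 H'] := H e e0.
exists (Num.min r r'); first by rewrite lt_min r0.
move=> w; rewrite lt_min => /andP[w1 w2].
by rewrite -(FG w) // -(FG z) ?subrr ?cmod0 //; apply: H'.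
Qed.

Lemma rdiff_cts (R : realType) (F : CC R -> E3 R) z a b :
  rdiff F z a b -> forall e : R, 0 < e -> exists2 r : R, 0 < r &
    forall w, cmod (w - z) < r -> `|F w - F z| < e.
Proof.
move=> H e e0; have [r r0 H'] := H 1 ltr01.
set K := 1 + (`|a| + `|b|).
have K0 : 0 < K by rewrite ltr_pwDl // addr_ge0.
exists (Num.min r (e / K)); first by rewrite lt_min r0 divr_gt0.
move=> w; rewrite lt_min => /andP[w1]; rewrite ltr_pdivlMr // => w2.
have := H' w w1; rewrite mul1r => w3.
have -> : F w - F z = (F w - F z - rlin a b (w - z)) + rlin a b (w - z).
  by rewrite subrK.
apply: le_lt_trans (ler_normD _ _) _; apply: le_lt_trans w2.
by rewrite /K mulrDr mulr1 lerD // mulrC rlin_bound.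
Qed.

Lemma rdiff_uniq (R : realType) (F : CC R -> E3 R) z a b a' b' :
  rdiff F z a b -> rdiff F z a' b' -> a = a' /\ b = b'.
Proof.
move=> H1 H2; suff E v : v != 0 -> rlin a b v = rlin a' b' v.
  have := E 1 (oner_neq0 _); have := E 'i; rewrite !rlin1 !rlini => Ei E1.
  by split=> //; apply: Ei; rewrite eq_complex /= oner_eq0 andbF.
move=> v0; apply/eqP; rewrite -subr_eq0 -normr_eq0; apply/eqP.
apply: (@le_small_eq0 _ _ (2 * cmod v)) => // e e0.
have [r1 r10 K1] := H1 e e0; have [r2 r20 K2] := H2 e e0.
have v0' := cmod_gt0 v0.
pose t : R := Num.min r1 r2 / (2 * cmod v).
have m0 : 0 < Num.min r1 r2 by rewrite lt_min r10.
have t0 : 0 < t by rewrite divr_gt0 // mulr_gt0.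
have tE : z + t%:C * v - z = t%:C * v by rewrite addrC addKr.
have tv : cmod (z + t%:C * v - z) = t * cmod v.
  by rewrite tE cmodM cmod_real gtr0_norm.
have tm : t * cmod v < Num.min r1 r2.
  rewrite /t invfM mulrA mulfVK ?gt_eqF // ltr_pdivrMr //.
  by rewrite ltr_pMr // ltr1n.
move: (tm); rewrite lt_min -!tv => /andP[t1 t2].
have A1 := K1 _ t1; have A2 := K2 _ t2.
rewrite !tv !tE !rlin_real in A1 A2.
rewrite -(ler_pM2l t0) -{1}(gtr0_norm t0) -normrZ scalerBr.
set u := F _ - F z in A1 A2.
have -> : forall x y : E3 R, x - y = (u - y) - (u - x).
  by move=> x y; rewrite opprB [RHS]addrC addrA subrK.
apply: le_trans (ler_normB _ _) _; apply: le_trans (lerD A2 A1) _.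
by rewrite le_eqVlt; apply/orP; left; apply/eqP; ring.
Qed.

Lemma rdiff_comp (R : realType) c (h : CC R -> CC R) (F : CC R -> E3 R) z d a b :
  cdiff c h z d -> rdiff F (h z) a b ->
  rdiff (F \o h) z (rlin a b d) (rlin a b (d * bconj c 'i)).
Proof.
move=> Hh HF e e0.
set K := 1 + cmod d + (`|a| + `|b|).
have ab0 : 0 <= `|a| + `|b| by rewrite addr_ge0.
have K1 : 1 <= K by rewrite /K -addrA lerDl addr_ge0 ?cmod_ge0.
have K0 : 0 < K by apply: lt_le_trans K1.
have dK : 1 + cmod d <= K by rewrite /K lerDl.
have abK : `|a| + `|b| <= K by rewrite /K lerDr addr_ge0 ?cmod_ge0.
pose e1 := Num.min 1 (e / (2 * K)).
have e10 : 0 < e1 by rewrite lt_min ltr01 divr_gt0 // mulr_gt0.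
have e11 : e1 <= 1 by rewrite ge_min lexx.
have e1e : e1 * K <= e / 2.
  have h1 : e1 <= e / (2 * K) by rewrite ge_min lexx orbT.
  apply: le_trans (ler_wpM2r (ltW K0) h1) _.
  by rewrite invfM mulrA mulfVK // gt_eqF.
have [r1 r10 H1] := HF e1 e10.
have [r2 r20 H2] := cdiff_cts Hh r10.
have [r3 r30 H3] := Hh e1 e10.
exists (Num.min r2 r3); first by rewrite lt_min r20.
move=> w; rewrite lt_min => /andP[w2 w3] /=.
have A1 := H1 _ (H2 _ w2); have A2 := H3 _ w3.
set u := h w - h z in A1 A2 *; set v := w - z in A2 *.
have E : rlin (rlin a b d) (rlin a b (d * bconj c 'i)) v = rlin a b (d * bconj c v).
  have Ev : d * bconj c v =
      (complex.Re v)%:C * d + (complex.Im v)%:C * (d * bconj c 'i).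
    have -> : bconj c v = bconj c ((complex.Re v)%:C + 'i * (complex.Im v)%:C).
      by rewrite -complexE.
    by rewrite bconjD bconjM !bconj_real; ring.
  by rewrite Ev [RHS]rlinD !rlin_real.
rewrite E.
have -> : F (h w) - F (h z) - rlin a b (d * bconj c v) =
  (F (h w) - F (h z) - rlin a b u) + rlin a b (u - d * bconj c v).
  by rewrite (rlinB a b u) addrA subrK.
apply: le_trans (ler_normD _ _) _.
have u1 : cmod u <= K * cmod v.
  have -> : u = (u - d * bconj c v) + d * bconj c v by rewrite subrK.
  apply: le_trans (cmodD _ _) _; rewrite cmodM cmod_bconj.
  apply: le_trans (lerD A2 (lexx _)) _; rewrite -mulrDl ler_wpM2r ?cmod_ge0 //.
  by apply: le_trans dK; rewrite lerD2r.
have B1 : e1 * cmod u <= e / 2 * cmod v.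
  apply: le_trans (_ : e1 * (K * cmod v) <= _).
    by rewrite ler_wpM2l // ltW.
  by rewrite mulrA ler_wpM2r ?cmod_ge0.
have B2 : `|rlin a b (u - d * bconj c v)| <= e / 2 * cmod v.
  apply: le_trans (rlin_bound _ _ _) _.
  apply: le_trans (_ : K * (e1 * cmod v) <= _).
    by rewrite ler_pM ?cmod_ge0.
  by rewrite mulrA [K * _]mulrC ler_wpM2r ?cmod_ge0.
apply: le_trans (lerD (le_trans A1 B1) B2) _.
by rewrite -mulrDl -splitr.
Qed.

Lemma rdiff_affine (R : realType) (F : CC R -> E3 R) (m : E3 R -> E3 R)
    (M : 'M[R]_3) z a b :
  (forall x y, m x = m y + (x - y) *m M) ->
  rdiff F z a b -> rdiff (m \o F) z (a *m M) (b *m M).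
Proof.
move=> Hm H e e0; have [K K0 HK] := mulmx_bound M.
have [r r0 Hr] := H (e / K) (divr_gt0 e0 K0); exists r => // w /Hr Hw /=.
have -> : m (F w) - m (F z) - rlin (a *m M) (b *m M) (w - z) =
    (F w - F z - rlin a b (w - z)) *m M.
  rewrite (Hm (F w) (F z)) [m _ + _]addrC addrK [RHS]mulmxBl; congr (_ - _).
  by rewrite /rlin [RHS]mulmxDl -!scalemxAl.
apply: le_trans (HK _) _; apply: le_trans (ler_wpM2l (ltW K0) Hw) _.
by rewrite mulrA [K * _]mulrC mulfVK // gt_eqF.
Qed.

Lemma conformal_at_rdiff (R : realType) (N : E3 R -> E3 R) (F : CC R -> E3 R) z :
  conformal_at N F z ->
  exists2 a, a != 0 & rdiff F z a (cross3 (N (F z)) a).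
Proof.
rewrite /conformal_at; set F2 := fun u : R * R => _; set z2 := (_, _).
move=> [dF a0 bE]; exists ('d F2 z2 (1, 0)) => //; rewrite -bE => e e0.
have := diff_locally dF => /eqaddoP /(_ e e0).
move=> /nbhs_ballP[r /= r0 Hr]; exists r => // w wr.
pose h := (complex.Re (w - z), complex.Im (w - z)).
have hr : ball (0 : R * R) r h.
  rewrite -ball_normE /= sub0r normrN prod_normE /= gt_max.
  by rewrite (le_lt_trans (Re_le_cmod _) wr) (le_lt_trans (Im_le_cmod _) wr).
have Eh : h = h.1 *: ((1, 0) : R * R) + h.2 *: ((0, 1) : R * R).
  by rewrite /h; congr (_, _) => /=; rewrite /GRing.scale /= !mulr1 !mulr0 ?addr0 ?add0r.
have := Hr h hr; rewrite /= => H.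
have Ed : 'd F2 z2 h = rlin ('d F2 z2 (1, 0)) ('d F2 z2 (0, 1)) (w - z).
  by rewrite Eh linearD !linearZ.
have Ew : F2 (h + z2) = F w.
  by rewrite /F2 /h /z2 /= !raddfB /= !subrK; case: (w).
have Ez : F2 z2 = F z by rewrite /F2 /z2 /=; case: (z).
move: H; rewrite -[X in `|X|]/(F2 (h + z2) - (F2 z2 + 'd F2 z2 h)) Ew Ez Ed opprD addrA.
move=> /le_trans; apply; rewrite ler_wpM2l ?(ltW e0) //.
by rewrite prod_normE /= ge_max Re_le_cmod Im_le_cmod.
Qed.

Lemma rdiff_curve (R : realType) (F : CC R -> E3 R) z a b v :
  rdiff F z a b ->
  is_derive (0 : R) (1 : R) (fun t : R => F (z + t%:C * v)) (rlin a b v).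
Proof.
move=> H; set u := fun t : R => _.
suff Hc : (fun h : R => h^-1 *: ((u \o shift 0) (h *: 1) - u 0)) @ 0^' --> rlin a b v.
  by split; [apply/cvg_ex; exists (rlin a b v) | apply: cvg_lim].
apply/cvgrPdist_le => /= e e0.
have K0 : 0 < 1 + cmod v by rewrite ltr_pwDl // cmod_ge0.
have [r r0 Hr] := H _ (divr_gt0 e0 K0).
near=> t.
have t0 : t != 0 by near: t; exact: nbhs_dnbhs_neq.
have tr : `|t| * (1 + cmod v) < r.
  rewrite -ltr_pdivlMr //; near: t; apply: nbhs_dnbhs.
  apply/nbhs_ballP; exists (r / (1 + cmod v)); first exact: divr_gt0.
  by move=> s; rewrite -ball_normE /= sub0r normrN.
have E : z + t%:C * v - z = t%:C * v by rewrite addrC addKr.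
have := Hr (z + t%:C * v); rewrite E cmodM cmod_real rlin_real => H1.
have {H1} /H1 : `|t| * cmod v < r by apply: le_lt_trans tr; rewrite ler_wpM2l // lerDr.
rewrite /u /= -[t *: 1]/(t * 1) mulr1 addr0 rmorph0 mul0r addr0.
set D := F _ - F z; clearbody D => H1.
have -> : rlin a b v - t^-1 *: D = - t^-1 *: (D - t *: rlin a b v).
  by rewrite scaleNr scalerBr opprB scalerA mulVf // scale1r.
rewrite normrZ normrN normfV ler_pdivrMl ?normr_gt0 //.
apply: le_trans H1 _; rewrite mulrCA ler_wpM2l // -mulrA ler_piMr ?(ltW e0) //.
by rewrite ler_pdivrMl // mulr1 lerDr.
Unshelve. all: by end_near.
Qed.

(** At a local maximum every directional derivative is nonpositive; applying this to [1], ['i] and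
    their opposites gives two equalities. *)
Lemma rdiff_max (R : realType) (F : CC R -> E3 R) z a b v (r0 : R) :
  rdiff F z a b -> 0 < r0 ->
  (forall w, cmod (w - z) < r0 -> dot3 v (F w) <= dot3 v (F z)) ->
  dot3 v a = 0 /\ dot3 v b = 0.
Proof.
move=> H r00 Hmax.
suff Hle u : u != 0 -> dot3 v (rlin a b u) <= 0.
  have i0 : ('i : CC R) != 0 by rewrite eq_complex /= oner_eq0 andbF.
  have h1 := Hle 1 (oner_neq0 _); have h2 := Hle 'i i0.
  have h3 := Hle (- 1); have h4 := Hle (- 'i).
  rewrite oppr_eq0 in h3; rewrite oppr_eq0 in h4.
  have {h3} := h3 (oner_neq0 _); have {h4} := h4 i0.
  have rN w : rlin a b (- w) = - rlin a b w.
    by rewrite -[- w]add0r rlinB {1}/rlin /= !scale0r addr0 add0r.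
  rewrite !rN rlin1 rlini !dot3Nr !oppr_le0 => h4 h3.
  by rewrite rlin1 in h1; rewrite rlini in h2; split; apply/eqP; rewrite eq_le ?h1 ?h2.
move=> u0; have cu := cmod_gt0 u0.
apply/ler_addgt0Pr => e e0; rewrite add0r.
have K0 : 0 < 1 + 3 * `|v| * cmod u.
  by rewrite ltr_pwDl // !mulr_ge0 ?cmod_ge0.
have [r1 r10 Hr] := H _ (divr_gt0 e0 K0).
pose t : R := Num.min r0 r1 / (2 * cmod u).
have m0 : 0 < Num.min r0 r1 by rewrite lt_min r00.
have t0 : 0 < t by rewrite divr_gt0 // mulr_gt0.
have tE : z + t%:C * u - z = t%:C * u by rewrite addrC addKr.
have tu : cmod (z + t%:C * u - z) = t * cmod u.
  by rewrite tE cmodM cmod_real gtr0_norm.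
have tm : t * cmod u < Num.min r0 r1.
  rewrite /t invfM mulrA mulfVK ?gt_eqF // ltr_pdivrMr //.
  by rewrite ltr_pMr // ltr1n.
move: (tm); rewrite lt_min -!tu => /andP[t1 t2].
have A1 := Hmax _ t1; have := Hr _ t2.
rewrite tu tE rlin_real => A2.
rewrite -(ler_pM2l t0) -dot3Zr.
set X := F (z + t%:C * u) in A1 A2; set L := t *: rlin a b u in A2 *.
have -> : dot3 v L = dot3 v X - dot3 v (F z) - dot3 v (X - F z - L).
  by rewrite !(dot3Dr, dot3Nr); ring.
apply: le_trans (_ : `|dot3 v (X - F z - L)| <= _).
  have := ler_norm (- dot3 v (X - F z - L)); rewrite normrN => h; lra.
apply: le_trans (dot3_bound _ _) _.
apply: le_trans (ler_wpM2l _ A2) _; first by rewrite mulr_ge0.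
have -> : 3 * `|v| * (e / (1 + 3 * `|v| * cmod u) * (t * cmod u)) =
   (t * e) * ((3 * `|v| * cmod u) / (1 + 3 * `|v| * cmod u)) by ring.
apply: ler_piMr; first by rewrite mulr_ge0 // ltW.
by rewrite ler_pdivrMr // mul1r lerDr.
Qed.

(** * Double covers of cubes *)

(** The supremum [s] of the [t] with [P a t] cannot be less than [b], since the interval given by
    the local hypothesis at [s] extends beyond it. *)
Lemma cousin (R : realType) (P : R -> R -> Prop) :
  (forall x y x' y', x <= x' -> x' <= y' -> y' <= y -> P x y -> P x' y') ->
  (forall x y z, x <= y -> y <= z -> P x y -> P y z -> P x z) ->
  (forall x, exists2 r : R, 0 < r & P (x - r) (x + r)) ->
  forall a b, a <= b -> P a b.
Proof.
move=> Psub Padd Ploc a b ab.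
pose E := [set t | a <= t <= b /\ P a t].
have Ea : E a.
  split; first by rewrite lexx ab.
  have [r r0 Hr] := Ploc a.
  by apply: Psub Hr => //; rewrite ?lerBlDr ?lerDl ltW.
have Eb : ubound E b by move=> t [/andP[]].
have supE : has_sup E by split; [exists a | exists b].
pose s := sup E.
have sb : s <= b by apply: ge_sup => //; exists a.
have as_ : a <= s by apply: sup_upper_bound.
have [r r0 Hr] := Ploc s.
have [t [/andP[at_ tb] Pat] st] := sup_adherent r0 supE.
have ts : t <= s by apply: sup_upper_bound => //; split=> //; rewrite at_ tb.
pose m := Num.min (s + r) b.
have tm : t <= m by rewrite le_min tb andbT (le_trans ts) // lerDl ltW.
have Pam : P a m.
  apply: (Padd _ t) => //; apply: Psub Hr => //; first exact: ltW.
  by rewrite ge_min lexx.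
have ms : m <= s.
  apply: sup_upper_bound => //; split=> //.
  by rewrite (le_trans at_ tm) /m ge_min lexx orbT.
move: ms Pam; rewrite /m; case: (leP (s + r) b) => // _.
by rewrite gerDl leNgt r0.
Qed.

Definition convex3 (R : realType) (Q : set (E3 R)) : Prop :=
  forall (x y : E3 R) (t : R), Q x -> Q y -> 0 <= t <= 1 -> Q (x + t *: (y - x)).

Lemma segment_continuous (R : realType) (x y : E3 R) :
  continuous (fun t : R => x + t *: (y - x)).
Proof.
move=> t; apply: cvgD; first exact: cvg_cst.
by apply: cvgZr_tmp; exact: cvg_id.
Qed.

Lemma convex3_locally_constant (R : realType) (Q : set (E3 R)) (T : Type)
    (g : E3 R -> T) :
  convex3 Q ->
  (forall x, Q x -> \forall x' \near x, Q x' -> g x' = g x) ->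
  forall x y, Q x -> Q y -> g x = g y.
Proof.
move=> Qc Hg x y Qx Qy.
pose u (t : R) := x + t *: (y - x).
pose P (s t : R) := forall a b : R, 0 <= a <= 1 -> 0 <= b <= 1 ->
  s <= a <= t -> s <= b <= t -> g (u a) = g (u b).
have P01 : P 0 1.
  apply: cousin => //.
  - move=> p q p' q' pp' pq' q'q H a b a01 b01 /andP[a1 a2] /andP[b1 b2].
    apply: H => //; first by rewrite (le_trans pp' a1) (le_trans a2 q'q).
    by rewrite (le_trans pp' b1) (le_trans b2 q'q).
  - move=> p q r pq qr H1 H2 a b a01 b01 /andP[a1 a2] /andP[b1 b2].
    have [qa|qa] := leP a q; have [qb|qb] := leP b q.
    + by apply: H1 => //; rewrite ?a1 ?b1.
    + have q01 : 0 <= q <= 1.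
        move: a01 b01 => /andP[h1 _] /andP[_ h2].
        by rewrite (le_trans h1 qa) (le_trans (ltW qb) h2).
      rewrite (H1 a q) ?a1 ?pq ?lexx //; apply: H2 => //; rewrite ?lexx ?qr //.
      by rewrite (ltW qb).
    + have q01 : 0 <= q <= 1.
        move: a01 b01 => /andP[_ h1] /andP[h2 _].
        by rewrite (le_trans h2 qb) (le_trans (ltW qa) h1).
      rewrite (H2 a q) ?(ltW qa) ?a2 ?qr ?lexx //; apply: H1 => //; rewrite ?lexx ?pq //.
      by rewrite b1.
    + by apply: H2 => //; rewrite ?a2 ?b2 ltW.
  - move=> s; have [s01|s01] := boolP (0 <= s <= 1).
      have Qs : Q (u s) by exact: Qc.
      have /nbhs_ballP[r /= r0 Hr] := @segment_continuous _ x y s _ (Hg _ Qs).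
      exists (r / 2); first by rewrite divr_gt0.
      suff E a : 0 <= a <= 1 -> s - r / 2 <= a <= s + r / 2 -> g (u a) = g (u s).
        by move=> a b a01 b01 sa sb; rewrite !E.
      move=> a01 sa; apply: (Hr a); last exact: Qc.
      rewrite -ball_normE /= distrC; apply: le_lt_trans (_ : r / 2 < r).
        by rewrite ler_distl.
      by rewrite ltr_pdivrMr // ltr_pMr // ltr1n.
    have s0 : s <= 0 \/ 1 <= s -> s < 0 \/ 1 < s.
      move: s01; rewrite negb_and -!ltNge => /orP[|]; by [left|right].
    (* For a parameter outside [0, 1] the interval is chosen to miss [0, 1], so that [P] holds
       vacuously. *)
    have [r r0 Hr] : exists2 r : R, 0 < r & (s + r < 0) \/ (1 < s - r).
      move: s01; rewrite negb_and -!ltNge => /orP[h|h].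
        by exists (- s / 2); [rewrite divr_gt0 // oppr_gt0 | left; lra].
      by exists ((s - 1) / 2); [rewrite divr_gt0 // subr_gt0 | right; lra].
    exists r => // a b /andP[a0 a1] /andP[b0 b1] /andP[a2 a3].
    by exfalso; apply: (@lt_irrefl_false R); case: Hr => ?; lra.
have := P01 0 1; rewrite !lexx !ler01 /u scale0r addr0 scale1r addrC subrK.
by apply.
Qed.

(* [c] is a cocycle for a locally trivial double cover of the space;
   [trivial_on] asks for a section over Q. *)
Definition local_cocycle (R : realType) (c : E3 R -> E3 R -> bool) : Prop :=
  forall x, \forall x' \near x, \forall x'' \near x',
    c x x'' = c x x' (+) c x' x''.

Definition trivial_on (R : realType) (c : E3 R -> E3 R -> bool)
    (Q : set (E3 R)) : Prop :=
  exists s : E3 R -> bool, forall x, Q x ->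
    \forall x' \near x, Q x' -> s x' = s x (+) c x x'.

Lemma trivial_onS (R : realType) (c : E3 R -> E3 R -> bool) (Q Q' : set (E3 R)) :
  Q' `<=` Q -> trivial_on c Q -> trivial_on c Q'.
Proof.
move=> QQ [s Hs]; exists s => x /QQ /Hs; apply: filterS => x' H /QQ.
exact: H.
Qed.

(** Two sections differ by a locally constant boolean, hence by a constant [k] on the convex
    intersection; shifting one of them by [k] makes them agree. Closedness ensures that only the
    sets containing a point matter near it. *)
Lemma trivial_onU (R : realType) (c : E3 R -> E3 R -> bool) (Q Q' : set (E3 R)) :
  closed Q -> closed Q' -> convex3 (Q `&` Q') ->
  trivial_on c Q -> trivial_on c Q' -> trivial_on c (Q `|` Q').
Proof.
move=> cQ cQ' Qc [s1 H1] [s2 H2].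
have [k Hk] : exists k, forall x, Q x -> Q' x -> s1 x = s2 x (+) k.
  have Hg x : (Q `&` Q') x -> \forall x' \near x, (Q `&` Q') x' ->
      s1 x' (+) s2 x' = s1 x (+) s2 x.
    move=> [Qx Q'x]; have h1 := H1 _ Qx; have h2 := H2 _ Q'x.
    near=> x' => -[Qx' Q'x'].
    rewrite (near h1 x') // (near h2 x') //.
    by case: (s1 x) (s2 x) (c x x') => [] [] [].
  have [[x0 Qx0]|N] := pselect ((Q `&` Q') !=set0); last first.
    by exists false => x Qx Q'x; exfalso; apply: N; exists x.
  exists (s1 x0 (+) s2 x0) => x Qx Q'x.
  rewrite -(convex3_locally_constant Qc Hg (conj Qx Q'x) Qx0).
  by case: (s1 x) (s2 x) => [] [].
pose s x := if asbool (Q x) then s1 x else s2 x (+) k.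
have sQ x : Q x -> s x = s1 x by move=> Qx; rewrite /s asboolT.
have sQ' x : Q' x -> s x = s2 x (+) k.
  by move=> Q'x; rewrite /s; case: asboolP => // Qx; exact: Hk.
exists s => x Qx.
have h1 : \forall x' \near x, Q x' -> s x' = s x (+) c x x'.
  have [Qx0|nQ] := pselect (Q x).
    by apply: filterS (H1 _ Qx0) => x' + Qx'; rewrite !sQ //; apply.
  have := open_nbhs_nbhs (conj (closed_openC cQ) nQ).
  by apply: filterS => x' nQ' Qx'.
have h2 : \forall x' \near x, Q' x' -> s x' = s x (+) c x x'.
  have [Qx0|nQ] := pselect (Q' x).
    apply: filterS (H2 _ Qx0) => x' + Qx'; rewrite !sQ' // => -> //.
    by rewrite -!addbA [k (+) _]addbC.
  have := open_nbhs_nbhs (conj (closed_openC cQ') nQ).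
  by apply: filterS => x' nQ' Qx'.
near=> x' => -[Qx'|Qx'].
  by apply: (near h1 x').
by apply: (near h2 x').
Unshelve. all: by end_near.
Qed.

Definition slab (R : realType) (i : 'I_3) (a b : R) : set (E3 R) :=
  [set x | a <= x 0 i <= b].

Lemma slab_closed (R : realType) i (a b : R) : closed (slab i a b).
Proof.
have -> : slab i a b = (fun x : E3 R => x 0 i) @^-1` `[a, b].
  by apply/seteqP; split => x /=; rewrite in_itv.
apply: preimage_closed; last by apply: interval_closed.
by move=> x _; exact: coord_continuous.
Qed.

Lemma slab_convex (R : realType) i (a b : R) : convex3 (slab i a b).
Proof.
move=> x y t /andP[x1 x2] /andP[y1 y2] /andP[t0 t1].
rewrite /slab /= !mxE.
have -> : x 0 i + t * (y 0 i - x 0 i) = (1 - t) * x 0 i + t * y 0 i by ring.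
have t1' : 0 <= 1 - t by rewrite subr_ge0.
have e z : z = (1 - t) * z + t * z by ring.
apply/andP; split; [rewrite [leLHS](e a)|rewrite [leRHS](e b)];
  by rewrite lerD // ler_wpM2l.
Qed.

Lemma convex3I (R : realType) (Q Q' : set (E3 R)) :
  convex3 Q -> convex3 Q' -> convex3 (Q `&` Q').
Proof. by move=> H H' x y t [? ?] [? ?] ?; split; [exact: H | exact: H']. Qed.

Lemma slabS (R : realType) i (a b a' b' : R) :
  a <= a' -> b' <= b -> slab i a' b' `<=` slab i a b.
Proof.
by move=> aa bb x /andP[x1 x2]; rewrite /slab /= (le_trans aa x1) (le_trans x2 bb).
Qed.

(** Subdivision in the coordinate [i] alone; the thickness [r] in the other directions may shrink at
    each gluing, and finitely many gluings keep it positive. *)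
Lemma trivial_on_slab (R : realType) (c : E3 R -> E3 R -> bool) (i : 'I_3)
    (K : R -> set (E3 R)) :
  (forall r, closed (K r)) -> (forall r, convex3 (K r)) ->
  (forall r r' : R, r <= r' -> K r `<=` K r') ->
  (forall s : R, exists2 r : R, 0 < r &
     trivial_on c (K r `&` slab i (s - r) (s + r))) ->
  forall a b, a <= b -> exists2 r : R, 0 < r & trivial_on c (K r `&` slab i a b).
Proof.
move=> Kcl Kc KS Hloc.
pose P (a b : R) := exists2 r : R, 0 < r & trivial_on c (K r `&` slab i a b).
apply: (@cousin _ P).
- move=> x y x' y' xx' _ y'y [r r0 Hr]; exists r => //.
  by apply: trivial_onS Hr; apply: setIS; exact: slabS.
- move=> x y z xy yz [r r0 Hr] [r' r'0 Hr'].
  pose q := Num.min r r'; exists q; first by rewrite lt_min r0.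
  have qr : K q `<=` K r by apply: KS; rewrite ge_min lexx.
  have qr' : K q `<=` K r' by apply: KS; rewrite ge_min lexx orbT.
  have := @trivial_onU _ c (K q `&` slab i x y) (K q `&` slab i y z)
    (closedI (Kcl _) (@slab_closed _ _ _ _)) (closedI (Kcl _) (@slab_closed _ _ _ _))
    (convex3I (convex3I (Kc _) (@slab_convex _ _ _ _)) (convex3I (Kc _) (@slab_convex _ _ _ _)))
    (trivial_onS (@setSI _ _ _ _ qr) Hr) (trivial_onS (@setSI _ _ _ _ qr') Hr').
  apply: trivial_onS => u [Ku /andP[u1 u2]].
  by have [h|h] := leP (u 0 i) y; [left|right]; split=> //;
     rewrite /slab /= ?u1 ?h ?u2 ?(ltW h).
- by move=> s; have [r r0 Hr] := Hloc s; exists r => //; exists r.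
Qed.

(** Small boxes are extended to full length in one coordinate after another, so each gluing takes
    place along a convex set. *)
Lemma trivial_on_cube (R : realType) (c : E3 R -> E3 R -> bool) (L : R) :
  0 <= L -> local_cocycle c ->
  trivial_on c [set x | forall i, `|x 0 i| <= L].
Proof.
move=> L0 Hc; have LL : - L <= L by rewrite (le_trans _ L0) // oppr_le0.
have H0 (x : E3 R) : exists2 r : R, 0 < r & trivial_on c
   (slab (inord 0) (x 0 (inord 0) - r) (x 0 (inord 0) + r)
    `&` slab (inord 1) (x 0 (inord 1) - r) (x 0 (inord 1) + r)
    `&` slab (inord 2) (x 0 (inord 2) - r) (x 0 (inord 2) + r)).
  have /nbhs_ballP[r /= r0 Hr] := Hc x.
  exists (r / 2); first by rewrite divr_gt0.
  (* Near [x] the function [c x] is itself a section, by the cocycle relation. *)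
  exists (c x) => x' [[h0 h1] h2].
  have bx' : ball x r x'.
    rewrite -ball_normE /=; apply: le_lt_trans (_ : r / 2 < r).
      apply: norm_le_coord; first by rewrite divr_ge0 // ltW.
      have hh (i : 'I_3) : slab i (x 0 i - r / 2) (x 0 i + r / 2) x' ->
          `|(x - x') 0 i| <= r / 2.
        by move=> h; rewrite !mxE distrC ler_distl.
      move=> i; have [E|[E|E]] : i = inord 0 \/ i = inord 1 \/ i = inord 2.
        by case: i => [[|[|[|//]]] hi]; [left | right; left | right; right];
          apply/val_inj; rewrite /= inordK.
      + by rewrite E; apply: hh.
      + by rewrite E; apply: hh.
      + by rewrite E; apply: hh.
    by rewrite ltr_pdivrMr // ltr_pMr // ltr1n.
  by apply: filterS (Hr _ bx') => x'' -> _.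
pose vec (x y z : R) : E3 R := \row_j
  if j == inord 0 then x else if j == inord 1 then y else z.
have v0 x y z : vec x y z 0 (inord 0) = x by rewrite mxE eqxx.
have v1 x y z : vec x y z 0 (inord 1) = y.
  by rewrite mxE eqxx -val_eqE /= !inordK.
have v2 x y z : vec x y z 0 (inord 2) = z.
  by rewrite mxE -!val_eqE /= !inordK.
have sS i (s : R) r r' : r <= r' -> @slab R i (s - r) (s + r) `<=` slab i (s - r') (s + r').
  by move=> rr; apply: slabS; [rewrite lerD2l lerN2 | rewrite lerD2l].
have H1 (x y : R) : exists2 r : R, 0 < r & trivial_on c
   (slab (inord 0) (x - r) (x + r) `&` slab (inord 1) (y - r) (y + r)
    `&` slab (inord 2) (- L) L).
  apply: (@trivial_on_slab _ c (inord 2) (fun r =>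
    slab (inord 0) (x - r) (x + r) `&` slab (inord 1) (y - r) (y + r))) => //.
  - by move=> r; apply: closedI; exact: slab_closed.
  - by move=> r; apply: convex3I; exact: slab_convex.
  - by move=> r r' rr u [h h']; split; [exact: (sS _ _ _ _ rr u h) | exact: (sS _ _ _ _ rr u h')].
  - by move=> z; have := H0 (vec x y z); rewrite v0 v1 v2.
have H2 (x : R) : exists2 r : R, 0 < r & trivial_on c
   (slab (inord 0) (x - r) (x + r) `&` slab (inord 2) (- L) L
    `&` slab (inord 1) (- L) L).
  apply: (@trivial_on_slab _ c (inord 1) (fun r =>
    slab (inord 0) (x - r) (x + r) `&` slab (inord 2) (- L) L)) => //.
  - by move=> r; apply: closedI; exact: slab_closed.
  - by move=> r; apply: convex3I; exact: slab_convex.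
  - by move=> r r' rr u [h h']; split => //; exact: (sS _ _ _ _ rr u h).
  - move=> y; have [r r0 Hr] := H1 x y; exists r => //.
    by apply: trivial_onS Hr => u [[? ?] ?].
have [r r0] : exists2 r : R, 0 < r & trivial_on c
   (slab (inord 1) (- L) L `&` slab (inord 2) (- L) L
    `&` slab (inord 0) (- L) L).
  apply: (@trivial_on_slab _ c (inord 0) (fun r =>
    slab (inord 1) (- L) L `&` slab (inord 2) (- L) L)) => //.
  - by move=> r; apply: closedI; exact: slab_closed.
  - by move=> r; apply: convex3I; exact: slab_convex.
  - by move=> r r' _ u.
  - move=> x; have [r r0 Hr] := H2 x; exists r => //.
    by apply: trivial_onS Hr => u [[? ?] ?].
apply: trivial_onS => x Hx.
by do !split; rewrite /slab /= -ler_norml.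
Qed.

(** * The two sides of a surface *)

Lemma connected_locally_constant (X : topologicalType) (T : set X) (S : Type)
    (g : X -> S) :
  connected T -> (forall x, T x -> \forall x' \near x, T x' -> g x' = g x) ->
  forall x y, T x -> T y -> g x = g y.
Proof.
move=> Tc Hg x y Tx Ty.
pose E := [set z | T z -> g z = g x]; pose E' := [set z | T z -> g z <> g x].
suff BT : T `&` E° = T.
  have : (T `&` E°) y by rewrite BT.
  by move=> [_ /nbhs_singleton] /(_ Ty).
apply: Tc.
- by exists x; split=> //; apply: Hg.
- by exists E° => //; exact: open_interior.
- exists (~` E'°); first exact/open_closedC/open_interior.
  apply/seteqP; split=> z [Tz Hz]; split=> //.
    by move=> /nbhs_singleton /(_ Tz); apply; exact: (nbhs_singleton Hz).
  have gz : g z = g x.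
    apply: contrapT => gz; apply: Hz; apply: filterS (Hg _ Tz) => w H Tw.
    by rewrite H.
  by apply: filterS (Hg _ Tz) => w H Tw; rewrite H.
Qed.

(** * Tangent vectors and local defining functions *)

Lemma diff_estimate (R : realType) (V W : normedModType R) (f : V -> W) x :
  differentiable f x -> forall e : R, 0 < e -> exists2 r : R, 0 < r &
    forall h, `|h| < r -> `|f (x + h) - f x - 'd f x h| <= e * `|h|.
Proof.
move=> df e e0; have := diff_locally df => /eqaddoP /(_ e e0).
move=> /nbhs_ballP[r /= r0 Hr]; exists r => // h hr.
have := Hr h; rewrite -ball_normE /= sub0r normrN => /(_ hr).
by rewrite -[X in `|X|]/(f (h + x) - (f x + 'd f x h)) opprD addrA addrC [h + x]addrC addrC.
Qed.

Lemma ord_max_coord_le (R : realType) (u : E3 R) : `|u 0 ord_max| <= `|u|.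
Proof. exact: coord_le_norm. Qed.

(** Along the curve [u] the last coordinate of [Phi] is identically zero near [0], hence so is its
    derivative. *)
Lemma tangent_differential0 (R : realType) (T : set (E3 R)) (y v : E3 R)
    (U : set (E3 R)) (Phi : E3 R -> E3 R) :
  open U -> U y -> differentiable Phi y -> Phi y 0 ord_max = 0 ->
  (forall x, U x -> T x -> Phi x 0 ord_max = 0) ->
  tangent_vector T y v -> ('d Phi y v) 0 ord_max = 0.
Proof.
move=> oU Uy dPhi Phiy TU [u [u0 uT du]].
have du0 : differentiable u 0 by apply/derivable1_diffP; exact: ex_derive.
have dPu : differentiable Phi (u 0) by rewrite u0.
have dc : differentiable (Phi \o u) 0 by exact: differentiable_comp.
have E : 'd (Phi \o u) 0 1 = 'd Phi y v.
  rewrite diff_comp // u0 /=; congr ('d Phi y _).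
  by rewrite -deriveE // derive_val.
rewrite -E; set w := 'd _ _ _.
apply/eqP; rewrite -normr_eq0; apply/eqP.
apply: (@le_small_eq0 _ _ 1) => // e e0; rewrite mulr1.
have [r r0 Hr] := diff_estimate dc e0.
have uU : \forall t \near (0 : R), U (u t).
  have := differentiable_continuous du0; apply.
  by rewrite u0; apply: open_nbhs_nbhs.
have uTU : \forall t \near (0 : R), T (u t) /\ U (u t).
  by apply: filterS2 uT uU => t.
have /nbhs_ballP[r' /= r'0 Hr'] := uTU.
pose t := Num.min r r' / 2.
have m0 : 0 < Num.min r r' by rewrite lt_min r0.
have t0 : 0 < t by rewrite divr_gt0.
have : t < Num.min r r' by rewrite /t ltr_pdivrMr // ltr_pMr // ltr1n.
rewrite lt_min => /andP[tr tr'].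
have nt : `|t| = t by rewrite gtr0_norm.
have [Tu Uu] : T (u t) /\ U (u t).
  by apply: Hr'; rewrite -ball_normE /= sub0r normrN nt.
have := Hr t; rewrite nt => /(_ tr); rewrite add0r /= => H.
have Ew : 'd (Phi \o u) 0 t = t *: w.
  by rewrite -[X in 'd _ _ X = _](mulr1 t) [t * 1](_ : _ = t *: 1) // linearZ.
rewrite -(ler_pM2l t0) -{1}nt -normrM; apply: le_trans (_ : `|Phi (u t) - Phi (u 0) - 'd (Phi \o u) 0 t| <= _).
  apply: le_trans (ord_max_coord_le _).
  by rewrite Ew !mxE u0 Phiy (TU _ Uu Tu) subrr sub0r normrN.
by rewrite mulrC.
Qed.

(* [phi] is a local defining function of T at y, positive on the side of N *)
Definition defining_at (R : realType) (T : set (E3 R)) (N : E3 R -> E3 R)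
    (y : E3 R) (phi : E3 R -> R) : Prop :=
  [/\ \forall x \near y, {for x, continuous phi},
      \forall x \near y, T x <-> phi x = 0 &
      exists2 r : R, 0 < r & forall t : R, 0 < t < r ->
        0 < phi (y + t *: N y) /\ phi (y - t *: N y) < 0].

(** [unit_normal] only bounds the tangent vectors from above; this provides enough of them to span
    the plane orthogonal to [N y]. A conformal parametrization supplies them. *)
Definition tangent_frame (R : realType) (T : set (E3 R)) (N : E3 R -> E3 R) :
    Prop :=
  forall y, T y -> exists2 a, a != 0 &
    tangent_vector T y a /\ tangent_vector T y (cross3 (N y) a).

(** The last coordinate of the differential of [Phi] kills the tangent frame. If it killed the
    normal too it would be zero, although the differential is invertible. *)
Lemma normal_differential_neq0 (R : realType) (T : set (E3 R))
    (N : E3 R -> E3 R) (y : E3 R) (U : set (E3 R)) (Phi Psi : E3 R -> E3 R) :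
  unit_normal T N -> tangent_frame T N -> T y ->
  open U -> U y -> differentiable Phi y -> differentiable Psi (Phi y) ->
  (forall x, U x -> Psi (Phi x) = x) ->
  (forall x, U x -> T x <-> Phi x 0 ord_max = 0) ->
  ('d Phi y (N y)) 0 ord_max != 0.
Proof.
move=> [_ N1 Ntan] HF Ty oU Uy dPhi dPsi PsiK TU.
have [a a0 [ta tc]] := HF _ Ty.
set L := fun v => ('d Phi y v) 0 ord_max; apply/eqP => LN.
have Phiy : Phi y 0 ord_max = 0 by apply/(TU _ Uy).
have TU' x : U x -> T x -> Phi x 0 ord_max = 0 by move=> /TU[].
have La := tangent_differential0 oU Uy dPhi Phiy TU' ta.
have Lc := tangent_differential0 oU Uy dPhi Phiy TU' tc.
set b := cross3 (N y) a in tc Lc.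
have Na := Ntan _ _ Ty ta.
have aa := dot3_gt0 a0.
have ab : dot3 a b = 0 by rewrite dot3_crossr.
have bb : dot3 b b = dot3 a a by rewrite cross3_norm N1 // Na expr0n subr0 mul1r.
have L0 x : L x = 0.
  pose p := dot3 x a / dot3 a a; pose q := dot3 x b / dot3 a a.
  pose v := x - p *: a - q *: b.
  have va : dot3 v a = 0.
    rewrite /v !(dot3D, dot3N, dot3Z) (dot3C b a) ab mulr0 subr0 /p mulfVK ?gt_eqF //.
    by rewrite subrr.
  have vb : dot3 v b = 0.
    rewrite /v !(dot3D, dot3N, dot3Z) ab mulr0 subr0 bb /q mulfVK ?gt_eqF //.
    by rewrite subrr.
  have Ev := perp_normal (N1 _ Ty) a0 Na va vb.
  have -> : x = dot3 v (N y) *: N y + q *: b + p *: a.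
    by rewrite -Ev /v !subrK.
  by rewrite /L !linearD !linearZ !mxE LN La Lc !mulr0 !addr0.
have Hid h : 'd Psi (Phi y) ('d Phi y h) = h.
  have dc : differentiable (Psi \o Phi) y by exact: differentiable_comp.
  have dE : 'd (Psi \o Phi) y = 'd Psi (Phi y) \o 'd Phi y :> (E3 R -> E3 R).
    exact: diff_comp.
  rewrite -[LHS](congr1 (@^~ h) dE).
  have [->|h0] := eqVneq h 0; first by rewrite linear0.
  apply/eqP; rewrite -subr_eq0 -normr_eq0; apply/eqP.
  apply: (@le_small_eq0 _ _ `|h|) => // e e0.
  have [r r0 Hr] := diff_estimate dc e0.
  have /nbhs_ballP[r' /= r'0 Hr'] := open_nbhs_nbhs (conj oU Uy).
  have nh : 0 < `|h| by rewrite normr_gt0.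
  pose t : R := Num.min r r' / (2 * `|h|).
  have m0 : 0 < Num.min r r' by rewrite lt_min r0.
  have t0 : 0 < t by rewrite divr_gt0 // mulr_gt0.
  have nt : `|t *: h| = t * `|h| by rewrite normrZ gtr0_norm.
  have : `|t *: h| < Num.min r r'.
    by rewrite nt /t invfM mulrA mulfVK ?gt_eqF // ltr_pdivrMr // ltr_pMr // ltr1n.
  rewrite lt_min => /andP[tr tr'].
  have Uh : U (y + t *: h).
    by apply: Hr'; rewrite -ball_normE /= opprD addNKr normrN.
  have := Hr _ tr; rewrite /= !PsiK // [y + _]addrC addrK linearZ /= -scalerBr nt.
  by rewrite normrZ gtr0_norm // mulrCA ler_pM2l // distrC.
(* The chain rule gives only a one-sided inverse; for square matrices it is two-sided. *)
pose A := lin1_mx ('d Phi y); pose B := lin1_mx ('d Psi (Phi y)).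
have AB : A *m B = 1%:M.
  apply/row_matrixP => i; rewrite row_mul !rowE mul_rV_lin1.
  by rewrite mul_rV_lin1 Hid mulmx1.
have BA : B *m A = 1%:M by exact: mulmx1C.
have : ((delta_mx 0 ord_max : E3 R) *m (B *m A)) 0 ord_max = 1.
  by rewrite BA mulmx1 mxE !eqxx.
rewrite mulmxA mul_rV_lin1 -/(L _) L0 => /eqP.
by rewrite eq_sym oner_eq0.
Qed.

Lemma cvg_coord3 (R : realType) (X : Type) (F : set_system X) {FF : Filter F}
    (f : X -> E3 R) (l : E3 R) j :
  f @ F --> l -> (fun x => f x 0 j : R) @ F --> (l 0 j : R).
Proof.
move=> h; exact: (continuous_cvg _ (@coord_continuous R 1 3 0 j l) h).
Qed.

(** The function is the last coordinate of a straightening chart, with the sign [s] that makes its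
    derivative along the normal positive at [y]. By continuity the derivative stays positive at
    nearby points of T, so one function serves them all. *)
Lemma exists_defining (R : realType) (T : set (E3 R)) (N : E3 R -> E3 R) y :
  embedded_surface T -> unit_normal T N -> tangent_frame T N -> T y ->
  exists phi : E3 R -> R, \forall y' \near y, T y' -> defining_at T N y' phi.
Proof.
move=> Hemb HN HF Ty.
have [U [V [Phi [Psi [[oU Uy oV PhiU] [sPhi sPsi PsiK TU]]]]]] := Hemb _ Ty.
have dPhi x : U x -> differentiable Phi x by exact: (sPhi [::]).
have VPhi x : U x -> V (Phi x) by move=> Ux; rewrite -PhiU; exists x.
have dPsi x : U x -> differentiable Psi (Phi x).
  by move=> /VPhi; exact: (sPsi [::]).
pose D x := ('d Phi x (N x)) 0 ord_max.
have Dn x : T x -> U x -> D x != 0.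
  move=> Tx Ux; apply: (normal_differential_neq0 HN HF Tx oU Ux) PsiK TU.
  - exact: dPhi.
  - exact: dPsi.
(* Expansion in the basis reduces the continuity of [D] along T to that of [N] and of the partial
   derivatives of [Phi]. *)
have DE x : U x -> D x = \sum_j N x 0 j * ('D_(delta_mx 0 j) Phi x) 0 ord_max.
  move=> Ux; rewrite /D [in LHS](row_sum_delta (N x)) linear_sum summxE.
  by apply: eq_bigr => j _; rewrite linearZ mxE deriveE //; exact: dPhi.
have [Nc0 _ _] := HN; have Nc := (subspace_continuousP T N).1 Nc0.
have Dc : (fun x => \sum_j N x 0 j * ('D_(delta_mx 0 j) Phi x) 0 ord_max : R)
    @ within T (nbhs y) --> (\sum_j N y 0 j * ('D_(delta_mx 0 j) Phi y) 0 ord_max : R).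
  have c1 j : (fun x => N x 0 j : R) @ within T (nbhs y) --> (N y 0 j : R).
    by apply: cvg_coord3; exact: Nc.
  have c2 j : (fun x => ('D_(delta_mx 0 j) Phi x) 0 ord_max : R)
      @ within T (nbhs y) --> (('D_(delta_mx 0 j) Phi y) 0 ord_max : R).

    have h : 'D_(delta_mx 0 j) Phi x @[x --> y] --> 'D_(delta_mx 0 j) Phi y.
      exact: (differentiable_continuous (sPhi [:: delta_mx 0 j] y Uy)).
    exact: (cvg_within_filter _ (@cvg_coord3 _ _ _ _ _ _ ord_max h)).
  by apply: cvg_big => [|j _]; [exact: add_continuous | apply: cvgM].
pose s : R := if 0 < D y then 1 else -1.
have s0 : s != 0 by rewrite /s; case: ifP => _; rewrite ?oppr_eq0 oner_neq0.
have sDy : 0 < s * D y.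
  rewrite /s; case: (ltP 0 (D y)) => h; first by rewrite mul1r.
  by rewrite mulN1r oppr_gt0 lt_neqAle h andbT; apply: Dn.
have near_pos : \forall x \near y, T x -> 0 < s *
    \sum_j N x 0 j * ('D_(delta_mx 0 j) Phi x) 0 ord_max.
  rewrite DE // in sDy.
  have c : (fun x => s * \sum_j N x 0 j * ('D_(delta_mx 0 j) Phi x) 0 ord_max : R)
    @ within T (nbhs y) -->
    (s * \sum_j N y 0 j * ('D_(delta_mx 0 j) Phi y) 0 ord_max : R).
    by apply: cvgM; [exact: cvg_cst | exact: Dc].
  exact: (cvgr_gt _ c _ sDy).
exists (fun x => s * Phi x 0 ord_max : R).
have Unear := open_nbhs_nbhs (conj oU Uy).
near=> y' => Ty'.
have Uy' : U y' by near: y'.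
have sD : 0 < s * D y' by rewrite DE //; apply: (near near_pos y').
have Unear' := open_nbhs_nbhs (conj oU Uy').
split.
- apply: filterS Unear' => x Ux.
  have h : (fun x => Phi x 0 ord_max : R) @ nbhs x --> (Phi x 0 ord_max : R).
    exact: (cvg_coord3 (differentiable_continuous (dPhi _ Ux))).
  exact: (cvgM (cvg_cst s) h).
- apply: filterS Unear' => x Ux; rewrite TU //; split=> [->|/eqP].
    by rewrite mulr0.
  by rewrite mulf_eq0 (negPf s0) => /eqP.
- have K0 : 0 < 1 + `|N y'| by rewrite ltr_pwDl.
  (* With this tolerance the error along [t *: N y'] is at most half of the main term
     [t * (s * D y')]. *)
  have e0 : 0 < s * D y' / (2 * (1 + `|N y'|)) by rewrite divr_gt0 // mulr_gt0.
  have [r r0 Hr] := diff_estimate (dPhi _ Uy') e0.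
  exists (r / (1 + `|N y'|)); first by rewrite divr_gt0.
  move=> t /andP[t0]; rewrite ltr_pdivlMr // => tr.
  have Phiy' : Phi y' 0 ord_max = 0 by apply/TU.
  have ns : `|s| = 1 by rewrite /s; case: ifP => _; rewrite ?normrN normr1.
  suff E (u : R) : `|u| = t ->
      `|s * Phi (y' + u *: N y') 0 ord_max - u * (s * D y')| <= t * (s * D y') / 2.
    have := E t (gtr0_norm t0); have := E (- t); rewrite normrN => /(_ (gtr0_norm t0)).
    have p0 : 0 < t * (s * D y') by rewrite mulr_gt0.
    rewrite scaleNr !ler_distl => /andP[_ h1] /andP[h2 _].
    move: p0 h1 h2; rewrite mulNr; move: (t * (s * D y')) => q.
    by move=> *; split; lra.
  move=> nu; have nuN : `|u *: N y'| = t * `|N y'| by rewrite normrZ nu.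
  have ur : `|u *: N y'| < r.
    by rewrite nuN; apply: le_lt_trans tr; rewrite ler_wpM2l ?(ltW t0) // lerDr.
  have := Hr _ ur; rewrite nuN => H.
  have -> : s * Phi (y' + u *: N y') 0 ord_max - u * (s * D y') =
      s * (Phi (y' + u *: N y') - Phi y' - 'd Phi y' (u *: N y')) 0 ord_max.
    have -> : 'd Phi y' (u *: N y') = u *: 'd Phi y' (N y') by rewrite linearZ.
    by rewrite !(add3E, opp3E, scale3E) Phiy' /D; ring.
  rewrite normrM ns mul1r; apply: le_trans (ord_max_coord_le _) _.
  apply: le_trans H _.
  have -> : s * D y' / (2 * (1 + `|N y'|)) * (t * `|N y'|) =
      (t * (s * D y') / 2) * (`|N y'| / (1 + `|N y'|)).
    by field; rewrite gt_eqF.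
  apply: ler_piMr; first by rewrite divr_ge0 // mulr_ge0 ?ltW.
  by rewrite ler_pdivrMr // mul1r lerDr.
Unshelve. all: by end_near.
Qed.

Lemma ball_convex (R : realType) (p : E3 R) (r : R) : convex3 (ball p r).
Proof.
move=> x y t; rewrite -!ball_normE /= => x1 y1 /andP[t0 t1].
have -> : p - (x + t *: (y - x)) = (1 - t) *: (p - x) + t *: (p - y).
  by rewrite !scalerBr !scalerBl !scale1r; apply/rowP => i; rewrite !mxE; ring.
apply: le_lt_trans (ler_normD _ _) _; rewrite !normrZ.
have t1' : 0 <= 1 - t by rewrite subr_ge0.
rewrite !ger0_norm //; have [t00|t00] := eqVneq t 0.
  by rewrite t00 mul0r addr0 subr0 mul1r.
have -> : r = (1 - t) * r + t * r by ring.
apply: ler_ltD; first by rewrite ler_wpM2l // ltW.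
by rewrite ltr_pM2l // lt_neqAle eq_sym t00.
Qed.

Lemma half_space_convex (R : realType) (i : 'I_3) (s : R) :
  convex3 [set q : E3 R | 0 < s * q 0 i].
Proof.
move=> x y t /= x1 y1 /andP[t0 t1]; rewrite !mxE.
have -> : s * (x 0 i + t * (y 0 i - x 0 i)) =
   (1 - t) * (s * x 0 i) + t * (s * y 0 i) by ring.
have [t00|t00] := eqVneq t 0.
  by rewrite t00 mul0r addr0 subr0 mul1r.
apply: ltr_wpDl; first by rewrite mulr_ge0 ?subr_ge0 // ltW.
by rewrite mulr_gt0 // lt_neqAle eq_sym t00.
Qed.

Lemma convex3_nonvanishing (R : realType) (Q : set (E3 R)) (h : E3 R -> R) :
  convex3 Q -> (forall q, Q q -> {for q, continuous h}) ->
  (forall q, Q q -> h q != 0) -> forall a b, Q a -> Q b -> 0 < h a -> 0 < h b.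
Proof.
move=> Qc hc hn a b Qa Qb ha.
pose u (t : R) := a + t *: (b - a).
have u0 : u 0 = a by rewrite /u scale0r addr0.
have u1 : u 1 = b by rewrite /u scale1r addrC subrK.
have := @path_nonvanishing _ (h \o u); rewrite /= u0 u1; apply => // t t01.
- apply: continuous_comp; first exact: segment_continuous.
  by apply: hc; exact: Qc.
- by apply: hn; exact: Qc.
Qed.

(* The two sides of T near y are the images of half-balls under a
   straightening chart, hence connected. *)
Lemma defining_at_uniq (R : realType) (T : set (E3 R)) (N : E3 R -> E3 R) y
    (f g : E3 R -> R) :
  embedded_surface T -> T y -> defining_at T N y f -> defining_at T N y g ->
  \forall x \near y, ~ T x -> (0 < f x) = (0 < g x).
Proof.
move=> Hemb Ty [fc fT [rf rf0 Hf]] [gc gT [rg rg0 Hg]].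
have [U [V [Phi [Psi [[oU Uy oV PhiU] [sPhi sPsi PsiK TU]]]]]] := Hemb _ Ty.
have dPhi x : U x -> differentiable Phi x by exact: (sPhi [::]).
have VPhi x : U x -> V (Phi x) by move=> Ux; rewrite -PhiU; exists x.
have PhiK v : V v -> U (Psi v) /\ Phi (Psi v) = v.
  by rewrite -PhiU => -[x Ux <-]; rewrite PsiK.
have cPsi v : V v -> {for v, continuous Psi}.
  by move=> Vv; exact: (differentiable_continuous (sPsi [::] v Vv)).
pose p := Phi y; have Vp : V p by exact: VPhi.
have Psip : Psi p = y by exact: PsiK.
pose Good x := [/\ U x, {for x, continuous f}, {for x, continuous g},
  T x <-> f x = 0 & T x <-> g x = 0].
have Goodn : \forall x \near y, Good x.
  have Un := open_nbhs_nbhs (conj oU Uy).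
  near=> x; split; [near: x | near: x | near: x | near: x | near: x] => //.
have : \forall v \near p, V v /\ Good (Psi v).
  have Vn := open_nbhs_nbhs (conj oV Vp).
  have Gn : \forall v \near p, Good (Psi v).
    by apply: (cPsi _ Vp); rewrite Psip.
  by apply: filterS2 Vn Gn => v.
move=> /nbhs_ballP[r /= r0 Hr].
pose H (s : R) := ball p r `&` [set q | 0 < s * q 0 ord_max].
have Hcv s : convex3 (H s).
  by apply: convex3I; [exact: ball_convex | exact: half_space_convex].
have HT s v : H s v -> [/\ V v, Good (Psi v) & ~ T (Psi v)].
  move=> [/Hr[Vv Gv] sv]; split=> // Tv; have [Uv PK] := PhiK _ Vv.
  move: Tv => /(TU _ Uv); rewrite PK => v0.
  by move: sv; rewrite /= v0 mulr0 ltxx.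
have signc (h : E3 R -> R) : (forall x, Good x -> {for x, continuous h}) ->
    (forall x, Good x -> ~ T x -> h x != 0) ->
    forall s a b, H s (Phi a) -> H s (Phi b) -> U a -> U b -> 0 < h a -> 0 < h b.
  move=> hc hn s a b Ha Hb Ua Ub.
  have := @convex3_nonvanishing _ (H s) (h \o Psi) (Hcv s).
  move=> /(_ _ _ (Phi a) (Phi b) Ha Hb); rewrite /= !PsiK //; apply.
    move=> q /HT[Vq Gq _]; apply: continuous_comp; first exact: cPsi.
    exact: hc.
  by move=> q /HT[Vq Gq Tq]; exact: hn.
have fs := signc f _ _; have gs := signc g _ _.
have {}fs : forall s a b, H s (Phi a) -> H s (Phi b) -> U a -> U b -> 0 < f a -> 0 < f b.
  by apply: fs => x [_ ? _ e _] // nT; apply/eqP => /e.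
have {}gs : forall s a b, H s (Phi a) -> H s (Phi b) -> U a -> U b -> 0 < g a -> 0 < g b.
  by apply: gs => x [_ _ ? _ e] // nT; apply/eqP => /e.
pose B x := U x /\ ball p r (Phi x).
have Bn : \forall x \near y, B x.
  have Un := open_nbhs_nbhs (conj oU Uy).
  have bn : \forall x \near y, ball p r (Phi x).
    by apply: (differentiable_continuous (dPhi _ Uy)); exact: nbhsx_ballx.
  by apply: filterS2 Un bn.
have side x : B x -> ~ T x -> exists s, H s (Phi x) /\ (s = 1 \/ s = -1).
  move=> [Ux bx] nT; have q0 : Phi x 0 ord_max != 0.
    by apply/eqP => q0; apply: nT; apply/TU.
  case: (ltgtP (Phi x 0 ord_max) 0) q0 => // q0 _.
    by exists (-1); split; [split=> //=; rewrite mulN1r oppr_gt0 | right].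
  by exists 1; split; [split=> //=; rewrite mul1r | left].
have [t [t0 [[Bp Gp] [Bm Gm]] [tf tg]]] : exists t : R, [/\ 0 < t,
    (B (y + t *: N y) /\ Good (y + t *: N y)) /\
    (B (y - t *: N y) /\ Good (y - t *: N y)) & t < rf /\ t < rg].
  have /nbhs_ballP[q /= q0 Hq] : \forall x \near y, B x /\ Good x.
    by apply: filterS2 Bn Goodn.
  have K0 : 0 < 1 + `|N y| by rewrite ltr_pwDl.
  pose t := Num.min (Num.min rf rg) (q / (1 + `|N y|)) / 2.
  have m0 : 0 < Num.min (Num.min rf rg) (q / (1 + `|N y|)).
    by rewrite !lt_min rf0 rg0 divr_gt0.
  have t0 : 0 < t by rewrite divr_gt0.
  have : t < Num.min (Num.min rf rg) (q / (1 + `|N y|)).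
    by rewrite /t ltr_pdivrMr // ltr_pMr // ltr1n.
  rewrite !lt_min -andbA ltr_pdivlMr // => /and3P[tf tg tq].
  have tN : `|t *: N y| < q.
    rewrite normrZ gtr0_norm //; apply: le_lt_trans tq.
    by rewrite ler_wpM2l ?(ltW t0) // lerDr.
  exists t; split=> //; split; apply: Hq; rewrite -ball_normE /= opprD ?opprK.
    by rewrite addNKr normrN.
  by rewrite addrA subrr add0r.
have [fp fm] := Hf t (introT andP (conj t0 tf)).
have [gp gm] := Hg t (introT andP (conj t0 tg)).
have nTp : ~ T (y + t *: N y).
  by have [_ _ _ e _] := Gp; move=> /e h; rewrite h ltxx in fp.
have nTm : ~ T (y - t *: N y).
  by have [_ _ _ e _] := Gm; move=> /e h; rewrite h ltxx in fm.
have [sp [Hp sp1]] := side _ Bp nTp; have [sm [Hm sm1]] := side _ Bm nTm.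
have [Up _] := Bp; have [Um _] := Bm.
(* The points [y + t *: N y] and [y - t *: N y] lie in opposite half-balls, since [f] changes sign
   between them. They give the reference signs of [f] and [g] on both sides. *)
have spm : sp <> sm.
  move=> E; rewrite -E in Hm; have := fs _ _ _ Hp Hm Up Um fp.
  by rewrite ltNge (ltW fm).
apply: filterS Bn => x Bx nTx; have [s [Hs s1]] := side _ Bx nTx; have [Ux _] := Bx.
have [E|E] : s = sp \/ s = sm.
  by case: s1 => ->; case: sp1 spm => ->; case: sm1 => ->; tauto.
- rewrite E in Hs.
  by rewrite (fs _ _ _ Hp Hs Up Ux fp) (gs _ _ _ Hp Hs Up Ux gp).
- rewrite E in Hs.
  have -> : (0 < f x) = false.
    by apply/negP => h; have := fs _ _ _ Hs Hm Ux Um h; rewrite ltNge (ltW fm).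
  apply/esym/negP => h; have := gs _ _ _ Hs Hm Ux Um h.
  by rewrite ltNge (ltW gm).
Unshelve. all: by end_near.
Qed.

Lemma affine_continuous (R : realType) (m : E3 R -> E3 R) (M : 'M[R]_3) :
  (forall x y, m x = m y + (x - y) *m M) -> continuous m.
Proof.
move=> Hm x A /nbhs_ballP[e /= e0 He]; have [K K0 HK] := mulmx_bound M.
apply/nbhs_ballP; exists (K^-1 * e); first by rewrite /= mulr_gt0 ?invr_gt0.
move=> y; rewrite -ball_normE /= => h; apply: He.
rewrite -ball_normE /= (Hm x y) [m y + _]addrC addrK.
by apply: le_lt_trans (HK _) _; rewrite -ltr_pdivlMl.
Qed.

(* Mod 2 separation: gluing the local sides of T gives [s : R^3 -> bool],
   locally constant off T and jumping across T; as [m] exchanges the sides,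
   [s (m x)] and [s x] differ near T, hence everywhere, even at O. *)
Lemma side_reversing_isometry (R : realType) (T : set (E3 R))
    (N : E3 R -> E3 R) (m : E3 R -> E3 R) (M : 'M[R]_3) (O : E3 R) :
  classical_riemann_surface T N -> tangent_frame T N ->
  (forall x y, m x = m y + (x - y) *m M) ->
  (forall x, T x <-> T (m x)) ->
  (forall y, T y -> N (m y) = - (N y *m M)) ->
  m O = O -> T O.
Proof.
move=> [[y0 Ty0] Tcpt Tconn Hemb HN] HF Hm mT mN mO; apply: contrapT => nTO.
have Tclosed : closed T by apply: compact_closed => //; exact: norm_hausdorff.
have offT x : ~ T x -> \forall x' \near x, ~ T x'.
  by move=> nT; exact: (open_nbhs_nbhs (conj (closed_openC Tclosed) nT)).
have [phi Hphi] : exists phi : E3 R -> E3 R -> R, forall y, T y ->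
    \forall y' \near y, T y' -> defining_at T N y' (phi y).
  have H y : exists f : E3 R -> R, T y ->
      \forall y' \near y, T y' -> defining_at T N y' f.
    have [Ty|nT] := pselect (T y); last by exists (fun=> 0).
    by have [f Hf] := exists_defining Hemb HN HF Ty; exists f.
  by have [phi Hphi] := choice H; exists phi.
have phi_at y : T y -> defining_at T N y (phi y).
  by move=> Ty; have := nbhs_singleton (Hphi _ Ty); apply.
(* A section of this cocycle keeps on the negative side the value it has on T and changes it on the
   positive side. *)
pose c x x' := asbool (T x /\ ~ T x' /\ 0 < phi x x').
have c_off x x' : ~ T x -> c x x' = false.
  by move=> nT; apply: asboolF => -[].
have c_on x x' : T x' -> c x x' = false.
  by move=> Tx'; apply: asboolF => -[_ [nT _]].
have c_val x x' : T x -> ~ T x' -> c x x' = (0 < phi x x').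
  move=> Tx nT; apply/idP/idP => [/asboolP[_ [_ //]]|h].
  by apply/asboolP; split.
have Hc : local_cocycle c.
  move=> x; have [Tx|nTx] := pselect (T x); last first.
    apply: filterS (offT _ nTx) => x' nTx'; apply: filterS (offT _ nTx') => x'' _.
    by rewrite !c_off.
  have [fc fT _] := phi_at _ Tx; have h := Hphi _ Tx.
  near=> x'.
  have [Tx'|nTx'] := pselect (T x').
    have d1 : defining_at T N x' (phi x) by apply: (near h x').
    have := defining_at_uniq Hemb Tx' d1 (phi_at _ Tx').
    apply: filterS => x'' E; rewrite (c_on _ _ Tx') /=.
    have [Tx''|nTx''] := pselect (T x''); first by rewrite !c_on.
    by rewrite !c_val // E.
  have fc' : {for x', continuous (phi x)} by near: x'.
  have fT' : T x' <-> phi x x' = 0 by near: x'.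
  have n0 : phi x x' != 0 by apply/eqP => /fT'.
  have E : \forall x'' \near x', (0 < phi x x'') = (0 < phi x x').
    case: (ltgtP (phi x x') 0) n0 => // h0 _.
      have hn : \forall x'' \near x', phi x x'' < 0 by exact: (cvgr_lt _ fc' _ h0).
      by apply: filterS hn => x'' h1; apply/negbTE; rewrite -leNgt ltW.
    have hp : \forall x'' \near x', 0 < phi x x'' by exact: (cvgr_gt _ fc' _ h0).
    by apply: filterS hp => x'' ->.
  apply: filterS2 E (offT _ nTx') => x'' E nTx''.
  by rewrite (c_val x x'') // (c_val x x') // (c_off x') // addbF E.
have [L [L0 TL OL]] : exists L : R, [/\ 0 <= L,
    forall y, T y -> forall i, `|y 0 i| <= L & forall i, `|O 0 i| <= L].
  have [B [Breal HB]] := compact_bounded Tcpt.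
  pose L := Num.max (B + 1) `|O|.
  exists L; split; first by rewrite le_max normr_ge0 orbT.
    move=> y Ty i; apply: le_trans (coord_le_norm _ _) _.
    by rewrite le_max (HB (B + 1)) ?ltrDl.
  by move=> i; rewrite le_max (coord_le_norm O i) orbT.
pose Q := [set x : E3 R | forall i, `|x 0 i| <= L].
have [s Hs] : trivial_on c Q by exact: trivial_on_cube.
have TQ y : T y -> Q y by move=> Ty i; exact: TL.
(* The points [x] and [m x] of T may be far apart; connectedness of T makes [s] agree at them. *)
have sT y z : T y -> T z -> s y = s z.
  apply: connected_locally_constant => // x Tx.
  apply: filterS (Hs _ (TQ _ Tx)) => x' h Tx'.
  by rewrite h ?c_on ?addbF //; exact: TQ.
have Tm x : T x -> T (m x) by move=> /mT.
(* Off T this says that [s] differs at [x] and [m x]; the value [true] on T makes it locally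
   constant across T as well. *)
pose psi x := asbool (T x) || (s x (+) s (m x)).
(* Both [x] and [m x] must lie in the cube where [s] is a section; this set is convex because [m] is
   affine. *)
pose D := [set x | Q x /\ Q (m x)].
have Qconv : convex3 Q.
  move=> x y t Qx Qy t01 i; have := @slab_convex R i (- L) L x y t.
  by rewrite /slab /= -!ler_norml; apply.
have Dconv : convex3 D.
  move=> x y t [Qx Qmx] [Qy Qmy] t01; split; first exact: Qconv.
  have -> : m (x + t *: (y - x)) = m x + t *: (m y - m x).
    have e1 : x + t *: (y - x) - x = t *: (y - x) by rewrite addrC addKr.
    by rewrite (Hm (x + _) x) e1 (Hm y x) -scalemxAl [m x + _ - _]addrC addKr.
  exact: Qconv.
have mcts := affine_continuous Hm.
have psic x : D x -> \forall x' \near x, D x' -> psi x' = psi x.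
  move=> [Qx Qmx]; have [Tx|nTx] := pselect (T x); last first.
    have nTmx : ~ T (m x) by move=> h; apply: nTx; apply/mT.
    have h1 := Hs _ Qx.
  have h2 : \forall x' \near x, Q (m x') ->
    s (m x') = s (m x) (+) c (m x) (m x') by exact: (mcts x _ (Hs _ Qmx)).
    have h3 := offT _ nTx.
    near=> x' => -[Qx' Qmx'].
    have nTx' : ~ T x' by near: x'.
    rewrite /psi (asboolF nTx) (asboolF nTx') /=.
    rewrite (near h1 x') // (c_off x) // addbF.
    have e2 : s (m x') = s (m x) (+) c (m x) (m x') by apply: (near h2 x').
    by rewrite e2 (c_off (m x)) // addbF.
  have h1 := Hs _ Qx.
  have h2 : \forall x' \near x, Q (m x') ->
    s (m x') = s (m x) (+) c (m x) (m x') by exact: (mcts x _ (Hs _ Qmx)).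
  have Tmx := Tm _ Tx.
  have dx := phi_at _ Tx; have [gc gT [r r0 Hr]] := phi_at _ Tmx.
  have h4 : \forall z \near x, T (m z) <-> phi (m x) (m z) = 0.
    exact: (mcts x _ gT).
  (* As [m] reverses the normal, pulling back the defining function at [m x] and changing its sign
     gives one at [x]. It has the same positive side as [phi x], by uniqueness of the sides. *)
  have dm : defining_at T N x (fun z => - phi (m x) (m z)).
    split.
    - have hc : \forall z \near x, {for m z, continuous (phi (m x))}.
        exact: (mcts x _ gc).
      apply: filterS hc => z hz.
      exact: (cvgN (continuous_comp (mcts z) hz)).
    - apply: filterS h4 => z hz.
      rewrite mT; split=> [/hz ->|/eqP]; first by rewrite oppr0.
      by rewrite oppr_eq0 => /eqP /hz.
    - exists r => // t /Hr; rewrite mN // !scalerN opprK.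
      rewrite (Hm (x + t *: N x) x) (Hm (x - t *: N x) x).
      rewrite ![x + _]addrC !addrK mulNmx -scalemxAl.
      by move=> [h5 h6]; rewrite oppr_gt0 oppr_lt0.
  have h3 := defining_at_uniq Hemb Tx dx dm.
  near=> x' => -[Qx' Qmx']; rewrite /psi (asboolT Tx) /=.
  have [Tx'|nTx'] := pselect (T x'); first by rewrite asboolT.
  have nTmx' : ~ T (m x') by move=> h; apply: nTx'; apply/mT.
  rewrite (asboolF nTx') /=.
  have e1 : s x' = s x (+) c x x' by apply: (near h1 x').
  have e2 : s (m x') = s (m x) (+) c (m x) (m x') by apply: (near h2 x').
  rewrite e1 e2 !c_val // (sT (m x) x) //.
  have e3 : (0 < phi x x') = (0 < - phi (m x) (m x')) by apply: (near h3 x').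
  have e4 : T (m x') <-> phi (m x) (m x') = 0 by apply: (near h4 x').
  rewrite e3 oppr_gt0; case: (ltgtP (phi (m x) (m x')) 0) => [_|_|/e4 //].
    by case: (s x).
  by case: (s x).
have Dy0 : D y0 by split; apply: TQ => //; exact: Tm.
have DO : D O by split; rewrite ?mO.
have := convex3_locally_constant Dconv psic Dy0 DO.
by rewrite /psi asboolT // asboolF //= mO addbb.
Unshelve. all: by end_near.
Qed.

(** * Conformally parametrized surfaces *)

Lemma param_tangent (R : realType) hyp (T : set (E3 R)) (N : E3 R -> E3 R)
    (F : CC R -> E3 R) z :
  unit_normal T N -> (forall w, plane R hyp w -> T (F w)) ->
  plane R hyp z -> conformal_at N F z ->
  exists a, [/\ a != 0, rdiff F z a (cross3 (N (F z)) a),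
    tangent_vector T (F z) a, tangent_vector T (F z) (cross3 (N (F z)) a) &
    dot3 (N (F z)) a = 0].
Proof.
move=> [_ _ Ntan] FT zP /conformal_at_rdiff[a a0 Ha]; exists a.
have curve v : tangent_vector T (F z) (rlin a (cross3 (N (F z)) a) v).
  exists (fun t : R => F (z + t%:C * v)); split.
  - by rewrite rmorph0 mul0r addr0.
  - have [r r0 Hr] := plane_open zP.
    have K0 : 0 < 1 + cmod v by rewrite ltr_pwDl // cmod_ge0.
    apply/nbhs_ballP; exists (r / (1 + cmod v)); first exact: divr_gt0.
    move=> t; rewrite -ball_normE /= sub0r normrN ltr_pdivlMr // => h.
    apply: FT; apply: Hr; rewrite addrC addKr cmodM cmod_real.
    by apply: le_lt_trans h; rewrite ler_wpM2l // lerDr.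
  - exact: rdiff_curve.
have t1 := curve 1; rewrite rlin1 in t1; have ti := curve 'i; rewrite rlini in ti.
by split=> //; apply: Ntan t1; exact: FT.
Qed.

Lemma dot3_continuous (R : realType) (v : E3 R) : continuous (fun x => dot3 v x).
Proof.
move=> x A /nbhs_ballP[e /= e0 He].
have K0 : 0 < 1 + 3 * `|v| by rewrite ltr_pwDl // mulr_ge0.
apply/nbhs_ballP; exists (e / (1 + 3 * `|v|)); first exact: divr_gt0.
move=> y; rewrite -ball_normE /= => h; apply: He.
rewrite -ball_normE /= -dot3Br; apply: le_lt_trans (dot3_bound _ _) _.
move: h; rewrite ltr_pdivlMr // mulrC; apply: le_lt_trans.
by rewrite ler_wpM2r // lerDr.
Qed.

(** If the form of [w] is constant on T, then [w] is normal to T everywhere. For a nonzero tangent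
    vector [v] at one point, [v] is orthogonal to [w]; but where the form of [v] is maximal on T,
    [v] is normal too, hence parallel to [w]. *)
Lemma surface_spans (R : realType) hyp (T : set (E3 R)) (N : E3 R -> E3 R)
    (F : CC R -> E3 R) (w : E3 R) (k : R) :
  classical_riemann_surface T N -> (forall z, plane R hyp z -> T (F z)) ->
  (forall y, T y -> exists2 z, plane R hyp z & F z = y) ->
  (forall z, plane R hyp z -> conformal_at N F z) ->
  (forall y, T y -> dot3 w y = k) -> w = 0.
Proof.
move=> [[y0 Ty0] Tcpt _ _ HN] FT TF HC Hw.
have [_ N1 _] := HN.
have perp z : plane R hyp z -> exists a, [/\ a != 0, dot3 (N (F z)) a = 0,
    rdiff F z a (cross3 (N (F z)) a), dot3 w a = 0 & dot3 w (cross3 (N (F z)) a) = 0].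
  move=> zP; have [a [a0 Ha _ _ Na]] := param_tangent HN FT zP (HC _ zP).
  have [r r0 Hr] := plane_open zP.
  have [|h1 h2] := @rdiff_max _ _ _ _ _ w _ Ha r0; last by exists a.
  by move=> u /Hr uP; rewrite !Hw //; exact: FT.
apply/eqP; apply: contrapT => /negP w0.
have [v v0 vw] : exists2 v : E3 R, v != 0 & dot3 v w = 0.
  have [z zP Ez] := TF _ Ty0; have [a [a0 _ _ wa _]] := perp _ zP.
  by exists a => //; rewrite dot3C.
have cv : {within T, continuous (fun x => dot3 v x)}.
  by apply: continuous_subspaceT; exact: dot3_continuous.
have T0 : T !=set0 by exists y0.
have [y /set_mem Ty Hmax] := compact_EVT_max T0 Tcpt cv.
have [z zP Ez] := TF _ Ty; have [a [a0 Na Ha wa wc]] := perp _ zP.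
have [r r0 Hr] := plane_open zP.
have [|va vc] := @rdiff_max _ _ _ _ _ v _ Ha r0.
  by move=> u /Hr uP; rewrite Ez; apply: Hmax; apply/mem_set; exact: FT.
have N1z := N1 _ (FT _ zP).
have Ev := perp_normal N1z a0 Na va vc; have Ew := perp_normal N1z a0 Na wa wc.
move: vw; rewrite Ev Ew !dot3_lin N1z mulr1 => /eqP; rewrite mulf_eq0 => /orP[] /eqP E.
  by move: v0; rewrite Ev E scale0r eqxx.
by move: w0; rewrite Ew E scale0r eqxx.
Qed.

(** Applied to each column, [surface_spans] turns relations between isometries that hold on T into
    relations between their linear parts. *)
Lemma surface_mulmx_eq0 (R : realType) hyp (T : set (E3 R)) (N : E3 R -> E3 R)
    (F : CC R -> E3 R) (O : E3 R) (M : 'M[R]_3) :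
  classical_riemann_surface T N -> (forall z, plane R hyp z -> T (F z)) ->
  (forall y, T y -> exists2 z, plane R hyp z & F z = y) ->
  (forall z, plane R hyp z -> conformal_at N F z) ->
  (forall y, T y -> (y - O) *m M = 0) -> M = 0.
Proof.
move=> crs FT TF HC HM; apply/matrixP => i j; rewrite [RHS]mxE.
pose w : E3 R := (col j M)^T.
have Ew x : (x *m M) 0 j = dot3 w x.
  by rewrite dot3C /dot3 /w trmxK !mxE; apply: eq_bigr => k _; rewrite !mxE.
suff : w = 0 by move/(congr1 (fun v : E3 R => v 0 i)); rewrite !mxE.
apply: (surface_spans (k := dot3 w O) crs FT TF HC) => y Ty.
apply/eqP; rewrite -subr_eq0 -dot3Br -Ew HM //.
by rewrite mxE.
Qed.

(** Differentiating [m (F w) = F (h w)] in two ways compares the image under [M] of the quarter turn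
    about [N (F z)] with the opposite quarter turn about the normal at the image point, [h] being
    anticonformal. The factor [k] appears when [M] is moved through the cross product. *)
Lemma reversing_normal (R : realType) hyp (T : set (E3 R)) (N : E3 R -> E3 R)
    (F : CC R -> E3 R) (h : CC R -> CC R) (m : E3 R -> E3 R) (M : 'M[R]_3) (k : R) z :
  unit_normal T N -> (forall w, plane R hyp w -> T (F w)) ->
  (forall w, plane R hyp w -> conformal_at N F w) ->
  conformal_plane_map hyp true h ->
  (forall w, plane R hyp w -> m (F w) = F (h w)) ->
  (forall x y, m x = m y + (x - y) *m M) ->
  M *m M^T = 1%:M -> cross_sign M k -> k * k = 1 -> plane R hyp z ->
  N (m (F z)) = - (k *: (N (F z) *m M)).
Proof.
move=> HN FT HC Hh mF Hm MMT Mk kk zP.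
have [_ N1 _] := HN.
have [hzP [d d0 Hd]] := Hh _ zP.
have [a [a0 Ha _ _ Na]] := param_tangent HN FT zP (HC _ zP).
have [a' [a'0 Ha' _ _ Na']] := param_tangent HN FT hzP (HC _ hzP).
have H1 := rdiff_affine Hm Ha.
have H2 := rdiff_comp Hd Ha'.
have [r r0 Hr] := plane_open zP.
have H3 : rdiff (m \o F) z (rlin a' (cross3 (N (F (h z))) a') d)
    (rlin a' (cross3 (N (F (h z))) a') (d * bconj true 'i)).
  by apply: (rdiff_near r0 _ H2) => w /Hr wP /=; rewrite mF.
have [E1 E2] := rdiff_uniq H1 H3.
rewrite mF //; move: E1 E2 Na' (N1 _ (FT _ hzP)) (N1 _ (FT _ zP)) Na.
set n := N (F z); set n' := N (F (h z)); set c' := cross3 n' a' => E1 E2 Na' n'1 n1 Na.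
(* Multiplication by ['i] in the plane corresponds to the quarter turn [cross3 n']; conjugation
   replaces ['i] by its opposite. *)
have Li v : rlin a' c' (v * bconj true 'i) = - cross3 n' (rlin a' c' v).
  rewrite /rlin cross3Dr !cross3Zr /c' cross3_cross Na' n'1 scale0r sub0r scale1r.
  case: v => x y /=; rewrite scalerN.
  rewrite !(mulr0, mul0r, add0r, addr0, sub0r, oppr0, mulrN, mulr1, opprK).
  by rewrite opprD opprK addrC scaleNr.
have n'L v : dot3 n' (rlin a' c' v) = 0.
  by rewrite /rlin !dot3_lin Na' /c' dot3_cross !mulr0 addr0.
rewrite Li -E1 in E2.
have aM0 : a *m M != 0.
  apply: contraNneq a0 => E; apply/eqP; apply: dot3_eq0.
  by rewrite -(dot3_mulmx a a MMT) E dot30.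
have H : cross3 (n *m M + k *: n') (a *m M) = 0.
  rewrite cross3Dl cross3Zl Mk E2 scalerN addNr //.
have H' : dot3 (n *m M + k *: n') (a *m M) = 0.
  by rewrite dot3D dot3Z dot3_mulmx // Na E1 n'L mulr0 addr0.
have : n *m M + k *: n' = 0.
  apply: dot3_eq0; have := cross3_norm (n *m M + k *: n') (a *m M).
  rewrite H H' dot30 expr0n subr0 => /esym/eqP; rewrite mulf_eq0.
  by rewrite (gt_eqF (dot3_gt0 aM0)) orbF => /eqP.
move/(congr1 (fun x => k *: x)); rewrite scalerDr scalerA kk scale1r scaler0.
by move/eqP; rewrite addrC addr_eq0 => /eqP.
Qed.

(** * Symmetries of the surface that reverse its orientation *)

Lemma isometry3_inj (R : realType) (m : E3 R -> E3 R) :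
  isometry3 m -> injective m.
Proof.
move=> Hm x y E; apply/eqP; rewrite -subr_eq0; apply/eqP/dot3_eq0.
by rewrite -Hm E subrr dot30.
Qed.

Lemma affine_centroid (R : realType) (m : E3 R -> E3 R) (M : 'M[R]_3)
    (a b c d : E3 R) :
  (forall x y, m x = m y + (x - y) *m M) ->
  m ((4 : R)^-1 *: (a + b + c + d)) = (4 : R)^-1 *: (m a + m b + m c + m d).
Proof.
move=> Hm; rewrite (Hm _ a) (Hm b a) (Hm c a) (Hm d a).
have -> : (4 : R)^-1 *: (a + b + c + d) - a =
    (4 : R)^-1 *: ((b - a) + (c - a) + (d - a)).
  by apply/rowP => i; rewrite !mxE; field.
rewrite -scalemxAl !mulmxDl.
by apply/rowP => i; rewrite !mxE; field.
Qed.

Lemma cross_sign1 (R : realType) (M : 'M[R]_3) :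
  (forall x : E3 R, x *m M = x) -> cross_sign M 1.
Proof. by move=> HM u v; rewrite !HM scale1r. Qed.

Lemma cross_signN1 (R : realType) (M : 'M[R]_3) :
  (forall x : E3 R, x *m M = - x) -> cross_sign M (-1).
Proof. by move=> HM u v; rewrite !HM; coord3; ring. Qed.

Lemma fixpoint_off_compact (R : realType) (T : set (E3 R)) (O n : E3 R) :
  compact T -> n != 0 -> exists t : R, ~ T (O + t *: n).
Proof.
move=> Tcpt n0; have [B [Breal HB]] := compact_bounded Tcpt.
have nn : 0 < `|n| by rewrite normr_gt0.
(* The term [O] is compensated by its own norm, so the point has norm at least [|B + 1| + 1], beyond
   the bound on T. *)
pose L := `|B + 1| + `|O| + 1; exists (L / `|n|) => TO.
have B1 : B < B + 1 by rewrite ltrDl.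
have h := HB _ B1 _ TO; rewrite /= in h.
have := ler_normB (O + (L / `|n|) *: n) O; rewrite addrC addKr normrZ.
have L0 : 0 <= L by rewrite /L !addr_ge0.
rewrite ger0_norm ?divr_ge0 ?(ltW nn) // mulfVK ?gt_eqF //.
have := ler_norm (B + 1); rewrite /L => h1 h2.
apply: (@lt_irrefl_false R); lra.
Qed.

(* T is parametrized conformally by F, and the isometry [m], with linear part
   M and fixed point O, lifts to the anticonformal map [h] of the plane. *)
Definition reversing_symmetry (R : realType) (hyp : bool) (T : set (E3 R))
    (N : E3 R -> E3 R) (F : CC R -> E3 R) (h : CC R -> CC R)
    (m : E3 R -> E3 R) (M : 'M[R]_3) (O : E3 R) : Prop :=
  [/\ classical_riemann_surface T N,
      forall z, plane R hyp z -> T (F z),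
      forall y, T y -> exists2 z, plane R hyp z & F z = y &
      forall z, plane R hyp z -> conformal_at N F z] /\
  [/\ conformal_plane_map hyp true h,
      forall z, plane R hyp z -> m (F z) = F (h z),
      forall x, T x <-> T (m x) &
      m O = O] /\
  [/\ forall x y, m x = m y + (x - y) *m M,
      M *m M^T = 1%:M & M *m M = 1%:M].

Lemma param_tangent_frame (R : realType) hyp (T : set (E3 R)) (N : E3 R -> E3 R)
    (F : CC R -> E3 R) :
  unit_normal T N -> (forall z, plane R hyp z -> T (F z)) ->
  (forall y, T y -> exists2 z, plane R hyp z & F z = y) ->
  (forall z, plane R hyp z -> conformal_at N F z) -> tangent_frame T N.
Proof.
move=> HN FT TF HC y /TF[z zP <-].
by have [a [a0 _ t1 t2 _]] := param_tangent HN FT zP (HC _ zP); exists a.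
Qed.

(** A half-turn preserves cross products, so an anticonformal one reverses the normal and exchanges
    the sides of T. *)
Lemma rotation_fixpoint (R : realType) hyp T N F h (m : E3 R -> E3 R) M O
    (n : E3 R) :
  reversing_symmetry hyp T N F h m M O -> dot3 n n = 1 ->
  (forall x : E3 R, x *m M = (2 * dot3 n x) *: n - x) ->
  forall x, m x = x -> T x.
Proof.
move=> [[crs FT TF HC] [[Hh mF mT mO] [Hm MMT MM]]] n1 HM x.
have [_ Tcpt _ _ HN] := crs.
apply: (side_reversing_isometry crs (param_tangent_frame HN FT TF HC) Hm mT).
move=> y /TF[z zP <-].
rewrite (reversing_normal HN FT HC Hh mF Hm MMT (rotation_cross_sign n1 HM) _ zP).
  by rewrite scale1r.
by rewrite mulr1.
Qed.

(** At a fixed point on T the normal satisfies the formula of [reversing_normal]. Both for the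
    identity and for its opposite this says that a unit vector equals its own opposite. A half-turn
    would have its whole axis on the compact T. Only reflections remain. *)
Lemma reversal_with_fixpoint (R : realType) hyp T N F h (m : E3 R -> E3 R) M O z0 :
  reversing_symmetry hyp T N F h m M O ->
  plane R hyp z0 -> m (F z0) = F z0 ->
  exists2 n : E3 R, dot3 n n = 1 & forall x : E3 R, x *m M = x - (2 * dot3 n x) *: n.
Proof.
move=> Hrev z0P mz0; have [[crs FT TF HC] [[Hh mF mT mO] [Hm MMT MM]]] := Hrev.
have [_ Tcpt _ _ HN] := crs; have [_ N1 _] := HN.
have normal k : cross_sign M k -> k * k = 1 ->
    N (F z0) = - (k *: (N (F z0) *m M)).
  by move=> Hk kk; rewrite -{1}mz0 (reversing_normal HN FT HC Hh mF Hm MMT Hk kk z0P).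
have contra (u : E3 R) : dot3 u u = 1 -> u = - u -> False.
  move=> u1 E; have : dot3 u u = - dot3 u u by rewrite {1}E dot3N.
  by rewrite u1 => h1; apply: (@lt_irrefl_false R); lra.
have [HM|[n [n1 nM]]] := orth_involution_axis MM.
  exfalso; apply: (contra _ (N1 _ (FT _ z0P))).
  rewrite {1}(normal _ (cross_signN1 HM)) ?mulrNN ?mulr1 //.
  by rewrite HM scaleN1r !opprK.
have [HM|HM|//] := orth_involution_fixing MMT MM n1 nM.
  exfalso; apply: (contra _ (N1 _ (FT _ z0P))).
  by rewrite {1}(normal _ (cross_sign1 HM)) ?mulr1 // HM scale1r.
have n0 : n != 0.
  by apply: contra_eq_neq n1 => ->; rewrite dot30 eq_sym oner_neq0.
have [t Ht] := fixpoint_off_compact O Tcpt n0.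
exfalso; apply/Ht/(rotation_fixpoint Hrev n1 HM).
by rewrite (Hm _ O) mO (addrC O (t *: n)) addrK -scalemxAl nM addrC.
Qed.

(** The identity fixes every point of T, and a half-turn has its centre [O] on T. For a reflection,
    the signed height [g] over the mirror is odd under [m], so it vanishes somewhere on the
    connected T. *)
Lemma reversal_fixing_axis (R : realType) hyp T N F h (m : E3 R -> E3 R) M O
    (n : E3 R) :
  reversing_symmetry hyp T N F h m M O ->
  dot3 n n = 1 -> n *m M = n -> exists2 y, T y & m y = y.
Proof.
move=> Hrev n1 nM; have [[crs FT TF HC] [[Hh mF mT mO] [Hm MMT MM]]] := Hrev.
have [[y0 Ty0] Tcpt Tconn _ HN] := crs.
have [HM|HM|[u u1 HM]] := orth_involution_fixing MMT MM n1 nM.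
- by exists y0 => //; rewrite (Hm y0 O) mO HM addrC subrK.
- by exists O => //; exact: (rotation_fixpoint Hrev n1 HM).
pose g y := dot3 u (y - O).
have gm y : g (m y) = - g y.
  rewrite /g (Hm y O) mO addrC addKr HM !dot3_lin u1; ring.
have [y Ty gy] : exists2 y, T y & g y = 0.
  have gc : continuous g.
    move=> y; have -> : g = (fun y => dot3 u y - dot3 u O).
      by apply/funext => w; rewrite /g dot3Br.
    exact: (cvgB (@dot3_continuous _ u y) (cvg_cst _)).
  have := connected_continuous_connected Tconn (continuous_subspaceT gc).
  move=> /connected_intervalP Hint.
  have a1 : (g @` T) (g y0) by exists y0.
  have a2 : (g @` T) (- g y0) by exists (m y0); [exact: (mT y0).1 | exact: gm].
  have [h0|h0] := leP 0 (g y0).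
    have := Hint _ _ a2 a1 0; rewrite oppr_le0 h0 => /(_ isT)[y Ty E].
    by exists y.
  have := Hint _ _ a1 a2 0; rewrite oppr_ge0 (ltW h0) => /(_ isT)[y Ty E].
  by exists y.
exists y => //; rewrite (Hm y O) mO HM.
by rewrite -/(g y) gy mulr0 scale0r subr0 addrC subrK.
Qed.

(** * Orbits of the kernel, the group C_2 x C_2, and the contradiction *)

Lemma unit_normalN (R : realType) (T : set (E3 R)) (N : E3 R -> E3 R) :
  unit_normal T N -> unit_normal T (fun y => - N y).
Proof.
move=> [Nc N1 Nt]; split.
- by move=> x; apply: cvgN; exact: Nc.
- by move=> y Ty; rewrite dot3N dot3Nr opprK N1.
- by move=> y v Ty tv; rewrite dot3N Nt // oppr0.
Qed.

(* An element of the group that moves [z] within its [ker omega]-orbit can be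
   corrected by [ker omega] to fix [z]. *)
Lemma orbit_fixpoint (R : realType) hyp (Gamma : groupType)
    (rho : Gamma -> CC R -> CC R) (omega : {multiplicative Gamma -> C2xC2})
    (D : topologicalType) (q : CC R -> D) x z :
  crystallographic hyp rho ->
  orbit_space (plane R hyp) rho [set y | omega y = 1%g] q ->
  plane R hyp z -> q (rho x z) = q z ->
  exists y, omega y = omega x /\ rho y z = z.
Proof.
move=> Hcr [_ Hq _] zP Eq; have [[H1 HM _ _] _] := Hcr.
have [b Hb] := crystallographic_conformal x Hcr.
have [xP _] := Hb _ zP.
have [l wl El] := (Hq _ _ xP zP).1 Eq.
by exists (l * x)%g; rewrite gmulfM wl mul1g HM.
Qed.

Lemma C2xC2_mulC (a b : C2xC2) : (a * b = b * a)%g.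
Proof.
have Z2C (x y : 'Z_2) : (x * y = y * x)%g.
  by case: (Z2_cases x) => ->; rewrite ?mul1g ?mulg1 //;
     case: (Z2_cases y) => ->; rewrite ?mul1g ?mulg1.
by case: a b => [a1 a2] [b1 b2]; exact: (congr2 pair (Z2C a1 b1) (Z2C a2 b2)).
Qed.

Lemma gen_sK : (gen_s * gen_s = 1)%g.
Proof. by apply/eqP; rewrite /eq_op. Qed.

Lemma gen_tK : (gen_t * gen_t = 1)%g.
Proof. by apply/eqP; rewrite /eq_op. Qed.

Lemma C2xC2_cases (a : C2xC2) :
  [\/ a = 1%g, a = gen_s, a = gen_t | a = (gen_s * gen_t)%g].
Proof.
case: a => a1 a2.
case: (Z2_cases a1) => ->; case: (Z2_cases a2) => ->.
- exact: Or41.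
- exact: Or43.
- exact: Or42.
- by apply: Or44; apply/eqP; rewrite /eq_op.
Qed.

Theorem mainTheorem5 (R : realType)
  (X : topologicalType) (A : set (chart R X))
  (hX : klein_surface A) (hnonor : ~ orientable A)
  (hbd : klein_boundary A !=set0)
  (g k : nat) (hg : (1 <= g)%N) (hk : (1 <= k)%N)
  (Gamma : groupType) (rho : Gamma -> CC R -> CC R)
  (d : 'I_g -> Gamma) (e c : 'I_k -> Gamma)
  (hGamma : klein_surface_group rho d e c)
  (p : CC R -> X)
  (hp : klein_quotient (plane R (hyperbolic_type g k)) rho A p)
  (omega : {multiplicative Gamma -> C2xC2}) (homega : doubling_hom d e c omega)
  (DX : topologicalType) (q : CC R -> DX)
  (hq : orbit_space (plane R (hyperbolic_type g k)) rho
          [set x | omega x = 1%g] q)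
  (act : C2xC2 -> DX -> DX)
  (hact : induced_action (plane R (hyperbolic_type g k)) rho omega q act) :
  ~ exists (T : set (E3 R)) (N : E3 R -> E3 R)
      (G : set (E3 R -> E3 R)) (f : DX -> E3 R),
    [/\ classical_riemann_surface T N,
        finite_isometry_group G /\ (forall gamma, G gamma -> gamma @` T = T),
        homeomorphism_onto T f /\
        conformal_or_anticonformal (plane R (hyperbolic_type g k)) q N f &
        (* f <s,t> f^-1 = G restricted to T, both sides composed with f *)
        [set f \o act a | a in [set: C2xC2]] =
        [set gamma \o f | gamma in G]].
Proof.
move=> [T [N0 [G [f [crs0 [HG GT] [[_ frange [f' fK _]] Hconf] HGact]]]]].
set hyp := hyperbolic_type g k in hp hq hact Hconf.
have [[Hcr _ Hpres] [_ _ Hrefl]] := hGamma.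
have [[rho1 rhoM _ _] _] := Hcr.
have [Hsurj Hq _] := hq.
have parity := klein_group_parity hGamma homega.
have free x z : conformal_plane_map hyp false (rho x) -> plane R hyp z ->
    rho x z = z -> x = 1%g.
  by move=> Hx zP xz; exact: (klein_group_free hGamma Hx zP xz).
pose F := f \o q.
(* An anticonformal [f] becomes conformal when the orientation of T is reversed. *)
have [N [crs HC]] : exists N, classical_riemann_surface T N /\
    forall z, plane R hyp z -> conformal_at N F z.
  case: Hconf => HC; first by exists N0.
  exists (fun y => - N0 y); split=> //.
  by have [? ? ? ? ?] := crs0; split=> //; exact: unit_normalN.
have FT z : plane R hyp z -> T (F z) by rewrite -frange; exists (q z).
have TF y : T y -> exists2 z, plane R hyp z & F z = y.
  by rewrite -frange => -[x _ <-]; have [z zP <-] := Hsurj x; exists z.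
have rhoP x z : plane R hyp z -> plane R hyp (rho x z).
  by move=> zP; have [] := parity x z zP.
have Fact x z : plane R hyp z -> F (rho x z) = f (act (omega x) (q z)).
  by move=> zP; rewrite hact.
have Fomega x y z : plane R hyp z -> omega x = omega y -> F (rho x z) = F (rho y z).
  by move=> zP E; rewrite !Fact // E.
have Fker x z : plane R hyp z -> omega x = 1%g -> F (rho x z) = F z.
  by move=> zP E; rewrite (Fomega x 1%g) ?rho1 // multiplicative1.
have Ffix x z : plane R hyp z -> F (rho x z) = F z ->
    exists y, omega y = omega x /\ rho y z = z.
  move=> zP /(can_inj fK) E; exact: (orbit_fixpoint Hcr hq zP E).
have realize x : exists m (M : 'M[R]_3), [/\ forall z, plane R hyp z -> m (F z) = F (rho x z),
    forall y, T y <-> T (m y), M *m M^T = 1%:M &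
    forall u v, m u = m v + (u - v) *m M].
  have [m Gm Em] : [set gamma \o f | gamma in G] (f \o act (omega x)).
    by rewrite -HGact; exists (omega x).
  have [[_ Giso _] _] := HG; have iso := Giso _ Gm.
  have [M [MMT Hm]] := isometry3_affine iso.
  exists m, M; split=> //.
    by move=> z zP; rewrite Fact // -[RHS]/((f \o act (omega x)) (q z)) -Em.
  move=> y; split=> [Ty|]; first by rewrite -(GT _ Gm); exists y.
  by rewrite -{1}(GT _ Gm) => -[y' Ty' /(isometry3_inj iso) <-].
pose xs := c (Ordinal hk); pose xt := d (Ordinal hg).
have [od _ oc] := homega.
have ws : omega xs = gen_s by exact: oc.
have wt : omega xt = gen_t by exact: od.
have [ms [As [mF_s Tms AAT Hms]]] := realize xs.
have [mt [Bt [mF_t Tmt BBT Hmt]]] := realize xt.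
have conf_s : conformal_plane_map hyp true (rho xs) by have := parity xs; rewrite ws.
have conf_t : conformal_plane_map hyp true (rho xt) by have := parity xt; rewrite wt.
have mss y : T y -> ms (ms y) = y.
  move=> /TF[z zP <-]; rewrite mF_s // mF_s; last exact: rhoP.
  by rewrite -rhoM // Fker // gmulfM ws gen_sK.
have mtt y : T y -> mt (mt y) = y.
  move=> /TF[z zP <-]; rewrite mF_t // mF_t; last exact: rhoP.
  by rewrite -rhoM // Fker // gmulfM wt gen_tK.
have mst y : T y -> ms (mt y) = mt (ms y).
  move=> /TF[z zP <-]; rewrite (mF_t _ zP) (mF_s _ zP).
  rewrite (mF_s _ (rhoP _ _ zP)) (mF_t _ (rhoP _ _ zP)) -!rhoM //.
  by apply: Fomega => //; rewrite !gmulfM C2xC2_mulC.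
have [[y0 Ty0] _ _ _ HN] := crs.
(* On T the two isometries are commuting involutions, so they permute these four points and, being
   affine, fix their centroid. *)
pose O := (4 : R)^-1 *: (y0 + ms y0 + mt y0 + ms (mt y0)).
have Tt0 : T (mt y0) by exact: (Tmt y0).1.
have Ts0 : T (ms y0) by exact: (Tms y0).1.
have msO : ms O = O.
  rewrite /O (affine_centroid _ _ _ _ Hms) !mss //; congr (_ *: _).
  by apply/rowP => i; rewrite !mxE; ring.
have mtO : mt O = O.
  rewrite /O (affine_centroid _ _ _ _ Hmt) mtt // -!mst // mtt //; congr (_ *: _).
  by apply/rowP => i; rewrite !mxE; ring.
have sA y : (y - O) *m As = ms y - O by rewrite (Hms y O) msO [RHS]addrC addKr.
have tB y : (y - O) *m Bt = mt y - O by rewrite (Hmt y O) mtO [RHS]addrC addKr.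
have mx0 (M : 'M[R]_3) : (forall y, T y -> (y - O) *m M = 0) -> M = 0.
  exact: (surface_mulmx_eq0 crs FT TF HC).
have AA : As *m As = 1%:M.
  apply/eqP; rewrite -subr_eq0; apply/eqP/mx0 => y Ty.
  by rewrite mulmxBr mulmx1 mulmxA !sA mss // subrr.
have BB : Bt *m Bt = 1%:M.
  apply/eqP; rewrite -subr_eq0; apply/eqP/mx0 => y Ty.
  by rewrite mulmxBr mulmx1 mulmxA !tB mtt // subrr.
have AB : As *m Bt = Bt *m As.
  apply/eqP; rewrite -subr_eq0; apply/eqP/mx0 => y Ty.
  by rewrite mulmxBr !mulmxA (sA y) (tB y) sA tB mst // subrr.
have rev_s : reversing_symmetry hyp T N F (rho xs) ms As O by [].
have rev_t : reversing_symmetry hyp T N F (rho xt) mt Bt O by [].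
(* A canonical reflection has a fixed point in the plane, which gives a fixed point of [ms] on T. *)
have [n n1 HA] : exists2 n : E3 R, dot3 n n = 1 &
    forall x : E3 R, x *m As = x - (2 * dot3 n x) *: n.
  have [_ [z0 z0P xz0]] := Hrefl (Ordinal hk).
  by apply: (reversal_with_fixpoint rev_s z0P); rewrite mF_s // /xs xz0.
(* A fixed point of [mt] on T lifts to a fixed point of some [x] over t. Its square is conformal
   with a fixed point, hence trivial, which is impossible for an element with nontrivial
   t-component. *)
have tfree y : T y -> mt y = y -> False.
  move=> /TF[z zP <-]; rewrite mF_t // => /(Ffix _ _ zP)[x [wx xz]].
  have Hx : conformal_plane_map hyp true (rho x) by have := parity x; rewrite wx wt.
  have Hxx : conformal_plane_map hyp false (rho (x * x)%g).
    by apply: (conformal_comp Hx Hx) => w wP; exact: rhoM.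
  have xx : (x * x = 1)%g by apply: (free _ z) => //; rewrite rhoM // !xz.
  by have := involution_t_component hk Hpres homega xx; rewrite wx wt.
have nA : n *m As = - n.
  by rewrite HA n1 mulr1 -[2]/(1 + 1) scalerDl scale1r opprD addNKr.
(* [Bt] commutes with [As], so it preserves the eigenspace of [As] for -1, which is the line spanned
   by [n]. *)
have nB : n *m Bt = dot3 n (n *m Bt) *: n.
  have : (n *m Bt) *m As = - (n *m Bt) by rewrite -mulmxA -AB mulmxA nA mulNmx.
  rewrite HA => /eqP; rewrite subr_eq addrC -subr_eq opprK -mulr2n -scaler_nat.
  move=> /eqP/(congr1 (fun x => (2 : R)^-1 *: x)).
  by rewrite !scalerA mulrA mulVf ?pnatr_eq0 // !mul1r scale1r.
pose l := dot3 n (n *m Bt); rewrite -/l in nB.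
have l2 : l * l = 1.
  have := dot3_mulmx n n BBT; rewrite nB !dot3_lin n1; by rewrite mulr1.
have /eqP : (l - 1) * (l + 1) = 0.
  by rewrite mulrDr mulr1 mulrBl l2 mul1r addrA subrK subrr.
rewrite mulf_eq0 subr_eq0 addr_eq0 => /orP[/eqP l1|/eqP l1].
  rewrite l1 scale1r in nB.
  by have [y Ty] := reversal_fixing_axis rev_t n1 nB; exact: tfree.
rewrite l1 scaleN1r in nB; apply: hnonor.
(* The signed height of [F z] over the mirror of [ms]; as both linear parts send [n] to its
   opposite, s and t change its sign. *)
pose zeta z := dot3 n (F z - O).
have zs z : plane R hyp z -> zeta (rho xs z) = - zeta z.
  move=> zP; rewrite /zeta -mF_s // -sA -{1}(opprK n) -nA -mulNmx.
  by rewrite dot3_mulmx // dot3N.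
have zt z : plane R hyp z -> zeta (rho xt z) = - zeta z.
  move=> zP; rewrite /zeta -mF_t // -tB -{1}(opprK n) -nB -mulNmx.
  by rewrite dot3_mulmx // dot3N.
apply: (@sign_orientable _ hyp Gamma rho X A p zeta) => //; last by exists xs.
split.
- move=> z zP eps eps0.
  have [a [_ Ha _ _ _]] := param_tangent HN FT zP (HC _ zP).
  have K0 : 0 < 1 + 3 * `|n| by rewrite ltr_pwDl // mulr_ge0.
  have [r r0 Hr] := rdiff_cts Ha (divr_gt0 eps0 K0).
  exists r => // w /Hr; rewrite ltr_pdivlMr // => h.
  rewrite /zeta -dot3Br opprB addrA subrK; apply: le_lt_trans (dot3_bound _ _) _.
  apply: le_lt_trans h; rewrite mulrC ler_wpM2l //.
  by rewrite lerDr.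
- move=> b x z zP Hb; have -> := conformal_parity zP Hb (parity x).
  have zomega y : omega x = omega y -> zeta (rho x z) = zeta (rho y z).
    by move=> E; rewrite /zeta (Fomega x y).
  (* Since [F (rho x z)] depends on [x] only through [omega x], four representatives suffice; for st
     the two sign changes cancel. *)
  have [E|E|E|E] := C2xC2_cases (omega x); rewrite E.
  + by rewrite /zeta Fker // mul1r.
  + by rewrite (zomega xs) ?ws // zs // expr1 mulN1r.
  + by rewrite (zomega xt) ?wt // zt // expr1 mulN1r.
  + rewrite (zomega (xs * xt)%g) ?gmulfM ?ws ?wt // rhoM // zs; last exact: rhoP.
    by rewrite zt // opprK mul1r.
(* A zero of [zeta] is a point with [F z] on the mirror, so [ms] fixes [F z]; a correction by the
   kernel of [omega] turns [xs] into an orientation-reversing element fixing [z] itself. *)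
- move=> z zP z0; have Hfix : ms (F z) = F z.
    apply: (addIr (- O)); rewrite -sA HA.
    by rewrite -/(zeta z) z0 mulr0 scale0r subr0.
  rewrite mF_s // in Hfix; have [y [wy yz]] := Ffix _ _ zP Hfix.
  by exists y => //; have := parity y; rewrite wy ws.
Qed.
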